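(* Let $N\ge2$ and let $\Omega\subset\mathbb{R}^N$ be a bounded and smooth domain with distance function to the boundary $\rho(x)=\inf_{y\in\partial\Omega}|y-x|$. For each $p>N$ let $u_p$ denote a positive extremal function of $\Lambda_p(\Omega)$ and $x_p$ its unique maximum point. Let $p_n\to\infty$, $x_*\in\Omega$ and $u_\infty\in W_0^{1,\infty}(\Omega)$ be such that: (a) $u_{p_n}\to u_\infty$ weakly in $W_0^{1,r}(\Omega)$ for any $r>N$ and uniformly in $\overline\Omega$; (b) $\|\nabla u_\infty\|_\infty=1/\|\rho\|_\infty$; (c) $0\le u_\infty\le\rho/\|\rho\|_\infty$ a.e. in $\Omega$; (d) $x_{p_n}\to x_*$; (e) $u_\infty(x_* )=1=\|u_\infty\|_\infty$ and $\rho(x_* )=\|\rho\|_\infty$. Then $u_\infty=\dfrac{\rho}{\|\rho\|_\infty}$ in $\overline\Omega$ if, and only if, both of the following hold: (i) $\rho$ has a unique maximum point, say $x_0$; and (ii) for each $x\in\Omega\setminus\{x_0\}$ there exists a unique $y_x\in\partial\Omega$ such that $|x-y_x|=\rho(x)$.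
   Context: $\|\cdot\|_s$ denotes the norm of $L^s(\Omega)$. For $p>N$, $\Lambda_p(\Omega)=\min\{\|\nabla u\|_p^p:u\in W_0^{1,p}(\Omega),\ \|u\|_\infty=1\}$. A positive extremal function of $\Lambda_p(\Omega)$ is a function $u_p\in W_0^{1,p}(\Omega)$ with $u_p>0$ in $\Omega$, $\|u_p\|_\infty=1$ and $\|\nabla u_p\|_p^p=\Lambda_p(\Omega)$; such functions exist, are continuous on $\overline\Omega$, and have a unique maximum point $x_p\in\Omega$. Data $(p_n),x_*,u_\infty$ satisfying (a)–(e) always exist. *)

(* Defs.v *)
From HB Require Import structures.
From mathcomp Require Import all_boot all_order all_algebra.
From mathcomp Require Import all_classical all_reals all_analysis.

Set Implicit Arguments.
Unset Strict Implicit.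
Unset Printing Implicit Defensive.

Import Order.TTheory GRing.Theory Num.Theory.
Import numFieldNormedType.Exports.

Local Open Scope classical_set_scope.
Local Open Scope ring_scope.

(* R^N is 'rV[R]_N. Its library norm is the sup norm, used only through the usual
   topology, boundedness and derivatives; lengths use the Euclidean norm. *)
Definition enorm (R : realType) (N : nat) (x : 'rV[R]_N) : R :=
  Num.sqrt (\sum_(i < N) x 0 i ^+ 2).

Definition bdry (T : topologicalType) (A : set T) : set T :=
  closure A `\` interior A.

(* 'rV[R]_N carries the product sigma-algebra, i.e. the Borel one. *)
Definition rV_display : measure_display. Proof. exact. Qed.

Section rV_measurable.
Variables (R : realType) (N : nat).

Definition rV_coord (i : 'I_N) (v : 'rV[R]_N) : measurableTypeR R := v 0 i.

Let rV_set0 : g_sigma_preimage rV_coord set0.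
Proof. exact: sigma_algebra0. Qed.

Let rV_setC A : g_sigma_preimage rV_coord A -> g_sigma_preimage rV_coord (~` A).
Proof. exact: sigma_algebraC. Qed.

Let rV_bigcup (F : (set 'rV[R]_N)^nat) :
  (forall i, g_sigma_preimage rV_coord (F i)) ->
  g_sigma_preimage rV_coord (\bigcup_i (F i)).
Proof. exact: sigma_algebra_bigcup. Qed.

HB.instance Definition _ := @isMeasurable.Build rV_display
  'rV[R]_N (g_sigma_preimage rV_coord) rV_set0 rV_setC rV_bigcup.

Lemma measurable_rV_coord (i : 'I_N) : measurable_fun setT (rV_coord i).
Proof.
move=> _ Y mY; rewrite setTI; apply: sub_sigma_algebra => /=.
rewrite -bigcup_seq/=; exists i => /=; first by rewrite mem_index_enum.
by exists Y => //; rewrite setTI.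
Qed.

Lemma measurable_fun_rV d (T : measurableType d) (f : T -> 'rV[R]_N) :
  (forall i, measurable_fun setT (rV_coord i \o f)) -> measurable_fun setT f.
Proof.
move=> mf; move=> _ A mA.
have : preimage_set_system setT f (g_sigma_preimage rV_coord) (setT `&` f @^-1` A).
  by exists A.
rewrite -g_sigma_preimage_comp; apply: smallest_sub.
  exact: sigma_algebra_measurable.
move=> B; rewrite -bigcup_seq => -[i _ [C mC <-]].
exact: mf.
Qed.

End rV_measurable.

Section lebesgue_step.
Variables (R : realType) (N : nat).
Variable m : {sigma_finite_measure set 'rV[R]_N -> \bar R}.

Definition rV_cons (xv : measurableTypeR R * 'rV[R]_N) : 'rV[R]_N.+1 :=
  \row_i oapp (fun j => xv.2 0 j) xv.1 (unlift ord0 i).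

Definition rV_uncons (v : 'rV[R]_N.+1) : measurableTypeR R * 'rV[R]_N :=
  (v 0 ord0, \row_j v 0 (lift ord0 j)).

Lemma rV_unconsK : cancel rV_uncons rV_cons.
Proof.
move=> v; apply/rowP => i; rewrite mxE.
by case: unliftP => [j|] -> //=; rewrite mxE.
Qed.

Lemma rV_consK : cancel rV_cons rV_uncons.
Proof.
move=> [x v]; congr pair; rewrite ?mxE ?unlift_none//.
by apply/rowP => j; rewrite !mxE liftK.
Qed.

Lemma measurable_rV_cons : measurable_fun setT rV_cons.
Proof.
apply: measurable_fun_rV => i; case: (unliftP ord0 i) => [j|] ->.
- have -> : rV_coord (lift ord0 j) \o rV_cons = rV_coord j \o snd.
    by apply/funext => xv; rewrite /rV_coord /= mxE liftK.
  by apply: measurableT_comp => //; exact: measurable_rV_coord.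
- have -> : rV_coord ord0 \o rV_cons = fst.
    by apply/funext => xv; rewrite /rV_coord /= mxE unlift_none.
  exact: measurable_fst.
Qed.

Lemma measurable_rV_uncons : measurable_fun setT rV_uncons.
Proof.
apply/measurable_fun_pairP; split; first exact: (measurable_rV_coord ord0).
apply: measurable_fun_rV => j.
have -> : rV_coord j \o (snd \o rV_uncons) = rV_coord (lift ord0 j).
  by apply/funext => v; rewrite /rV_coord /= mxE.
exact: measurable_rV_coord.
Qed.

Definition lebesgue_succ : set 'rV[R]_N.+1 -> \bar R :=
  pushforward (@lebesgue_measure R \x m)%E rV_cons.

Let lebesgue_succ0 : lebesgue_succ set0 = 0%E.
Proof. by rewrite /lebesgue_succ /pushforward preimage_set0 measure0. Qed.

Let lebesgue_succ_ge0 A : (0 <= lebesgue_succ A)%E.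
Proof. by apply: integral_ge0 => // *. Qed.

Let lebesgue_succ_sigma_additive : semi_sigma_additive lebesgue_succ.
Proof.
move=> F mF tF mUF; rewrite /lebesgue_succ /pushforward preimage_bigcup.
have mp A : measurable A -> measurable (rV_cons @^-1` A).
  by move=> mA; rewrite -[X in measurable X]setTI; exact: measurable_rV_cons.
apply: measure_semi_sigma_additive.
- by move=> n; exact: mp.
- apply/trivIsetP => /= i j _ _ ij; rewrite -preimage_setI.
  by move/trivIsetP : tF => /(_ _ _ _ _ ij) ->//; rewrite preimage_set0.
- by rewrite -preimage_bigcup; exact: mp.
Qed.

HB.instance Definition _ := isMeasure.Build _ _ _ lebesgue_succ
  lebesgue_succ0 lebesgue_succ_ge0 lebesgue_succ_sigma_additive.

Let lebesgue_succ_sigma_finite : sigma_finite setT lebesgue_succ.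
Proof.
have [F FT Foo] : sigma_finite setT (@lebesgue_measure R \x m)%E.
  have /sigma_finiteP[F [TF ndF Foo]] := sigma_finiteT (@lebesgue_measure R).
  have /sigma_finiteP[G [TG ndG Goo]] := sigma_finiteT m.
  exists (fun n => F n `*` G n).
    rewrite -setXTT TF TG predeqE => -[x y]; split.
      move=> [/= [n _ Fnx] [k _ Gky]]; exists (maxn n k) => //; split.
      - by move: x Fnx; exact/subsetPset/ndF/leq_maxl.
      - by move: y Gky; exact/subsetPset/ndG/leq_maxr.
    by move=> [n _ []/= ? ?]; split; exists n.
  move=> k; have [? ?] := Foo k; have [? ?] := Goo k.
  split; first exact: measurableX.
  by rewrite product_measure1E// lte_mul_pinfty// ge0_fin_numE.
exists (fun n => rV_uncons @^-1` F n).
  by rewrite -preimage_bigcup -FT preimage_setT.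
move=> n; have [mF Foo'] := Foo n; split.
  by rewrite -[X in measurable X]setTI; exact: measurable_rV_uncons.
rewrite /lebesgue_succ /pushforward -comp_preimage.
by rewrite (_ : rV_uncons \o rV_cons = id)//; apply/funext => xv; exact: rV_consK.
Qed.

HB.instance Definition _ := Measure_isSigmaFinite.Build _ _ _ lebesgue_succ
  lebesgue_succ_sigma_finite.

End lebesgue_step.

Fixpoint lebesgueN (R : realType) (N : nat) :
    {sigma_finite_measure set 'rV[R]_N -> \bar R} :=
  match N with
  | 0 => \d_(0 : 'rV[R]_0)
  | N'.+1 => lebesgue_succ (lebesgueN R N')
  end.

Lemma lebesgueN_box (R : realType) (N : nat) (a b : 'I_N -> R) : (forall i, a i <= b i) ->
  lebesgueN R N [set v | forall i, a i < v 0 i <= b i] = (\prod_i (b i - a i))%:E.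
Proof.
elim: N a b => [|N IH] a b ab /=.
  rewrite big_ord0 diracE mem_set//; by case.
rewrite /lebesgue_succ /pushforward.
set A := (X in (_ \x _)%E X).
have -> : A = `]a ord0, b ord0]%classic `*` [set v : 'rV[R]_N | forall i : 'I_N, a (lift ord0 i) < v 0 i <= b (lift ord0 i)].
  apply/seteqP; split => [[x v] /= H|[x v] /= [H1 H2] i].
    split; [have := H ord0|move=> i; have := H (lift ord0 i)]; rewrite !mxE ?unlift_none ?liftK//=.
  rewrite !mxE; case: (unliftP ord0 i) => [j|] ->; [exact: H2|by move: H1; rewrite in_itv].
rewrite product_measure1E//.
  rewrite IH//. rewrite -[X in (X * _)%E]/(lebesgue_measure [set` `]a ord0, b ord0]%R]) lebesgue_measure_itv/= big_ord_recl.
  rewrite lte_fin; have := ab ord0; rewrite le_eqVlt => /predU1P[->|h].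
    by rewrite ltxx mul0e subrr mul0r.
  by rewrite h -EFinD -EFinM.
rewrite (_ : mkset _ = \bigcap_(i in [set: 'I_N]) ((rV_coord i) @^-1` `]a (lift ord0 i), b (lift ord0 i)]%classic)).
  apply: fin_bigcap_measurable => // i _.
  rewrite -[X in measurable X]setTI; exact: measurable_rV_coord.
apply/seteqP; split => [v /= H i _|v /= H i]; rewrite /=; first by rewrite in_itv; exact: H.
by have := H i I; rewrite /= in_itv.
Qed.

Section sobolev.
Variables (R : realType) (N : nat).
Local Notation V := 'rV[R]_N.
Local Notation mu := (lebesgueN R N).
Implicit Types (Omega : set V) (u v f phi : V -> R) (g : V -> V).

Definition partial (i : 'I_N) f : V -> R := 'D_(delta_mx 0 i : V) f.

Definition cinfty f : Prop := forall s : seq 'I_N,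
  continuous (foldr partial f s) /\
  forall (i : 'I_N) (x : V), derivable (foldr partial f s) x (delta_mx 0 i).

Definition test_fun Omega phi : Prop :=
  [/\ cinfty phi, compact (closure [set x | phi x != 0])
    & closure [set x | phi x != 0] `<=` Omega].

Definition loc_integrable Omega f : Prop :=
  measurable_fun Omega f /\
  forall K, compact K -> K `<=` Omega -> mu.-integrable K (EFin \o f).

Definition is_weak_grad Omega u g : Prop :=
  [/\ loc_integrable Omega u, forall i : 'I_N, loc_integrable Omega (fun x => g x 0 i)
    & forall phi (i : 'I_N), test_fun Omega phi ->
      \int[mu]_(x in Omega) (u x * partial i phi x) =
      - \int[mu]_(x in Omega) (g x 0 i * phi x)].

(* well defined up to a.e. equality *)
Definition wgrad Omega u : V -> V := get (is_weak_grad Omega u).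

Definition normLp Omega (p : \bar R) f : \bar R := 'N[mu]_p[EFin \o (f \_ Omega)].

Definition normgrad Omega (p : \bar R) u : \bar R :=
  normLp Omega p (fun x => enorm (wgrad Omega u x)).

Definition W1 (p : \bar R) Omega : set (V -> R) :=
  [set u | [/\ measurable_fun Omega u, exists g, is_weak_grad Omega u g,
              (normLp Omega p u < +oo)%E & (normgrad Omega p u < +oo)%E]].

Definition normW1 Omega (p : \bar R) u : \bar R := (normLp Omega p u + normgrad Omega p u)%E.

Definition W10 (p : R) Omega : set (V -> R) :=
  [set u | W1 p%:E Omega u /\
     exists phi : (V -> R)^nat, (forall k, test_fun Omega (phi k)) /\
       normW1 Omega p%:E (fun x => u x - phi k x) @[k --> \oo] --> 0%E].

(* The closure of C_c^oo in W^{1,oo} would only contain C^1 functions; as usual,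
   W_0^{1,oo}(Omega) is the intersection of W^{1,oo}(Omega) and W_0^{1,1}(Omega). *)
Definition W10oo Omega : set (V -> R) := W1 +oo%E Omega `&` W10 1 Omega.

Definition W10_dual (p : R) Omega (l : (V -> R) -> R) : Prop :=
  (forall (a : R) u v, W10 p Omega u -> W10 p Omega v ->
     l (fun x => a * u x + v x) = a * l u + l v) /\
  exists C : R, forall u, W10 p Omega u -> (`|l u|%:E <= C%:E * normW1 Omega p%:E u)%E.

(* Finitely many terms of the sequence may lie outside W_0^{1,p}(Omega). *)
Definition weak_cvg_W10 (p : R) Omega (w : (V -> R)^nat) u : Prop :=
  [/\ \forall k \near \oo, W10 p Omega (w k), W10 p Omega u
    & forall l, W10_dual p Omega l -> l (w k) @[k --> \oo] --> l u].

Definition Lambda (p : R) Omega : \bar R :=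
  ereal_inf [set (normgrad Omega p%:E u `^ p)%E |
    u in [set u | W10 p Omega u /\ normLp Omega +oo%E u = 1%E]].

(* Elements of W_0^{1,p}(Omega), p > N, are identified with their continuous
   representative on the closure of Omega. An extremal attains the infimum Lambda,
   which is then a minimum. *)
Definition positive_extremal (p : R) Omega u : Prop :=
  [/\ W10 p Omega u, {within closure Omega, continuous u}, forall x, Omega x -> 0 < u x,
      normLp Omega +oo%E u = 1%E & (normgrad Omega p%:E u `^ p)%E = Lambda p Omega].

Definition is_max_point (A : set V) f (x : V) : Prop :=
  A x /\ forall y, A y -> f y <= f x.

Definition dist_bdry Omega (x : V) : R := inf [set enorm (y - x) | y in bdry Omega].

Definition sup_dist Omega : R := fine (normLp Omega +oo%E (dist_bdry Omega)).

End sobolev.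

(* Near each boundary point, up to relabelling and reorienting the axes, Omega is the
   part of a ball lying above the graph of a C^oo function of the other N-1
   coordinates. *)
Definition smooth_boundary (R : realType) (N : nat) (Omega : set 'rV[R]_N) : Prop :=
  forall x0, bdry Omega x0 ->
    exists (r : R) (i : 'I_N) (b : bool) (gamma : 'rV[R]_N.-1 -> R),
      [/\ 0 < r, cinfty gamma
        & forall x, enorm (x - x0) < r ->
            (Omega x <-> gamma (col' i x) < (-1) ^+ b * x 0 i)].

Definition smooth_domain (R : realType) (N : nat) (Omega : set 'rV[R]_N) : Prop :=
  [/\ Omega !=set0, open Omega, connected Omega & smooth_boundary Omega].

(* Main.v *)
(* Let S be the maximum of the distance rho.

   If nearest points are unique away from x0, then rho increases at a speed arbitrarily
   close to 1 at every point other than x0, and Ekeland's argument gives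
   rho y + |y - x0| <= rho x0. As u_oo is 1/S-Lipschitz with u_oo x0 = 1, this yields
   u_oo >= 1 - |. - x0|/S >= rho/S.

   Conversely let u_oo = rho/S, and let x <> x_* have two nearest boundary points. Then
   rho lies below a paraboloid touching it at x with slope |m| < 1, so some paraboloid v
   satisfies |grad v| <= c < 1/S, v < u_oo near x and v > u_oo away from x, in particular
   near x_*. For large p, truncating u_p towards v where u_p > v does not affect the
   maximum of u_p, so by minimality the energy of u_p there is at most that of v, which is
   of order c^p. Hence u_oo is c'-Lipschitz near x for some c' < 1/S, whereas rho has slope
   1 at x in the direction of a nearest point. *)
Require Import Defs.
From mathcomp Require Import all_boot all_order all_algebra.
From mathcomp Require Import all_classical all_reals all_analysis.
From mathcomp Require Import measurable_realfun ess_sup_inf ring lra.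
Import Order.TTheory GRing.Theory Num.Theory.
Import numFieldNormedType.Exports.
Local Open Scope classical_set_scope.
Local Open Scope ring_scope.
Set Implicit Arguments.
Unset Strict Implicit.


(** * Lebesgue measure on R^N *)

Section lebesgueN_facts.
Context {R : realType} {N : nat}.
Local Notation V := 'rV[R]_N.
Local Notation mu := (lebesgueN R N).
Implicit Types (a b : 'I_N -> R) (v h c : V) (e : R).

(** An extremal belongs to [W10] only as a limit of test functions, so the truncation is never
    applied to it. It is applied to one test function [phi] close to it in norm, where the chain
    rule is classical. The price is that [phi] is close to the extremal only off a set of small
    measure: the barrier conditions therefore carry a margin [eta], and the exceptional set is
    estimated separately, with constants chosen after the extremal. Gradients are never passed to
    the limit. What survives is a bound $\int_T|\nabla\phi|\le c'|T|+d$ for test functions close to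
    $u_\infty$ in $L^1$. An energy of order $c^q$ yields it once $|\nabla\phi|$ is compared with a
    level $c'>c$, the error being proportional to $(c/c')^q$. Averaging over translates of a small
    cube then turns such bounds directly into $|u(x+h)-u(x)|\le c'|h|$. The same device gives the
    $1/S$-Lipschitz bound in the other direction. There test functions vanish off [Omega], so
    segments may leave [Omega] and no convexity is involved. *)

Definition box a b : set V := [set v | forall i, a i < v 0 i <= b i].

Definition cube c e : set V := box (fun i => c 0 i - e) (fun i => c 0 i + e).

Lemma coord_le_norm v i : `|v 0 i| <= `|v|.
Proof.
rewrite [leRHS]/Num.norm /= mx_normrE; apply/bigmax_geP; right => /=.
by exists (0, i).
Qed.

Lemma norm_le_coord v e : 0 <= e -> (forall i, `|v 0 i| <= e) -> `|v| <= e.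
Proof.
move=> e0 H; rewrite [leLHS]/Num.norm /= mx_normrE; apply/bigmax_leP; split => //.
by move=> [i j] _ /=; rewrite ord1.
Qed.

Lemma cube_norm c e v : 0 <= e -> cube c e v -> `|v - c| <= e.
Proof.
move=> e0 H; apply: norm_le_coord => // i; rewrite !mxE.
by have /andP[h1 h2] := H i; rewrite ler_norml; apply/andP; split; lra.
Qed.

Lemma norm_cube c e v : `|v - c| < e -> cube c e v.
Proof.
move=> H i; have := le_lt_trans (coord_le_norm (v - c) i) H; rewrite !mxE.
by rewrite ltr_norml => /andP[h1 h2]; apply/andP; split; lra.
Qed.

Lemma measurable_box a b : measurable (box a b).
Proof.
have -> : box a b =
    \bigcap_(i in [set: 'I_N]) (rV_coord i @^-1` `]a i, b i]%classic).
  apply/seteqP; split => [v /= H i _|v /= H i].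
    by rewrite /= in_itv; exact: H.
  by have := H i I; rewrite /= in_itv.
apply: fin_bigcap_measurable => // i _.
by rewrite -[X in measurable X]setTI; exact: measurable_rV_coord.
Qed.

Lemma measurable_cube c e : measurable (cube c e).
Proof. exact: measurable_box. Qed.

Lemma lebesgueN_cube c e : 0 <= e -> mu (cube c e) = ((2 * e) ^+ N)%:E.
Proof.
move=> e0; rewrite lebesgueN_box; last by move=> i; lra.
congr EFin; rewrite -[in RHS](card_ord N) -prodr_const.
by apply: eq_bigr => i _; lra.
Qed.

Lemma lebesgueN_cube_gt0 c e : 0 < e -> (0 < mu (cube c e))%E.
Proof. by move=> e0; rewrite lebesgueN_cube ?ltW// lte_fin exprn_gt0// mulr_gt0. Qed.

(** A countable substitute for a base of the topology, although its members are half-open: it makes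
    open sets measurable and, in [ae_local], local statements global. *)
Definition rat_box (q : {ffun 'I_N -> rat * rat}) : set V :=
  box (fun i => ratr (q i).1) (fun i => ratr (q i).2).

Lemma open_rat_box (U : set V) v : open U -> U v ->
  exists2 q, rat_box q v & rat_box q `<=` U.
Proof.
move=> oU Uv; have /nbhs_ballP[e /= e0 eU] : nbhs v U by exact: open_nbhs_nbhs.
have ch i : exists q : rat * rat, v 0 i - e < ratr q.1 < v 0 i /\
    v 0 i < ratr q.2 < v 0 i + e.
  have /rat_in_itvoo[q1 /[!in_itv]/= h1] : v 0 i - e < v 0 i by lra.
  have /rat_in_itvoo[q2 /[!in_itv]/= h2] : v 0 i < v 0 i + e by lra.
  by exists (q1, q2).
have [f Hf] := choice ch.
exists (finfun f) => [i|w Hw].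
  by rewrite !ffunE; have [/andP[_ ->] /andP[h _]] := Hf i; exact: ltW.
apply: eU; rewrite -ball_normE /=.
have nv i : `|(v - w) 0 i| < e.
  rewrite !mxE; have := Hw i; rewrite !ffunE.
  have [/andP[h1 h2] /andP[h3 h4]] := Hf i => /andP[h5 h6].
  by rewrite ltr_norml; apply/andP; split; lra.
rewrite [ltLHS]/Num.norm /= mx_normrE; apply/bigmax_ltP; split => //.
by move=> [i j] _; rewrite ord1; exact: nv.
Qed.

Lemma open_measurable_rV (U : set V) : open U -> measurable U.
Proof.
move=> oU; pose F q := if `[< rat_box q `<=` U >] then rat_box q else set0.
have -> : U = \bigcup_q F q.
  apply/seteqP; split => [v Uv|v [q _]]; last first.
    by rewrite /F; case: asboolP => // h /h.
  have [q qv qU] := open_rat_box oU Uv.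
  by exists q => //; rewrite /F; case: asboolP.
apply: countable_bigcupT_measurable => [|q]; first exact: countableP.
by rewrite /F; case: ifP => _; [exact: measurable_box|exact: measurable0].
Qed.

Lemma closed_measurable_rV (U : set V) : closed U -> measurable U.
Proof.
move=> cU; rewrite -(setCK U); apply: measurableC; apply: open_measurable_rV.
exact: closed_openC.
Qed.

Lemma continuous_measurable_rV (f : V -> R) : continuous f -> measurable_fun setT f.
Proof.
move=> cf; apply: (measurability _ (RGenOInfty.measurableE R)).
move=> _ [_ [x ->] <-]; rewrite setTI; apply: open_measurable_rV.
by apply: open_comp; [move=> ? _; exact: cf|exact: interval_open].
Qed.

Lemma lebesgueN_open_gt0 (U : set V) : open U -> U !=set0 -> (0 < mu U)%E.
Proof.
move=> oU [v Uv]; have /nbhs_ballP[e /= e0 eU] : nbhs v U by exact: open_nbhs_nbhs.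
have e2 : 0 < e / 2 by lra.
apply: lt_le_trans (lebesgueN_cube_gt0 v e2) _.
apply: le_measure; rewrite ?inE; [exact: measurable_cube|exact: open_measurable_rV|].
move=> w /(cube_norm (ltW e2)) h; apply: eU; rewrite -ball_normE/= distrC.
by apply: le_lt_trans h _; lra.
Qed.

Lemma bounded_lebesgueN_lty (A : set V) :
  measurable A -> bounded_set A -> (mu A < +oo)%E.
Proof.
move=> mA [M [Mr HM]].
have [x xM x0] : exists2 x, M < x & 0 < x.
  by exists (`|M| + 1); [have := ler_norm M; lra|have := normr_ge0 M; lra].
apply: (@le_lt_trans _ _ (mu (cube 0 (x + 1)))).
  apply: le_measure; rewrite ?inE//; first exact: measurable_cube.
  move=> v Av; apply: norm_cube; rewrite subr0.
  by apply: le_lt_trans (HM x xM v Av) _; lra.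
by rewrite lebesgueN_cube ?ltry//; lra.
Qed.

Lemma box_setI a b a' b' : box a b `&` box a' b' =
  box (fun i => Num.max (a i) (a' i)) (fun i => Num.min (b i) (b' i)).
Proof.
apply/seteqP; split => [v [/= h1 h2] i|v /= h].
  by rewrite gt_max le_min; have /andP[-> ->] := h1 i; have /andP[-> ->] := h2 i.
by split => i; have := h i; rewrite gt_max le_min => /andP[/andP[? ?] /andP[? ?]];
  apply/andP; split.
Qed.

Lemma box_setI_closed : setI_closed [set A | exists a b, A = box a b].
Proof.
by move=> _ _ [a [b ->]] [a' [b' ->]]; rewrite box_setI; eexists; eexists.
Qed.

(** Boxes form a generating pi-system, on which measures are compared in
    [lebesgueN_pushforward_shift] and in [ae_eq0_boxes]. *)
Lemma measurable_boxE :
  @measurable _ 'rV[R]_N = <<s [set A : set V | exists a b, A = box a b] >>.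
Proof.
apply/seteqP; split; last first.
  apply: smallest_sub; first exact: sigma_algebra_measurable.
  by move=> _ [a [b ->]]; exact: measurable_box.
pose G := [set A : set V | exists a b, A = box a b].
have mcoord i : measurable_fun setT
    (rV_coord i : g_sigma_algebraType G -> measurableTypeR R).
  apply: (measurability _ (RGenOInfty.measurableE R)).
  move=> _ [_ [x ->] <-]; rewrite setTI.
  (* A half-space is a countable union of boxes bounded below by [x] in coordinate [i] and by [- n]
     in the others. *)
  have -> : rV_coord i @^-1` `]x, +oo[%classic = \bigcup_(n : nat)
      box (fun j => if j == i then x else - n%:R) (fun=> n%:R) :> set V.
    apply/seteqP; split => [v /=|v [n _ /= /(_ i)]]; last first.
      by rewrite eqxx in_itv/= andbT => /andP[].
    rewrite in_itv/= andbT => xv.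
    have [n Hn] : exists n : nat, `|v| < n%:R.
      by exists (Num.truncn `|v|).+1; exact: truncnS_gt.
    exists n => // j /=; have := le_lt_trans (coord_le_norm v j) Hn.
    rewrite ltr_norml => /andP[h1 h2]; rewrite (ltW h2) andbT.
    by case: eqP => [->|_].
  apply: bigcupT_measurable => n; apply: sub_sigma_algebra.
  by eexists; eexists.
apply: smallest_sub; first exact: smallest_sigma_algebra.
move=> B; rewrite -bigcup_seq => -[i _ [C mC <-]].
exact: (mcoord i measurableT C mC).
Qed.

Lemma lebesgueN_box0 a b i : b i < a i -> mu (box a b) = 0%E.
Proof.
move=> h; rewrite (_ : box a b = set0) ?measure0//.
by apply/seteqP; split => // v /(_ i) /andP[h1 h2]; lra.
Qed.

Lemma continuous_shift h : continuous (fun v : V => v + h).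
Proof. by move=> v; apply: (@continuousD _ V V id (cst h)); [by move=> A|exact: cst_continuous]. Qed.

Lemma measurable_shift h : measurable_fun setT (fun v : V => v + h).
Proof.
apply: measurable_fun_rV => i; apply: continuous_measurable_rV => v.
apply: (@continuous_comp _ _ _ (fun v : V => v + h) (fun M : V => M 0 i)).
  exact: continuous_shift.
exact: coord_continuous.
Qed.

(** Translates of boxes are boxes with the same sides, and cubes of finite measure exhaust the
    space, so uniqueness of measures applies. *)
Lemma lebesgueN_pushforward_shift h (A : set V) :
  measurable A -> pushforward mu (fun v : V => v + h) A = mu A.
Proof.
move=> mA.
apply: (@measure_unique _ R V [set A | exists a b, A = box a b]
  (fun n : nat => cube 0 n%:R)) => //.
- exact: measurable_boxE.
- exact: box_setI_closed.
- by move=> n; eexists; eexists.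
- apply/seteqP; split => // v _; exists (Num.truncn `|v|).+1 => //.
  by apply: norm_cube; rewrite subr0; exact: truncnS_gt.
- exact: measurable_shift.
- move=> mf _ [a [b ->]]; rewrite -[LHS]/(mu ((fun v : V => v + h) @^-1` box a b)).
  have -> : (fun v : V => v + h) @^-1` box a b =
      box (fun i => a i - h 0 i) (fun i => b i - h 0 i).
    apply/seteqP; split => v /= H i; have := H i; rewrite !mxE;
      by move=> /andP[? ?]; apply/andP; split; lra.
  (* [lebesgueN_box] asks for ordered bounds; a box with reversed bounds is empty, and so is its
     translate. *)
  have [ab|/existsNP[i /negP]] := pselect (forall i, a i <= b i).
    rewrite [LHS]lebesgueN_box; last by move=> i; rewrite lerD2r.
    rewrite [RHS]lebesgueN_box//.
    by congr EFin; apply: eq_bigr => i _; lra.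
  rewrite -ltNge => h'; rewrite [RHS](lebesgueN_box0 h').
  by rewrite [LHS](@lebesgueN_box0 _ _ i)// ltrD2r.
- move=> mf n; rewrite -[ltLHS]/(mu ((fun v : V => v + h) @^-1` cube 0 n%:R)).
  have -> : (fun v : V => v + h) @^-1` cube 0 n%:R = cube (- h) n%:R.
    apply/seteqP; split => v /= H i; have := H i; rewrite !mxE;
      by move=> /andP[? ?]; apply/andP; split; lra.
  by rewrite lebesgueN_cube// ltry.
Qed.

Lemma ge0_integral_shift h (A : set V) (f : V -> \bar R) :
  measurable A -> measurable_fun A f -> (forall v, A v -> (0 <= f v)%E) ->
  (\int[mu]_(v in A) f v = \int[mu]_(v in [set v | A (v + h)%R]) f (v + h)%R)%E.
Proof.
move=> mA mf f0.
rewrite -(@ge0_integral_pushforward _ _ _ _ R _ (measurable_shift h) mu A f)//.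
- apply: eq_measure_integral; first exact: measurable_shift.
  by move=> mh B mB _; apply/esym; exact: lebesgueN_pushforward_shift.
- by move=> v /[!inE]; exact: f0.
Qed.

(** Lindelöf argument: the rational boxes on which [P] holds almost everywhere cover [U], and there
    are countably many of them; [pickle] numbers them. *)
Lemma ae_local (U : set V) (P : V -> Prop) :
  (forall c, U c -> exists2 W : set V, open W /\ W c &
     \forall y \ae mu, W y -> P y) ->
  \forall y \ae mu, U y -> P y.
Proof.
move=> H; pose good q := \forall y \ae mu, rat_box q y -> P y.
have : \forall y \ae mu, forall n : nat,
    if (unpickle n : option {ffun 'I_N -> rat * rat}) is Some q
    then good q -> rat_box q y -> P y else True.
  apply: ae_foralln => n; case: (unpickle n) => [q|]; last exact: aeW.
  have [gq|ngq] := pselect (good q); last by apply: aeW => y /ngq.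
  by apply: filterS gq => y h _.
apply: filterS => y Hy Uy; have [W [oW Wy] PW] := H y Uy.
have [q qy qW] := open_rat_box oW Wy.
have := Hy (pickle q); rewrite pickleK; apply => //.
by apply: filterS PW => z h /qW.
Qed.

(** A negative value would spread to a nonempty open set contained in a null set. *)
Lemma continuous_ae_ge0 (U : set V) (f : V -> R) : open U ->
  (forall y, U y -> {for y, continuous f}) ->
  (\forall y \ae mu, U y -> 0 <= f y) -> forall y, U y -> 0 <= f y.
Proof.
move=> oU cf [A [mA A0 HA]] y Uy; rewrite leNgt; apply/negP => fy.
have : \forall z \near y, f z < 0 by exact: (cvgr_lt (f y) (cf y Uy)).
move=> /nbhs_ballP[e /= e0 eF].
have [V0 [oV0 V0y] V0F] : exists2 W : set V, open W /\ W y &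
    W `<=` A.
  exists (U `&` ball y e); first split.
  - by apply: openI => //; exact: ball_open.
  - by split => //; exact: ballxx.
  - move=> z [Uz /eF fz]; apply: HA => /(_ Uz); rewrite leNgt => /negP; exact.
have := lebesgueN_open_gt0 oV0 (ex_intro _ _ V0y); rewrite ltNge => /negP; apply.
by rewrite -A0; apply: le_measure; rewrite ?inE//; exact: open_measurable_rV.
Qed.

End lebesgueN_facts.

(** * The Euclidean norm *)

Section euclid.
Context {R : realType} {N : nat}.
Local Notation V := 'rV[R]_N.
Implicit Types (x y z h : V).

Definition dot x y : R := \sum_(i < N) x 0 i * y 0 i.

Lemma dotC x y : dot x y = dot y x.
Proof. by apply: eq_bigr => i _; rewrite mulrC. Qed.

Lemma dotDl x y z : dot (x + y) z = dot x z + dot y z.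
Proof. by rewrite /dot -big_split/=; apply: eq_bigr => i _; rewrite !mxE mulrDl. Qed.

Lemma dotZl (a : R) x y : dot (a *: x) y = a * dot x y.
Proof. by rewrite /dot mulr_sumr; apply: eq_bigr => i _; rewrite !mxE mulrA. Qed.

Lemma dotNl x y : dot (- x) y = - dot x y.
Proof. by rewrite -scaleN1r dotZl mulN1r. Qed.

Lemma dotBl x y z : dot (x - y) z = dot x z - dot y z.
Proof. by rewrite dotDl dotNl. Qed.

Lemma dotDr x y z : dot z (x + y) = dot z x + dot z y.
Proof. by rewrite !(dotC z) dotDl. Qed.

Lemma dotZr (a : R) x y : dot x (a *: y) = a * dot x y.
Proof. by rewrite !(dotC x) dotZl. Qed.

Lemma dotNr x y : dot x (- y) = - dot x y.
Proof. by rewrite !(dotC x) dotNl. Qed.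

Lemma dotBr x y z : dot z (x - y) = dot z x - dot z y.
Proof. by rewrite !(dotC z) dotBl. Qed.

Definition dotE := (dotDl, dotDr, dotNl, dotNr, dotZl, dotZr).

Lemma dot_ge0 x : 0 <= dot x x.
Proof. by apply: sumr_ge0 => i _; rewrite -expr2 sqr_ge0. Qed.

Lemma dot_eq0 x : dot x x = 0 -> x = 0.
Proof.
move=> /eqP; rewrite psumr_eq0 => [/allP h|i _]; last by rewrite -expr2 sqr_ge0.
apply/rowP => i; rewrite mxE; apply/eqP.
by rewrite -sqrf_eq0 expr2; apply: h; rewrite mem_index_enum.
Qed.

Lemma enormE x : enorm x = Num.sqrt (dot x x).
Proof. by rewrite /enorm /dot; under eq_bigr do rewrite expr2. Qed.

Lemma enorm_ge0 x : 0 <= enorm x.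
Proof. exact: sqrtr_ge0. Qed.

Lemma enorm_sqr x : enorm x ^+ 2 = dot x x.
Proof. by rewrite enormE sqr_sqrtr// dot_ge0. Qed.

Lemma enorm0 : enorm (0 : V) = 0.
Proof. by rewrite enormE /dot big1 ?sqrtr0// => i _; rewrite mxE mul0r. Qed.

Lemma enorm_eq0 x : enorm x = 0 -> x = 0.
Proof. by move=> h; apply: dot_eq0; rewrite -enorm_sqr h expr0n. Qed.

Lemma enormZ (a : R) x : enorm (a *: x) = `|a| * enorm x.
Proof.
by rewrite !enormE !dotE mulrA -expr2 sqrtrM ?sqr_ge0// sqrtr_sqr.
Qed.

Lemma enormN x : enorm (- x) = enorm x.
Proof. by rewrite -scaleN1r enormZ normrN1 mul1r. Qed.

Lemma enormB x y : enorm (x - y) = enorm (y - x).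
Proof. by rewrite -enormN opprB. Qed.

Lemma dot_le_enorm x y : dot x y <= enorm x * enorm y.
Proof.
have [y0|y0] := eqVneq (enorm y) 0.
  have -> : y = 0 by exact: enorm_eq0.
  by rewrite enorm0 mulr0 /dot big1// => i _; rewrite mxE mulr0.
have yp : 0 < enorm y by rewrite lt_neqAle eq_sym y0 enorm_ge0.
have [x0|x0] := eqVneq (enorm x) 0.
  have -> : x = 0 by exact: enorm_eq0.
  by rewrite enorm0 mul0r /dot big1// => i _; rewrite mxE mul0r.
have xp : 0 < enorm x by rewrite lt_neqAle eq_sym x0 enorm_ge0.
have := dot_ge0 (enorm y *: x - enorm x *: y).
rewrite !dotE -!enorm_sqr (dotC y x) => h.
have := mulr_gt0 xp yp; nra.
Qed.

Lemma normr_dot_le x y : `|dot x y| <= enorm x * enorm y.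
Proof.
rewrite ler_norml dot_le_enorm andbT lerNl -dotNl.
by apply: le_trans (dot_le_enorm _ _) _; rewrite enormN.
Qed.

Lemma enormD x y : enorm (x + y) <= enorm x + enorm y.
Proof.
rewrite -(@ler_pXn2r _ 2)// ?nnegrE ?addr_ge0 ?enorm_ge0//.
rewrite sqrrD !enorm_sqr !dotE (dotC y x).
have := dot_le_enorm x y; lra.
Qed.

Lemma enormB_le x y z : enorm (x - z) <= enorm (x - y) + enorm (y - z).
Proof. by apply: le_trans (enormD _ _); rewrite addrA subrK. Qed.

Lemma coord_le_enorm x i : `|x 0 i| <= enorm x.
Proof.
rewrite -(@ler_pXn2r _ 2)// ?nnegrE ?enorm_ge0// enorm_sqr /dot (bigD1 i)//=.
rewrite real_normK ?num_real// expr2 lerDl sumr_ge0// => j _.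
by rewrite -expr2 sqr_ge0.
Qed.

Lemma norm_le_enorm x : `|x| <= enorm x.
Proof. by apply: norm_le_coord; [exact: enorm_ge0|exact: coord_le_enorm]. Qed.

Lemma enorm_le_norm x : enorm x <= N%:R * `|x|.
Proof.
rewrite -(@ler_pXn2r _ 2)// ?nnegrE ?enorm_ge0 ?mulr_ge0// enorm_sqr.
apply: (@le_trans _ _ (\sum_(i < N) `|x| ^+ 2)).
  apply: ler_sum => i _; rewrite -expr2 -(real_normK (num_real _)).
  by rewrite ler_pXn2r ?nnegrE// coord_le_norm.
rewrite sumr_const card_ord -[leLHS]mulr_natl exprMn ler_wpM2r ?sqr_ge0//.
by rewrite -natrX ler_nat; case: (N) => // n; rewrite leq_pmulr.
Qed.

Lemma enorm_lip x y : `|enorm x - enorm y| <= enorm (x - y).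
Proof.
rewrite ler_distlC; have := enormD (x - y) y; have := enormD (y - x) x.
by rewrite !subrK (enormB y x) => ? ?; apply/andP; split; lra.
Qed.

Lemma enorm_lip_continuous (f : V -> R) (c : R) :
  (forall x y, `|f x - f y| <= c * enorm (x - y)) -> continuous f.
Proof.
move=> fL x; apply/(@cvgrPdist_lt _ _ _ (nbhs x)) => e e0.
have cN : 0 < `|c| * N%:R + 1 by rewrite ltr_wpDl// mulr_ge0.
apply/nbhs_ballP; exists (e / (`|c| * N%:R + 1)) => /=; first exact: divr_gt0.
move=> y; rewrite -ball_normE /= => xy; apply: le_lt_trans (fL _ _) _.
apply: (@le_lt_trans _ _ ((`|c| * N%:R + 1) * `|x - y|)).
  apply: (@le_trans _ _ (`|c| * (N%:R * `|x - y|))).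
    apply: (@le_trans _ _ (`|c| * enorm (x - y))).
      by rewrite ler_wpM2r ?enorm_ge0// ler_norm.
    by rewrite ler_wpM2l ?enorm_le_norm.
  by rewrite mulrA mulrDl mul1r lerDl.
by rewrite mulrC -ltr_pdivlMr.
Qed.

Lemma continuous_enorm : continuous (@enorm R N).
Proof.
by apply: (@enorm_lip_continuous _ 1) => x y; rewrite mul1r enorm_lip.
Qed.

Lemma enorm_scale_unit x : 0 < enorm x -> enorm ((enorm x)^-1 *: x) = 1.
Proof.
move=> x0; rewrite enormZ ger0_norm ?invr_ge0 ?enorm_ge0//.
by rewrite mulVf// gt_eqF.
Qed.

Lemma dot_delta i x : dot (delta_mx 0 i) x = x 0 i.
Proof.
rewrite /dot (bigD1 i)//= mxE !eqxx mul1r big1 ?addr0// => j ji.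
by rewrite mxE eqxx (negbTE ji) mul0r.
Qed.

Lemma enorm_delta i : enorm (delta_mx 0 i : V) = 1.
Proof. by rewrite enormE dot_delta mxE !eqxx sqrtr1. Qed.

End euclid.

(** * Smooth functions *)

Section smooth.
Context {R : realType} {N : nat}.
Local Notation V := 'rV[R]_N.
Local Notation e_ i := (delta_mx 0 i : V).
Implicit Types (f g : V -> R) (x z w v : V) (i : 'I_N).

Lemma line_quotient f w v (s : R) :
  (fun h : R => h^-1 *: (((fun t : R => f (t *: v + w)) \o shift s) (h *: (1 : R)) -
     f (s *: v + w))) =
  (fun h : R => h^-1 *: ((f \o shift (s *: v + w)) (h *: v) - f (s *: v + w))).
Proof.
by apply/funext => h /=; rewrite [h *: (1:R)]mulr1 scalerDl addrA.
Qed.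

(** Directional derivatives become derivatives of one real variable, to which the chain rule and the
    mean value theorem apply. *)
Lemma is_derive_line f w v (s : R) (d : R) :
  is_derive (s *: v + w) v f d <-> is_derive s (1 : R) (fun t : R => f (t *: v + w)) d.
Proof.
split => -[h1 h2]; split.
- by rewrite /derivable line_quotient.
- by rewrite /derive line_quotient.
- by rewrite /derivable -line_quotient.
- by rewrite /derive -line_quotient.
Qed.

(** [cinfty] treats all iterated partial derivatives at once; grading them by the order [n] lets
    stability under products and composition be proved by induction. [cinftyP] relates the two
    notions. *)
Fixpoint Ck (n : nat) f : Prop :=
  continuous f /\ if n is n'.+1 then
    forall i, (forall x, derivable f x (e_ i)) /\ Ck n' (partial i f)
  else True.

Lemma Ck_continuous n f : Ck n f -> continuous f.
Proof. by case: n => [|n] []. Qed.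
Arguments Ck_continuous {n f}.

Lemma CkS n f : Ck n.+1 f -> Ck n f.
Proof.
elim: n f => [|n IH] f [cf Hf]; split => // i.
by have [d c] := Hf i; split => //; exact: IH.
Qed.

Lemma cinftyP f : cinfty f <-> forall n, Ck n f.
Proof.
split=> [cf n|Hf s].
  elim: n f cf => [|n IH] f cf; first by split => //; exact: (cf [::]).1.
  split; first exact: (cf [::]).1.
  move=> i; split; first exact: (cf [::]).2.
  by apply: IH => s; rewrite -foldr_rcons; exact: cf.
(* [foldr] applies the last index of [s] first, hence the induction from the right. *)
elim/last_ind: s f Hf => [|s j IH] f Hf.
  split; first exact: Ck_continuous (Hf 0%N).
  by move=> i x; have [_ /(_ i)[]] := Hf 1%N.
rewrite foldr_rcons; apply: IH => n.
by have [_ /(_ j)[]] := Hf n.+1.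
Qed.

Lemma cinfty_Ck n f : cinfty f -> Ck n f.
Proof. by move=> /cinftyP. Qed.

Lemma cinfty_continuous f : cinfty f -> continuous f.
Proof. by move=> /(_ [::])[]. Qed.

Lemma cinfty_derivable f i x : cinfty f -> derivable f x (e_ i).
Proof. by move=> /(_ [::])[_]; exact. Qed.

Lemma cinfty_partial f i : cinfty f -> cinfty (partial i f).
Proof. by move=> cf s; rewrite -foldr_rcons; exact: cf. Qed.

Lemma cinfty_is_derive f i x : cinfty f -> is_derive x (e_ i) f (partial i f x).
Proof. by move=> cf; apply: derivableP; exact: cinfty_derivable. Qed.

Lemma partialE f i x (d : R) : is_derive x (e_ i) f d -> partial i f x = d.
Proof. by move=> h; rewrite /partial derive_val. Qed.

Lemma Ck_S n f (df : 'I_N -> V -> R) : continuous f ->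
  (forall i x, is_derive x (e_ i) f (df i x)) -> (forall i, Ck n (df i)) ->
  Ck n.+1 f.
Proof.
move=> cf fd Cd; split => // i; split => [x|]; first by have [] := fd i x.
rewrite (_ : partial i f = df i)//; apply/funext => x; exact: partialE.
Qed.

Lemma Ck_cst n (a : R) : Ck n (fun _ : V => a).
Proof.
elim: n a => [|n IH] a; first by split => //; exact: cst_continuous.
by apply: (@Ck_S _ _ (fun _ _ => 0)); [exact: cst_continuous|move=> i; exact: IH].
Qed.

Lemma Ck_is_derive n f i x : Ck n.+1 f -> is_derive x (e_ i) f (partial i f x).
Proof. by move=> [_ /(_ i)[h _]]; exact: derivableP. Qed.

Lemma Ck_partial n f i : Ck n.+1 f -> Ck n (partial i f).
Proof. by move=> [_ /(_ i)[]]. Qed.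

Lemma Ck_D n f g : Ck n f -> Ck n g -> Ck n (fun x => f x + g x).
Proof.
elim: n f g => [|n IH] f g Cf Cg;
  have cf := Ck_continuous Cf; have cg := Ck_continuous Cg.
  by split => // x; apply: continuousD; [exact: cf|exact: cg].
apply: (@Ck_S _ _ (fun i x => partial i f x + partial i g x)).
- by move=> x; apply: (@continuousD _ R V f g); [exact: cf|exact: cg].
- by move=> i x; apply: is_deriveD; apply: Ck_is_derive; [exact: Cf|exact: Cg].
- by move=> i; apply: IH; exact: Ck_partial.
Qed.

Lemma Ck_M n f g : Ck n f -> Ck n g -> Ck n (fun x => f x * g x).
Proof.
elim: n f g => [|n IH] f g Cf Cg;
  have cf := Ck_continuous Cf; have cg := Ck_continuous Cg.
  by split => // x; apply: continuousM; [exact: cf|exact: cg].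
apply: (@Ck_S _ _ (fun i x => f x * partial i g x + g x * partial i f x)).
- by move=> x; apply: (@continuousM R V f g); [exact: cf|exact: cg].
- by move=> i x; apply: is_deriveM; apply: Ck_is_derive; [exact: Cf|exact: Cg].
- by move=> i; apply: Ck_D; apply: IH; try exact: Ck_partial; exact: CkS.
Qed.

Lemma Ck_Z n (a : R) f : Ck n f -> Ck n (fun x => a * f x).
Proof. by move=> Cf; apply: Ck_M => //; exact: Ck_cst. Qed.

Lemma Ck_sum n (I : Type) (s : seq I) (F : I -> V -> R) :
  (forall j, Ck n (F j)) -> Ck n (fun x => \sum_(j <- s) F j x).
Proof.
move=> CF; elim: s => [|j s IH].
  by under eq_fun do rewrite big_nil; exact: Ck_cst.
by under eq_fun do rewrite big_cons; exact: Ck_D.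
Qed.

Lemma Ck_prod n (I : Type) (s : seq I) (F : I -> V -> R) :
  (forall j, Ck n (F j)) -> Ck n (fun x => \prod_(j <- s) F j x).
Proof.
move=> CF; elim: s => [|j s IH].
  by under eq_fun do rewrite big_nil; exact: Ck_cst.
by under eq_fun do rewrite big_cons; exact: Ck_M.
Qed.

Lemma is_derive_coord i j x : is_derive x (e_ i) (fun z : V => z 0 j) ((j == i)%:R : R).
Proof.
rewrite -[x in is_derive x]add0r -(scale0r (e_ i)); apply/is_derive_line.
rewrite (_ : (fun _ => _) = (fun t : R => (j == i)%:R * t + x 0 j)); last first.
  by apply/funext => t; rewrite !mxE eqxx/= mulrC.
by apply: is_derive_eq; rewrite addr0 [LHS]mulr1.
Qed.

Lemma Ck_coord n j : Ck n (fun z : V => z 0 j).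
Proof.
case: n => [|n]; first by split => //; exact: coord_continuous.
apply: (@Ck_S _ _ (fun i _ => (j == i)%:R)).
- exact: coord_continuous.
- by move=> i x; exact: is_derive_coord.
- by move=> i; exact: Ck_cst.
Qed.

End smooth.

(** * The smooth function $e^{-1/t}$ used for truncation *)

Section expinv.
Context {R : realType}.
Implicit Types (k : nat) (t : R).

(* The exponent k makes the family closed under differentiation, up to linear
   combinations; expinv 2 is the derivative of expinv 0 (t = 0 included). *)
Definition expinv k t : R := if 0 < t then t^-1 ^+ k * expR (- t^-1) else 0.

Lemma expinv_ge0 k t : 0 <= expinv k t.
Proof.
rewrite /expinv; case: ifP => // t0.
by rewrite mulr_ge0 ?expR_ge0// exprn_ge0// invr_ge0 ltW.
Qed.

Lemma expinv_gt0 k t : 0 < t -> 0 < expinv k t.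
Proof. by move=> t0; rewrite /expinv t0 mulr_gt0 ?expR_gt0// exprn_gt0// invr_gt0. Qed.

Lemma expinv_le0 k t : t <= 0 -> expinv k t = 0.
Proof. by rewrite /expinv ltNge => ->. Qed.

Lemma expR_ge_powern (s : R) k : 0 <= s -> (1 + s / k.+1%:R) ^+ k.+1 <= expR s.
Proof.
move=> s0; have -> : expR s = expR (s / k.+1%:R) ^+ k.+1.
  by rewrite -expRM_natl mulrC divfK.
rewrite lerXn2r ?nnegrE ?expR_ge0 ?expR_ge1Dx// addr_ge0//.
by rewrite divr_ge0.
Qed.

(** Exponential decay beats any power of $1/t$; one spare factor [t] is kept so that the difference
    quotients at 0 tend to 0. *)
Lemma expinv_le_lin k t : expinv k t <= k.+1%:R ^+ k.+1 * `|t|.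
Proof.
have [t0|t0] := ltP 0 t; last by rewrite expinv_le0// mulr_ge0// exprn_ge0.
rewrite /expinv t0 gtr0_norm//.
have s0 : 0 < t^-1 by rewrite invr_gt0.
have h := expR_ge_powern k (ltW s0).
rewrite expRN ler_pdivrMr ?expR_gt0// mulrAC.
have h2 : (t^-1 / k.+1%:R) ^+ k.+1 <= expR t^-1.
  apply: le_trans h; rewrite lerXn2r ?nnegrE ?lerDr//.
  - by rewrite divr_ge0// ltW.
  - by rewrite addr_ge0// divr_ge0// ltW.
move: h2; rewrite expr_div_n ler_pdivrMr ?exprn_gt0//.
rewrite exprSr => /(ler_wpM2r (ltW t0)); rewrite -[X in X <= _]mulrA mulVf ?gt_eqF//.
by rewrite mulr1 [X in _ -> _ <= X * _]mulrC.
Qed.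

Lemma is_derive_expinv k t :
  is_derive t 1 (expinv k) (expinv k.+2 t - k%:R * expinv k.+1 t).
Proof.
have [t0|t0|t0] := ltgtP t 0.
- rewrite !expinv_le0 ?(ltW t0)// mulr0 subr0.
  apply: (@near_eq_is_derive _ _ _ (cst 0)).
    near=> s; rewrite expinv_le0//; near: s.
    by apply: filterS (lt_nbhsl t0) => s /ltW.
- have h : is_derive t 1 (fun s : R => s^-1 ^+ k * expR (- s^-1))
     (expinv k.+2 t - k%:R * expinv k.+1 t).
    have hV : is_derive t 1 (fun s : R => s^-1) (- t^-2).
      apply: is_derive_eq; first by apply: is_deriveV; rewrite gt_eqF.
      by rewrite [LHS]mulr1.
    have hX : is_derive t 1 (fun s : R => s^-1 ^+ k) (k%:R * t^-1 ^+ k.-1 * - t^-2).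
      have := is_deriveX k hV.
      by rewrite (_ : (GRing.inv : R -> R) ^+ k = fun s : R => s^-1 ^+ k)// exprfctE.
    have hE : is_derive t 1 (fun s : R => expR (- s^-1)) (expR (- t^-1) * t^-2).
      apply: (@is_derive1_comp _ expR (fun s : R => - s^-1)).
      by rewrite -[X in is_derive _ _ _ X]opprK; exact: is_deriveN.
    have := is_deriveM hX hE.
    rewrite /expinv t0 /GRing.scale/= => h; apply: is_derive_eq h _.
    case: (k) => [|m] /=; first by rewrite !expr0 !mul0r mulr0 subr0 -exprVn; ring.
    by rewrite -!exprVn !exprS; ring.
  apply: near_eq_is_derive h.
  near=> s; rewrite /expinv; case: ifP => //.
  by move/negP; case; near: s; exact: lt_nbhsr.
- rewrite t0 !expinv_le0// mulr0 subr0.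
  have : (fun h : R => h^-1 *: ((expinv k \o shift 0) (h *: (1:R)) - expinv k 0))
     @ 0^' --> (0 : R).
    apply/cvgrPdist_le => e e0.
    have C0 : 0 < k.+2%:R ^+ k.+2 :> R by rewrite exprn_gt0.
    near=> h; rewrite sub0r normrN (expinv_le0 k (lexx 0)) subr0 /= addr0.
    (* Dividing by [h > 0] turns [expinv k] into [expinv k.+1], which is at most linear in [h]; for
       [h <= 0] the quotient is 0. *)
    rewrite [h *: 1]mulr1; apply: (@le_trans _ _ (expinv k.+1 h)).
      rewrite /expinv; case: ifP => h0; last by rewrite scaler0 normr0.
      rewrite ger0_norm; first by rewrite /GRing.scale/= exprS mulrA.
      rewrite /GRing.scale/= !mulr_ge0 ?expR_ge0 ?exprn_ge0 ?invr_ge0 ?ltW//.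
    apply: le_trans (expinv_le_lin _ _) _.
    rewrite -ler_pdivlMl//; near: h.
    apply: dnbhs0_le; rewrite mulr_gt0// invr_gt0//.
  by move=> h; split; [apply/cvg_ex; exists 0|exact/cvg_lim].
Unshelve. all: by end_near. Qed.

Lemma continuous_expinv k : continuous (expinv k).
Proof.
move=> t; apply: differentiable_continuous; apply/derivable1_diffP.
by have [] := is_derive_expinv k t.
Qed.

Lemma expinv0_le1 t : expinv 0 t <= 1.
Proof.
rewrite /expinv; case: ifP => // t0; rewrite mul1r.
by rewrite -expR0 ler_expR oppr_le0 invr_ge0 ltW.
Qed.

(** With $s=1/t$, the identity $(1+s/4)^2-s=(1-s/4)^2$ gives $e^s\ge(1+s/4)^4\ge s^2$. This bound
    allows [expinv 2] to be the weight of a convex combination. *)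
Lemma expinv2_le1 t : expinv 2 t <= 1.
Proof.
rewrite /expinv; case: ifP => // t0.
have s0 : 0 < t^-1 by rewrite invr_gt0.
rewrite expRN ler_pdivrMr ?expR_gt0// mul1r.
apply: le_trans (expR_ge_powern 3 (ltW s0)).
set s := t^-1 in s0 *.
have -> : (1 + s / 4%:R) ^+ 4 = ((1 + s / 4%:R) ^+ 2) ^+ 2 by rewrite -exprM.
rewrite lerXn2r ?nnegrE ?sqr_ge0 ?(ltW s0)//.
have := sqr_ge0 (1 - s / 4); nra.
Qed.

End expinv.

Section expinv_comp.
Context {R : realType} {N : nat}.
Local Notation V := 'rV[R]_N.

Lemma is_derive_expinv_comp k (f : V -> R) (x v : V) (d : R) : is_derive x v f d ->
  is_derive x v (fun z => expinv k (f z))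
    ((expinv k.+2 (f x) - k%:R * expinv k.+1 (f x)) * d).
Proof.
rewrite -{1 2}[x]add0r -(scale0r v) => /is_derive_line h.
apply/is_derive_line; apply: is_derive1_comp.
by rewrite /= scale0r add0r; exact: is_derive_expinv.
Qed.

Lemma Ck_expinv n k (f : V -> R) : Ck n f -> Ck n (fun x => expinv k (f x)).
Proof.
have cc j g : continuous g -> continuous (fun x : V => expinv j (g x) : R).
  by move=> cg x; apply: continuous_comp; [exact: cg|exact: continuous_expinv].
elim: n k f => [|n IH] k f Cf; first by split => //; exact/cc/Ck_continuous/Cf.
apply: (@Ck_S _ _ _ _ (fun i x => (expinv k.+2 (f x) +
    (- k%:R) * expinv k.+1 (f x)) * partial i f x)).
- exact/cc/Ck_continuous/Cf.
- move=> i x; rewrite mulNr; apply: is_derive_expinv_comp; exact: Ck_is_derive Cf.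
- move=> i; apply: Ck_M; last exact: Ck_partial.
  by apply: Ck_D; [|apply: Ck_Z]; apply: IH; exact: CkS.
Qed.

End expinv_comp.

(** * Uniform first-order expansions *)

Section taylor.
Context {R : realType} {N : nat}.
Local Notation V := 'rV[R]_N.
Local Notation e_ i := (delta_mx 0 i : V).
Implicit Types (f g : V -> R) (x z w v k : V) (i : 'I_N) (K : set V).

(** Only [z] is confined to [K]; the nearby point [y] may lie outside, as the increments used later
    do. *)
Lemma compact_unif_cont K (I : finType) (F : I -> V -> R) (e : R) :
  compact K -> (forall j, continuous (F j)) -> 0 < e ->
  exists2 d : R, 0 < d &
    forall z y, K z -> `|y - z| < d -> forall j, `|F j y - F j z| < e.
Proof.
move=> cK cF e0.
pose P (d : R) z := forall y, `|y - z| < d -> forall j, `|F j y - F j z| < e.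
have H : \forall d \near (0 : R)^'+, K `<=` P d.
  apply: (proj1 (compact_near_coveringP K) cK) => x Kx.
  have : \forall y \near x, forall j, `|F j y - F j x| < e / 2.
    apply: (@filter_forall V I (fun j y => `|F j y - F j x| < e / 2) (nbhs x)) => j.
    have e2 : 0 < e / 2 by lra.
    have /(@cvgrPdist_lt _ _ _ (nbhs x))/(_ _ e2) := cF j x.
    by apply: filterS => y; rewrite distrC.
  move=> /nbhs_ballP[d /= d0 dF].
  exists (ball x (d / 2), [set r | r < d / 2]) => /=.
    by split; [apply: nbhsx_ballx; lra|apply: nbhs_right_lt; lra].
  move=> [z r] [/= xz rd] y yz j.
  move: xz; rewrite -ball_normE/= => xz.
  have h1 : `|F j z - F j x| < e / 2.
    by apply: dF; rewrite -ball_normE/=; lra.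
  have h2 : `|F j y - F j x| < e / 2.
    apply: dF; rewrite -ball_normE/=.
    rewrite -(subrK z x) -addrA; apply: le_lt_trans (ler_normD _ _) _.
    rewrite (distrC z y); lra.
  rewrite -(subrK (F j x) (F j y)) -addrA.
  apply: le_lt_trans (ler_normD _ _) _; rewrite (distrC (F j x)); lra.
near (0 : R)^'+ => d; exists d; first by near: d; exact: nbhs_right_gt.
have Pd : K `<=` P d by near: d.
by move=> z y Kz; exact: Pd.
Unshelve. all: by end_near. Qed.

Lemma continuous_compact_bounded K f : compact K -> continuous f ->
  exists2 M : R, 0 < M & forall z, K z -> `|f z| <= M.
Proof.
move=> cK cf; have [[z0 Kz0]|K0] := pselect (K !=set0); last first.
  by exists 1 => // z Kz; case: K0; exists z.
have cnf : {within K, continuous (fun z => `|f z| : R)}.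
  apply: continuous_subspaceT => z; apply: continuous_comp; [exact: cf|].
  exact: norm_continuous.
have [z /[!inE] Kz h] := compact_EVT_max (ex_intro _ _ Kz0) cK cnf.
exists (`|f z| + 1) => [|y Ky]; first by rewrite ltr_wpDl.
by apply: le_trans (h y _) _; rewrite ?inE// lerDl.
Qed.

Lemma partial_MVT f i w (t : R) : (forall x, derivable f x (e_ i)) ->
  exists2 s : R, `|s| <= `|t| &
    f (t *: e_ i + w) - f w = t * partial i f (s *: e_ i + w).
Proof.
move=> df; pose g (s : R) := f (s *: e_ i + w).
have dg (s : R) : is_derive s (1 : R) g (partial i f (s *: e_ i + w)).
  by apply/is_derive_line; exact: derivableP.
have cg (a b : R) : {within `[a, b], continuous g}.
  apply: continuous_subspaceT => s; apply: differentiable_continuous.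
  by apply/derivable1_diffP; have [] := dg s.
have g0 : g 0 = f w by rewrite /g scale0r add0r.
have [t0|t0] := leP 0 t.
- have [s /[!in_itv]/= /andP[s0 st]] := MVT_segment t0 (fun s _ => dg s) (cg _ _).
  rewrite g0 subr0 mulrC => h; exists s => //.
  by rewrite !ger0_norm.
- have [s /[!in_itv]/= /andP[s0 st]] := MVT_segment (ltW t0) (fun s _ => dg s) (cg _ _).
  rewrite g0 sub0r => h; exists s => //.
    by rewrite !ler0_norm ?lerN2// ltW.
  by rewrite -opprB h mulrN opprK mulrC.
Qed.

Definition grad f x : V := \row_i partial i f x.

(** The increment is telescoped along the path that changes one coordinate at a time, and
    [partial_MVT] is applied on each edge. The value of the partial derivative there is replaced by
    the one at [z] by uniform continuity. *)
Lemma taylor_unif f K (e : R) : Ck 1 f -> compact K -> 0 < e ->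
  exists2 d : R, 0 < d & forall z k, K z -> `|k| < d ->
    `|f (z + k) - f z - dot k (grad f z)| <= e * enorm k.
Proof.
move=> Cf cK e0.
(* Each of the [N] edges contributes at most this multiple of [enorm k]; the successor avoids a
   division by 0 in dimension 0. *)
have e'0 : 0 < e / N.+1%:R by rewrite divr_gt0.
have cp i : continuous (partial i f) by exact: (Ck_continuous (Ck_partial i Cf)).
have [d d0 H] := compact_unif_cont cK cp e'0.
exists d => // z k Kz kd.
pose kj (j : nat) : V := \row_i (if (i < j)%N then k 0 i else 0).
have kN : kj N = k by apply/rowP => i; rewrite mxE ltn_ord.
have k0 : kj 0%N = 0 by apply/rowP => i; rewrite !mxE.
have kS (j : 'I_N) : kj j.+1 = k 0 j *: e_ j + kj j.
  apply/rowP => i; rewrite !mxE eqxx/= ltnS leq_eqVlt eq_sym.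
  rewrite [in LHS]eq_sym -[(i == j :> nat)]/(i == j).
  by case: eqP => [->|_] /=; rewrite ?ltnn ?mulr1 ?mulr0 ?addr0 ?add0r.
have -> : f (z + k) - f z = \sum_(j < N) (f (z + kj j.+1) - f (z + kj j)).
  rewrite -(big_mkord xpredT (fun j => f (z + kj j.+1) - f (z + kj j))).
  by rewrite telescope_sumr// kN k0 addr0.
rewrite /dot -sumrB; apply: le_trans (ler_norm_sum _ _ _) _.
apply: (@le_trans _ _ (\sum_(j < N) e / N.+1%:R * enorm k)); last first.
  rewrite sumr_const card_ord -[leLHS]mulr_natl.
  rewrite (_ : _ * _ = N%:R / N.+1%:R * (e * enorm k)); last by ring.
  rewrite ler_piMl ?mulr_ge0 ?enorm_ge0 ?(ltW e0)//.
  by rewrite ler_pdivrMr// mul1r ler_nat.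
apply: ler_sum => j _.
have [s sk ->] : exists2 s : R, `|s| <= `|k 0 j| &
    f (z + kj j.+1) - f (z + kj j) = k 0 j * partial j f (s *: e_ j + (z + kj j)).
  have [|s sk h] := @partial_MVT f j (z + kj j) (k 0 j).
    by move=> x; have [] := Cf.2 j.
  by exists s => //; rewrite -h kS addrCA.
rewrite /grad mxE -mulrBr normrM mulrC ler_pM//; last exact: coord_le_enorm.
apply/ltW/H => //; rewrite addrCA [z + _]addrC addrK.
apply: le_lt_trans kd; apply: norm_le_coord => // i.
rewrite !mxE eqxx/=; have [->|ij] := eqVneq i j.
  by rewrite ltnn mulr1 addr0; apply: le_trans sk _; exact: coord_le_norm.
rewrite mulr0 add0r; case: ifP => _; last by rewrite normr0.
exact: coord_le_norm.
Qed.

End taylor.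

(** * Weak gradients *)

Section integration_by_parts.
Context {R : realType} {N : nat}.
Local Notation V := 'rV[R]_N.
Local Notation e_ i := (delta_mx 0 i : V).
Local Notation mu := (lebesgueN R N).
Implicit Types (f g phi : V -> R) (x z w v h : V) (i : 'I_N) (K Omega : set V).

Lemma rV_compact_closed K : compact K -> closed K.
Proof. by apply: compact_closed; exact: norm_hausdorff. Qed.

Lemma rV_compact_measurable K : compact K -> measurable K.
Proof. by move=> /rV_compact_closed; exact: closed_measurable_rV. Qed.

Lemma rV_compact_lty K : compact K -> (mu K < +oo)%E.
Proof.
move=> cK; apply: bounded_lebesgueN_lty; first exact: rV_compact_measurable.
exact: compact_bounded.
Qed.

Lemma continuous_measurable_on (D : set V) f : continuous f -> measurable_fun D f.
Proof. by move=> cf; apply: measurable_funTS; exact: continuous_measurable_rV. Qed.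

Lemma bounded_integrable (D : set V) f (M : R) : measurable D -> (mu D < +oo)%E ->
  measurable_fun D f -> (forall z, D z -> `|f z| <= M) ->
  mu.-integrable D (EFin \o f).
Proof.
move=> mD Dlty mf fM; apply: measurable_bounded_integrable => //.
exists M; split; first exact: num_real.
by move=> r Mr z Dz; apply: le_trans (fM z Dz) (ltW Mr).
Qed.

Lemma continuous_integrable_compact K f : compact K -> continuous f ->
  mu.-integrable K (EFin \o f).
Proof.
move=> cK cf; have [M M0 fM] := continuous_compact_bounded cK cf.
apply: bounded_integrable fM; first exact: rV_compact_measurable.
- exact: rV_compact_lty.
- exact: continuous_measurable_on.
Qed.

Lemma restrict_supp (D : set V) f : (forall x, f x != 0 -> D x) -> f \_ D = f.
Proof.
move=> fD; apply/funext => x; rewrite /patch; case: ifPn => // /negP xD.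
by apply/esym/eqP; apply: contrapT => /negP /fD; rewrite -inE.
Qed.

Lemma integrable_supp (D : set V) f : measurable D ->
  (forall x, f x != 0 -> D x) ->
  mu.-integrable D (EFin \o f) -> mu.-integrable setT (EFin \o f).
Proof.
move=> mD fD /(integrable_mkcond _ mD); by rewrite restrict_EFin restrict_supp.
Qed.

Lemma Rintegral_supp (D : set V) f : (forall x, f x != 0 -> D x) ->
  \int[mu]_(x in D) f x = \int[mu]_x f x.
Proof. by move=> fD; rewrite Rintegral_mkcond restrict_supp. Qed.

Lemma integral_shift h (f : V -> \bar R) : measurable_fun setT f ->
  (\int[mu]_v f (v + h)%R = \int[mu]_v f v)%E.
Proof.
have shift_ge0 (g : V -> \bar R) : measurable_fun setT g -> (forall v, 0 <= g v)%E ->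
    (\int[mu]_v g (v + h)%R = \int[mu]_v g v)%E.
  move=> mg g0; rewrite [RHS](@ge0_integral_shift _ _ h)//.
move=> mf; rewrite integralE [RHS]integralE; congr (_ - _)%E.
- rewrite -[RHS](shift_ge0 (f^\+)%E)//; last exact: measurable_funepos.
  by apply: eq_integral => v _; rewrite /= !funeposE.
- rewrite -[RHS](shift_ge0 (f^\-)%E)//; last exact: measurable_funeneg.
  by apply: eq_integral => v _; rewrite /= !funenegE.
Qed.

Lemma partial_supp K f i x : closed K -> (forall z, f z != 0 -> K z) ->
  partial i f x != 0 -> K x.
Proof.
move=> cK fK; apply: contra_neqP => Kx.
rewrite /partial -(@near_eq_derive _ _ _ (cst 0 : V -> R)) ?derive_cst//.
have : \forall z \near x, ~ K z by apply: open_nbhs_nbhs; split => //; exact: closed_openC.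
apply: filterS => z Kz; apply/esym/eqP; apply: contrapT => /negP /fK.
exact: Kz.
Qed.

(** By translation invariance the integral of $f(x+te_i)-f(x)$ is 0, while this difference is
    $t\,\partial_if$ up to an error at most $et$ on a fixed compact set; dividing by $t$ leaves an
    arbitrarily small bound. *)
Lemma integral_partial0 K f i : Ck 1 f -> compact K -> (forall z, f z != 0 -> K z) ->
  \int[mu]_x partial i f x = 0.
Proof.
move=> Cf cK fK.
have clK := rV_compact_closed cK.
have cf := Ck_continuous Cf.
have cp : continuous (partial i f) := Ck_continuous (Ck_partial i Cf).
have [M0 [_ HM]] := compact_bounded cK.
pose M := `|M0| + 1.
have KM z : K z -> `|z| <= M.
  by apply: HM; rewrite /M; have := ler_norm M0; lra.
have M1 : 0 < M by rewrite /M ltr_wpDl.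
(* The extra unit of radius contains all translates of the support by vectors of length at most 1,
   hence the support of the remainder [r] below. *)
pose C := closed_ball (0 : V) (M + 1).
have CE z : C z <-> `|z| <= M + 1.
  by rewrite /C closed_ballE /closed_ball_ /=; [rewrite sub0r normrN|lra].
have cC : compact C.
  apply: bounded_closed_compact; last exact: closed_ball_closed.
  exists (M + 1); split; first exact: num_real.
  by move=> r Mr z /CE h; exact: le_trans h (ltW Mr).
have mC := rV_compact_measurable cC.
have ip : mu.-integrable setT (EFin \o partial i f).
  apply: (@integrable_supp C) => //; last exact: continuous_integrable_compact.
  by move=> x /(partial_supp clK fK) /KM h; apply/CE; lra.
have if_ h : mu.-integrable setT (EFin \o (fun z => f (z + h))).
  have cKh : compact ((fun z => z - h) @` K).
    by apply: continuous_compact cK; apply: continuous_subspaceT; exact: continuous_shift.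
  apply: (@integrable_supp ((fun z => z - h) @` K)).
  - exact: rV_compact_measurable.
  - by move=> z /fK Kz; exists (z + h) => //; rewrite addrK.
  - apply: continuous_integrable_compact => // z.
    by apply: (@continuous_comp _ _ _ (fun v : V => v + h) f);
      [exact: continuous_shift|exact: cf].
have if0 : mu.-integrable setT (EFin \o f).
  by have := if_ 0; under [X in EFin \o X]eq_fun do rewrite addr0.
have mCfin : mu C \is a fin_num by rewrite ge0_fin_numE// rV_compact_lty.
have key (e : R) : 0 < e -> `|\int[mu]_x partial i f x| <= e * fine (mu C).
  move=> e0; have [d d0 Hd] := taylor_unif Cf cC e0.
  pose t := Num.min (d / 2) 1.
  have t0 : 0 < t by rewrite /t lt_min ltr01 andbT; lra.
  have td : t < d by rewrite /t gt_min; apply/orP; left; lra.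
  have t1 : t <= 1 by rewrite /t ge_min lexx orbT.
  pose k : V := t *: e_ i.
  have ek : enorm k = t by rewrite /k enormZ enorm_delta mulr1 gtr0_norm.
  have nk : `|k| <= t by rewrite -ek; exact: norm_le_enorm.
  pose r z := f (z + k) - f z - t * partial i f z.
  have fz0 z : ~ K z -> f z = 0.
    by move=> Kz; apply/eqP; apply: contrapT => /negP /fK.
  have rC z : r z != 0 -> C z.
    apply: contra_neqP => /CE/negP; rewrite -ltNge => zM.
    have Kz : ~ K z by move=> /KM; lra.
    have Kzk : ~ K (z + k).
      move=> /KM h; have := ler_normB (z + k) k; rewrite addrK => h'.
      by have := le_lt_trans (le_trans (le_refl _) nk) (ltr_pwDr t0 (lexx t)); lra.
    have pz : partial i f z = 0.
      by apply/eqP; apply: contrapT => /negP /(partial_supp clK fK).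
    by rewrite /r !fz0// pz; lra.
  have rle z : C z -> `|r z| <= e * t.
    move=> Cz; have := Hd z k Cz (le_lt_trans nk td).
    by rewrite ek /k dotZl dot_delta /grad mxE.
  have itp : mu.-integrable setT (EFin \o (fun z => t * partial i f z)).
    by apply: eq_integrable (integrableZl measurableT t ip).
  have ifB : mu.-integrable setT (EFin \o (fun z => f (z + k) - f z)).
    by apply: eq_integrable (integrableB measurableT (if_ k) if0).
  have ir : mu.-integrable setT (EFin \o r).
    by apply: eq_integrable (integrableB measurableT ifB itp).
  have Er : \int[mu]_x r x = - (t * \int[mu]_x partial i f x).
    rewrite /r RintegralB// RintegralB// RintegralZl//.
    rewrite (_ : \int[mu]_x f (x + k) = \int[mu]_x f x) ?subrr ?sub0r//.
    congr fine; apply: (@integral_shift k (EFin \o f)).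
    by apply/measurable_EFinP; exact: continuous_measurable_rV.
  have : `|\int[mu]_x r x| <= e * t * fine (mu C).
    rewrite -(Rintegral_supp rC); apply: le_trans.
      by apply: le_normr_Rintegral => //; exact: integrableS ir.
    rewrite -Rintegral_cst//; apply: le_Rintegral => //.
    - by apply: integrable_norm => //; exact: integrableS ir.
    - apply: (@bounded_integrable _ _ (e * t)) => //; first exact: rV_compact_lty.
      by move=> z _; rewrite ger0_norm// mulr_ge0// ltW.
  rewrite Er normrN normrM gtr0_norm// mulrAC mulrC.
  by rewrite ler_pM2r.
apply/eqP; rewrite -normr_le0; apply/ler_addgt0Pr => e e0; rewrite add0r.
have := @key (e / (fine (mu C) + 1)).
have C1 : 0 < fine (mu C) + 1 by rewrite ltr_wpDl// fine_ge0.
rewrite divr_gt0// => /(_ isT) /le_trans; apply.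
by rewrite mulrAC ler_pdivrMr// ler_pM2l// lerDl.
Qed.

End integration_by_parts.

(** * Test functions and smooth approximations of boxes *)

Section weak_gradient.
Context {R : realType} {N : nat}.
Local Notation V := 'rV[R]_N.
Local Notation mu := (lebesgueN R N).
Implicit Types (f g phi : V -> R) (x z w v h : V) (i : 'I_N) (K Omega : set V).

Lemma test_fun_intro Omega K phi : cinfty phi -> compact K -> K `<=` Omega ->
  (forall x, phi x != 0 -> K x) -> test_fun Omega phi.
Proof.
move=> cphi cK KO phiK.
have sub : closure [set x | phi x != 0] `<=` K.
  rewrite [X in _ `<=` X](closure_id K).1; last exact: rV_compact_closed.
  exact: closure_subset.
split => //; last exact: subset_trans KO.
by apply: subclosed_compact cK sub; exact: closed_closure.
Qed.

Lemma test_fun_supp Omega phi : test_fun Omega phi ->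
  exists K, [/\ compact K, K `<=` Omega & forall x, phi x != 0 -> K x].
Proof.
move=> [_ cK KO]; exists (closure [set x | phi x != 0]); split => // x px.
exact: subset_closure.
Qed.

Lemma test_fun0 Omega : test_fun Omega (fun=> 0).
Proof.
apply: (@test_fun_intro _ set0) => //; first by apply/cinftyP => n; exact: Ck_cst.
  exact: compact0.
by move=> x; rewrite eqxx.
Qed.

(** Although [f] need not have compact support, the product with [phi] does, and [integral_partial0]
    applies to it. *)
Lemma integral_byparts Omega f phi i : cinfty f -> test_fun Omega phi ->
  \int[mu]_(x in Omega) (f x * partial i phi x) =
  - \int[mu]_(x in Omega) (partial i f x * phi x).
Proof.
move=> cf tphi; have [K [cK KO phiK]] := test_fun_supp tphi.
have [cphi _ _] := tphi.
have clK := rV_compact_closed cK.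
have pK x : partial i phi x != 0 -> K x := partial_supp clK phiK.
have s1 x : f x * partial i phi x != 0 -> K x.
  by move=> h; apply: pK; apply: contra_neq h => ->; rewrite mulr0.
have s2 x : partial i f x * phi x != 0 -> K x.
  by move=> h; apply: phiK; apply: contra_neq h => ->; rewrite mulr0.
rewrite Rintegral_supp; last by move=> x /s1 /KO.
rewrite [in RHS]Rintegral_supp; last by move=> x /s2 /KO.
have cM g1 g2 : cinfty g1 -> cinfty g2 -> continuous (fun x => g1 x * g2 x : R).
  by move=> c1 c2; apply: (@Ck_continuous _ _ 0%N); apply: Ck_M; exact: cinfty_Ck.
have mK := rV_compact_measurable cK.
have i1 : mu.-integrable setT (EFin \o (fun x => f x * partial i phi x)).
  apply: (integrable_supp mK s1); apply: continuous_integrable_compact => //.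
  exact: cM cf (cinfty_partial i cphi).
have i2 : mu.-integrable setT (EFin \o (fun x => partial i f x * phi x)).
  apply: (integrable_supp mK s2); apply: continuous_integrable_compact => //.
  exact: cM (cinfty_partial i cf) cphi.
apply/eqP; rewrite -addr_eq0 -RintegralD//; apply/eqP.
rewrite -(@integral_partial0 _ _ K (fun x => f x * phi x) i)//.
- apply: eq_Rintegral => x _; apply/esym/partialE.
  rewrite [partial i f x * _]mulrC.
  by apply: is_deriveM; exact: cinfty_is_derive.
- by apply: Ck_M; exact: cinfty_Ck.
- by move=> x h; apply: phiK; apply: contra_neq h => ->; rewrite mulr0.
Qed.

Lemma is_weak_grad_smooth Omega f : open Omega -> cinfty f ->
  is_weak_grad Omega f (grad f).
Proof.
move=> oO cf; split.
- split; first by apply: continuous_measurable_on; exact: cinfty_continuous.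
  by move=> K cK _; apply: continuous_integrable_compact => //; exact: cinfty_continuous.
- move=> i; rewrite /grad; under eq_fun do rewrite mxE.
  have cp : continuous (partial i f) by apply: cinfty_continuous; exact: cinfty_partial.
  split; first exact: continuous_measurable_on.
  by move=> K cK _; exact: continuous_integrable_compact.
- move=> phi i tphi; rewrite integral_byparts//.
  by congr (- _); apply: eq_Rintegral => x _; rewrite /grad mxE.
Qed.

(** The positive and negative parts of the charge with density [g] agree on the pi-system of boxes,
    hence everywhere; so [g] has integral 0 over every measurable set. *)
Lemma ae_eq0_boxes (g : V -> R) : mu.-integrable setT (EFin \o g) ->
  (forall a b, \int[mu]_(x in box a b) g x = 0) ->
  \forall y \ae mu, g y = 0.
Proof.
move=> ig H.
pose nu := induced_charge ig.
have [P [Q PQ]] := Hahn_decomposition nu.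
have nuE A : measurable A -> nu A = (jordan_pos PQ A - jordan_neg PQ A)%E.
  by move=> mA; rewrite [LHS](jordan_decomp PQ mA) /cadd/= cscaleN1.
have eqpn A : measurable A -> jordan_pos PQ A = jordan_neg PQ A.
  apply: (@measure_unique _ R V [set A | exists a b, A = box a b]
    (fun n : nat => cube 0 n%:R)).
  - exact: measurable_boxE.
  - exact: box_setI_closed.
  - by move=> n; eexists; eexists.
  - apply/seteqP; split => // v _; exists (Num.truncn `|v|).+1 => //.
    by apply: norm_cube; rewrite subr0; exact: truncnS_gt.
  - move=> _ [a [b ->]].
    have : nu (box a b) = 0%E.
      have /fineK <- : nu (box a b) \is a fin_num.
        by apply: fin_num_measure; exact: measurable_box.
      by congr EFin; exact: H.
    rewrite (nuE _ (measurable_box _ _)) => h.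
    have fn : jordan_neg PQ (box a b) \is a fin_num.
      by apply: fin_num_measure; exact: measurable_box.
    by rewrite -[LHS](subeK _ fn) [X in (X + _)%E]h add0e.
  - move=> n; rewrite -ge0_fin_numE//; apply: fin_num_measure; exact: measurable_cube.
have : ae_eq mu setT (EFin \o g) (cst 0%E).
  apply: integral_ae_eq => // E _ mE; rewrite integral0.
  rewrite -[LHS]/(nu E) nuE// eqpn// subee//.
  exact: fin_num_measure.
by apply: filterS => y /= /(_ I) [].
Qed.

Lemma expinv0_near1 (s : R) : 0 < s -> `|1 - expinv 0 s| <= s^-1.
Proof.
move=> s0; rewrite ger0_norm; last by rewrite subr_ge0 expinv0_le1.
rewrite /expinv s0 expr0 mul1r; have := expR_ge1Dx (- s^-1); lra.
Qed.

Lemma cvg_expinv0 (u : nat -> R) : u n @[n --> \oo] --> +oo ->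
  expinv 0 (u n) @[n --> \oo] --> (1 : R).
Proof.
move=> /cvgryPgt uoo; apply/cvgrPdist_lt => e e0.
near=> n; have un : e^-1 < u n by near: n; exact: uoo.
have u0 : 0 < u n by apply: lt_trans un; rewrite invr_gt0.
apply: le_lt_trans (expinv0_near1 u0) _.
by rewrite invf_plt ?posrE.
Unshelve. all: by end_near. Qed.

Lemma nat_mul_cvgy (c d : R) : 0 < c -> (n%:R * c + d) @[n --> \oo] --> +oo.
Proof.
move=> c0; apply/cvgryPge => A; near=> n.
rewrite -lerBlDr -ler_pdivrMr//; near: n; exact: nbhs_infty_ger.
Unshelve. all: by end_near. Qed.

(* [bump a b n] increases to the indicator function of [box a b]; the second factor
   is positive at the closed end of the interval. *)
Definition bump (a b : 'I_N -> R) (n : nat) v : R :=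
  \prod_(i < N) (expinv 0 (n%:R * (v 0 i - a i)) *
                 expinv 0 (n%:R * (n%:R * (b i - v 0 i) + 1))).

Lemma cinfty_bump a b n : cinfty (bump a b n).
Proof.
apply/cinftyP => m; apply: Ck_prod => i; apply: Ck_M; apply: Ck_expinv.
- by apply: Ck_Z; apply: Ck_D; [exact: Ck_coord|exact: Ck_cst].
- apply: Ck_Z; apply: Ck_D; last exact: Ck_cst.
  apply: Ck_Z; apply: Ck_D; first exact: Ck_cst.
  under eq_fun do rewrite -mulN1r; apply: Ck_Z; exact: Ck_coord.
Qed.

Lemma bump_ge0 a b n v : 0 <= bump a b n v.
Proof. by apply: prodr_ge0 => i _; rewrite mulr_ge0// expinv_ge0. Qed.

Lemma bump_le1 a b n v : bump a b n v <= 1.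
Proof.
apply: prodr_ile1 => i _; rewrite mulr_ge0 ?expinv_ge0//=.
by rewrite mulr_ile1// ?expinv_ge0// expinv0_le1.
Qed.

Lemma bump_supp a b n v : (0 < n)%N -> bump a b n v != 0 ->
  forall i, a i <= v 0 i <= b i + n%:R^-1.
Proof.
move=> n0 bn i; have n0' : 0 < n%:R :> R by rewrite ltr0n.
have : expinv 0 (n%:R * (v 0 i - a i)) *
    expinv 0 (n%:R * (n%:R * (b i - v 0 i) + 1)) != 0.
  by apply: contra_neq bn => h; rewrite /bump (bigD1 i)//= h mul0r.
rewrite mulf_eq0 negb_or => /andP[h1 h2]; apply/andP; split.
  rewrite leNgt; apply: contra h1 => h; apply/eqP/expinv_le0.
  by rewrite pmulr_rle0// subr_le0 ltW.
rewrite leNgt; apply: contra h2 => h; apply/eqP/expinv_le0.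
rewrite pmulr_rle0// -lerBrDr sub0r -ler_pdivlMl// mulrN1.
by rewrite lerBlDr addrC; rewrite -lerBlDr opprK ltW.
Qed.

Lemma cvg_bump a b v : bump a b n v @[n --> \oo] --> (\1_(box a b) v : R).
Proof.
rewrite indicE; have [vab|vab] := boolP (v \in box a b).
  rewrite (_ : true%:R = \prod_(i < N) (1 * 1 : R)); last first.
    by rewrite mulr1 big1.
  apply: cvg_big => [|i _].
    exact: mul_continuous.
  have /(_ i)/andP[av vb] := set_mem vab.
  apply: cvgM; apply: cvg_expinv0.
    have := @nat_mul_cvgy (v 0 i - a i) 0; rewrite subr_gt0 => /(_ av).
    by under eq_fun do rewrite addr0.
  apply/cvgryPge => A; near=> n; apply: (@le_trans _ _ n%:R).
    by near: n; exact: nbhs_infty_ger.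
  rewrite -[leLHS]mulr1 ler_wpM2l// lerDr mulr_ge0// subr_ge0//.
have /existsNP[i /negP] : ~ box a b v by move=> h; move/negP: vab; apply; exact: mem_set.
rewrite negb_and -leNgt -ltNge => vi.
apply: cvg_near_cst.
near=> n; rewrite /bump (bigD1 i)//=; case/orP: vi => vi.
  by rewrite expinv_le0 ?mul0r// mulr_ge0_le0// subr_le0.
rewrite [X in _ * X * _]expinv_le0 ?mulr0 ?mul0r//.
rewrite mulr_ge0_le0// -lerBrDr sub0r.
have vb : 0 < v 0 i - b i by rewrite subr_gt0.
rewrite -[b i - _]opprB mulrN lerN2 -ler_pdivrMr//.
by near: n; exact: nbhs_infty_ger.
Unshelve. all: by end_near. Qed.

End weak_gradient.

(** * Uniqueness of weak gradients *)

Section fundamental_lemma.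
Context {R : realType} {N : nat}.
Local Notation V := 'rV[R]_N.
Local Notation mu := (lebesgueN R N).
Implicit Types (f u phi : V -> R) (g : V -> V) (K Omega : set V).

(** Near a point, testing with bumps and passing to the limit by dominated convergence shows that
    [f] has integral 0 over every box in a small cube; [ae_eq0_boxes] concludes for [f] cut off to
    that cube. *)
Lemma fundamental_lemma Omega f : open Omega -> loc_integrable Omega f ->
  (forall phi, test_fun Omega phi -> \int[mu]_(x in Omega) (f x * phi x) = 0) ->
  \forall y \ae mu, Omega y -> f y = 0.
Proof.
move=> oO [mf Lf] H; apply: ae_local => c Oc.
have /nbhs_ballP[r /= r0 rO] : nbhs c Omega by exact: open_nbhs_nbhs.
(* The boxes lie in the cube of radius [e]; bumps with [n%:R^-1 <= e] are supported in [K], of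
   radius [2 * e], which is still inside the ball of radius [r]. *)
pose e := r / 3; have e0 : 0 < e by rewrite /e; lra.
have e20 : 0 < 2 * e by rewrite mulr_gt0.
pose K := closed_ball c (2 * e).
have KE z : K z <-> `|c - z| <= 2 * e by rewrite /K closed_ballE.
have KO : K `<=` Omega.
  by move=> z /KE h; apply: rO; rewrite -ball_normE/=; rewrite /e in h; lra.
have cK : compact K.
  apply: bounded_closed_compact; last exact: closed_ball_closed.
  exists (`|c| + 2 * e); split; first exact: num_real.
  move=> M hM z /KE h; apply: le_trans (ltW hM).
  by have := ler_normB c (c - z); rewrite opprB addrC subrK; lra.
have mK := rV_compact_measurable cK.
have ifK : mu.-integrable K (EFin \o f) by exact: Lf.
have mC : measurable (cube c e) by exact: measurable_cube.
have CK : cube c e `<=` K.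
  by move=> z /(cube_norm (ltW e0)) h; apply/KE; rewrite distrC; lra.
exists (ball c e); first by split; [exact: ball_open|exact: ballxx].
have : \forall y \ae mu, (f \_ (cube c e)) y = 0.
  apply: ae_eq0_boxes.
    rewrite -restrict_EFin; apply/(integrable_mkcond _ mC).
    exact: (integrableS mK mC CK ifK).
  move=> a b; rewrite -Rintegral_mkcondr box_setI.
  set a' := fun i => _; set b' := fun i => _.
  have BK : box a' b' `<=` K.
    move=> z Hz; apply: CK => i; have := Hz i; rewrite /a' /b' gt_max le_min.
    by move=> /andP[/andP[_ ->] /andP[_ ->]].
  have mfK : measurable_fun K f by apply: measurable_funS mf => //; exact: open_measurable_rV.
  have mfb n : measurable_fun K (fun x => f x * bump a' b' n x).
    apply: measurable_funM => //; apply: continuous_measurable_on.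
    exact/cinfty_continuous/cinfty_bump.
  have mb : measurable_fun K (fun x => (f x * \1_(box a' b') x)%:E).
    apply/measurable_EFinP; apply: measurable_funM => //.
    by apply: measurable_indic; exact: measurable_box.
  have cb : {ae mu, forall x, K x ->
      (f x * bump a' b' n x)%:E @[n --> \oo] --> (f x * \1_(box a' b') x)%:E}.
    apply: aeW => x Kx; apply: cvg_EFin; first exact: nearW.
    by apply: cvgM; [exact: cvg_cst|exact: cvg_bump].
  have db : {ae mu, forall x n, K x -> (`|(f x * bump a' b' n x)%:E| <= `|f x|%:E)%E}.
    by apply: aeW => x n Kx; rewrite lee_fin normrM ler_piMr// ger0_norm ?bump_ge0// bump_le1.
  have [_ _ cvgI] := dominated_convergence mK
    (fun n => proj2 (measurable_EFinP _ _) (mfb n)) mb cb (integrable_norm ifK) db.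
  have I0 : \forall n \near \oo, (\int[mu]_(x in K) (f x * bump a' b' n x)%:E)%E = 0%E.
    near=> n.
    have n0 : (0 < n)%N by near: n; exact: nbhs_infty_gt.
    have ne : n%:R^-1 <= e.
      rewrite invf_ple ?posrE ?ltr0n//; near: n; exact: nbhs_infty_ger.
    have bK x : bump a' b' n x != 0 -> K x.
      move=> /(bump_supp n0) h; apply/KE; rewrite distrC; apply: norm_le_coord.
        exact: ltW.
      move=> i; rewrite !mxE; have := h i; rewrite /a' /b'.
      rewrite ge_max -lerBlDr le_min => /andP[/andP[_ h1] /andP[_ h2]].
      by rewrite ler_norml; apply/andP; split; lra.
    have tb : test_fun Omega (bump a' b' n).
      by apply: test_fun_intro bK => //; exact: cinfty_bump.
    have fbK x : f x * bump a' b' n x != 0 -> K x.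
      by move=> h; apply: bK; apply: contra_neq h => ->; rewrite mulr0.
    have := H _ tb; rewrite Rintegral_supp; last by move=> x /fbK /KO.
    rewrite -(Rintegral_supp fbK) => h.
    have /fineK <- : (\int[mu]_(x in K) (f x * bump a' b' n x)%:E)%E \is a fin_num.
      apply: integrable_fin_num => //; apply: le_integrable (integrable_norm ifK) => //.
        exact/measurable_EFinP.
      move=> x Kx /=; rewrite lee_fin normr_id normrM ler_piMr//.
      by rewrite ger0_norm ?bump_ge0// bump_le1.
    by congr EFin; exact: h.
  have I1 : (\int[mu]_(x in K) (f x * \1_(box a' b') x)%:E)%E = 0%E.
    rewrite -[LHS](cvg_lim (@ereal_hausdorff R) cvgI).
    by apply: cvg_lim; [exact: ereal_hausdorff|exact: cvg_near_cst].
  rewrite -[RHS]/(fine 0%E) -I1; congr fine.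
  rewrite -{1}(setIidr BK) integral_mkcondr; apply: eq_integral => x _ /=.
  by rewrite /patch indicE; case: ifPn => _ /=; rewrite ?mulr1 ?mulr0.
apply: filterS => y + cy; rewrite /patch ifT//; apply/mem_set.
by apply: norm_cube; move: cy; rewrite -ball_normE/= distrC.
Unshelve. all: by end_near. Qed.

Lemma is_weak_grad_unique Omega u g1 g2 : open Omega ->
  is_weak_grad Omega u g1 -> is_weak_grad Omega u g2 ->
  \forall y \ae mu, Omega y -> g1 y = g2 y.
Proof.
move=> oO [_ L1 I1] [_ L2 I2].
have H i : \forall y \ae mu, Omega y -> g1 y 0 i = g2 y 0 i.
  have L : loc_integrable Omega (fun x => g1 x 0 i - g2 x 0 i).
    have [m1 i1] := L1 i; have [m2 i2] := L2 i; split; first exact: measurable_funB.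
    move=> K cK KO; have mK := rV_compact_measurable cK.
    by apply: eq_integrable (integrableB mK (i1 K cK KO) (i2 K cK KO)).
  suff: \forall y \ae mu, Omega y -> g1 y 0 i - g2 y 0 i = 0.
    by apply: filterS => y h /h /eqP; rewrite subr_eq0 => /eqP.
  apply: fundamental_lemma L _ => // phi tphi.
  have [K [cK KO phiK]] := test_fun_supp tphi.
  have mK := rV_compact_measurable cK.
  have cphi : continuous phi by apply: cinfty_continuous; case: tphi.
  have [M M0 phiM] := continuous_compact_bounded cK cphi.
  have ip g : loc_integrable Omega (fun x => g x 0 i) ->
      mu.-integrable K (EFin \o (fun x => g x 0 i * phi x)).
    move=> [mg /(_ K cK KO) ig].
    apply: (@le_integrable _ _ _ _ _ mK _ (fun x => (M * `|g x 0 i|)%:E)).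
    - apply/measurable_EFinP; apply: measurable_funM.
        by apply: measurable_funS mg => //; exact: open_measurable_rV.
      exact: continuous_measurable_on.
    - move=> x Kx /=; rewrite lee_fin normrM mulrC [X in _ <= X]ger0_norm.
        by rewrite ler_wpM2r// phiM.
      by rewrite mulr_ge0// ltW.
    - exact: eq_integrable (integrableZl mK M (integrable_norm ig)).
  have s1 g x : g x 0 i * phi x != 0 -> K x.
    by move=> h; apply: phiK; apply: contra_neq h => ->; rewrite mulr0.
  have EK g : \int[mu]_(x in Omega) (g x 0 i * phi x) =
      \int[mu]_(x in K) (g x 0 i * phi x).
    rewrite Rintegral_supp; last by move=> x /s1 /KO.
    by rewrite [RHS]Rintegral_supp//; exact: s1.
  have := EK (fun x => g1 x - g2 x).
  under eq_Rintegral do rewrite !mxE.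
  move=> ->; under eq_Rintegral do rewrite !mxE mulrBl.
  rewrite RintegralB//; [|exact: ip|exact: ip].
  rewrite -!EK; apply/eqP; rewrite subr_eq0 -eqr_opp; apply/eqP.
  by rewrite -I1// -I2.
have : \forall y \ae mu, forall i, Omega y -> g1 y 0 i = g2 y 0 i.
  exact: filter_forall.
by apply: filterS => y h Oy; apply/rowP => i; exact: h.
Qed.

End fundamental_lemma.

(** * Sobolev norms *)

Section sobolev_norms.
Context {R : realType} {N : nat}.
Local Notation V := 'rV[R]_N.
Local Notation mu := (lebesgueN R N).
Implicit Types (f u phi : V -> R) (g G : V -> V) (D Omega : set V) (q : R).

Lemma measurable_fun_enorm D G :
  (forall i, measurable_fun D (fun x => G x 0 i)) ->
  measurable_fun D (fun x => enorm (G x)).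
Proof.
move=> mG.
have -> : (fun x => enorm (G x)) = (fun s : R => s `^ 2^-1) \o
    (fun x => \sum_(i <- index_enum 'I_N) G x 0 i ^+ 2).
  by apply/funext => x /=; rewrite powR12_sqrt// sumr_ge0// => i _; exact: sqr_ge0.
apply: measurableT_comp; first exact: measurable_powR.
by apply: measurable_sum => i; exact: measurable_funX.
Qed.

Lemma poweR_normLp Omega q f : measurable Omega -> 0 < q ->
  (normLp Omega q%:E f `^ q = \int[mu]_(x in Omega) (`|f x| `^ q)%:E)%E.
Proof.
move=> mO q0; have qN0 : q != 0 by rewrite gt_eqF.
rewrite /normLp (poweR_Lnorm _ _ qN0).
rewrite [RHS]integral_mkcond; apply: eq_integral => x _.
by rewrite /= !patchE; case: ifPn => _; rewrite ?normr0 ?powR0.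
Qed.

Lemma normLp_powV Omega q f : measurable Omega -> 0 < q ->
  (normLp Omega q%:E f = (\int[mu]_(x in Omega) (`|f x| `^ q)%:E) `^ q^-1)%E.
Proof.
move=> mO q0; have qN0 : q != 0 by rewrite gt_eqF.
rewrite -(poweR_normLp f mO q0) -poweRrM (mulfV qN0) poweRe1//; exact: Lnorm_ge0.
Qed.

Lemma normLp_ge0 Omega p f : (0 <= normLp Omega p f)%E.
Proof. exact: Lnorm_ge0. Qed.

Lemma measurable_abs_powR D f q : measurable_fun D f ->
  measurable_fun D (fun x => (`|f x| `^ q)%:E).
Proof.
move=> mf; apply/measurable_EFinP.
apply: (@measurableT_comp _ _ _ _ _ _ (@powR R ^~ q)) => //.
exact: measurableT_comp.
Qed.

Lemma le_normLp Omega q f1 f2 : measurable Omega -> 0 < q ->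
  measurable_fun Omega f1 -> measurable_fun Omega f2 ->
  (\forall x \ae mu, Omega x -> `|f1 x| <= `|f2 x|) ->
  (normLp Omega q%:E f1 <= normLp Omega q%:E f2)%E.
Proof.
move=> mO q0 m1 m2 H; rewrite (normLp_powV f1 mO q0) (normLp_powV f2 mO q0).
have q0' : 0 <= q^-1 by rewrite invr_ge0 ltW.
have I0 f : (0 <= \int[mu]_(x in Omega) (`|f x| `^ q)%:E)%E.
  by apply: integral_ge0 => x _; rewrite lee_fin powR_ge0.
apply: (gt0_ler_poweR q0'); [by rewrite in_itv /= I0 leey|by rewrite in_itv /= I0 leey|].
apply: ae_ge0_le_integral => //; try exact: measurable_abs_powR.
apply: filterS H => x h Ox; rewrite lee_fin ge0_ler_powR ?nnegrE//; last exact: h.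
exact: ltW.
Qed.

Lemma normLp_triangle Omega q f1 f2 : measurable Omega -> 1 <= q ->
  measurable_fun Omega f1 -> measurable_fun Omega f2 ->
  (normLp Omega q%:E (fun x => (f1 x + f2 x)%R) <=
   normLp Omega q%:E f1 + normLp Omega q%:E f2)%E.
Proof.
move=> mO q1 m1 m2; rewrite /normLp.
have -> : (fun x => f1 x + f2 x) \_ Omega = ((f1 \_ Omega) \+ (f2 \_ Omega))%R.
  by apply/funext => x; rewrite /= !patchE; case: ifPn => //; rewrite addr0.
by apply: minkowski_EFin => //; apply/(measurable_restrictT _ mO).
Qed.

Lemma normLpoo_le Omega f (M : R) : 0 <= M ->
  (\forall x \ae mu, Omega x -> `|f x| <= M) -> (normLp Omega +oo f <= M%:E)%E.
Proof.
move=> M0 H; rewrite /normLp unlock /Lnorm; case: ifP => _; last by rewrite lee_fin.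
apply/ess_supP; apply: filterS H => x h /=; rewrite patchE.
by case: ifPn => [/set_mem/h|_]; rewrite lee_fin// normr0.
Qed.

(** The norm at infinity is the essential supremum only if the whole space has positive measure, and
    0 otherwise. *)
Lemma lebesgueN_setT_gt0 : (0 < mu [set: V])%E.
Proof. by apply: lebesgueN_open_gt0; [exact: openT|exists 0]. Qed.

Lemma le_normLpoo Omega f : \forall x \ae mu, Omega x ->
  (`|f x|%:E <= normLp Omega +oo f)%E.
Proof.
rewrite /normLp unlock /Lnorm lebesgueN_setT_gt0.
apply: filterS (ess_sup_ge mu (abse \o (EFin \o f \_ Omega))) => x /= + Ox.
by rewrite patchE mem_set.
Qed.

Lemma eq_normLp Omega p f1 f2 : measurable Omega -> (0 < p)%E ->
  measurable_fun Omega f1 -> measurable_fun Omega f2 ->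
  (\forall x \ae mu, Omega x -> f1 x = f2 x) -> normLp Omega p f1 = normLp Omega p f2.
Proof.
move=> mO; case: p => [q q0|_|//] m1 m2 H.
  by apply/eqP; rewrite eq_le !le_normLp//; apply: filterS H => x h /h ->.
rewrite /normLp unlock /Lnorm lebesgueN_setT_gt0; apply: eq_ess_sup.
by apply: filterS H => x h /=; rewrite !patchE; case: ifPn => // /set_mem/h ->.
Qed.

Lemma weak_grad_measurable Omega u g : is_weak_grad Omega u g ->
  measurable_fun Omega (fun x => enorm (g x)).
Proof. by move=> [_ L _]; apply: measurable_fun_enorm => i; case: (L i). Qed.

Lemma wgradP Omega u g : is_weak_grad Omega u g -> is_weak_grad Omega u (wgrad Omega u).
Proof. by move=> ug; apply: (@getPex _ (is_weak_grad Omega u)); exists g. Qed.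

(** [wgrad] is an arbitrary choice among weak gradients; since these agree almost everywhere, any of
    them computes the norm. *)
Lemma normgradE Omega p u g : open Omega -> (0 < p)%E ->
  is_weak_grad Omega u g -> normgrad Omega p u = normLp Omega p (fun x => enorm (g x)).
Proof.
move=> oO p0 ug; have ug' := wgradP ug.
apply: eq_normLp => //; [exact: open_measurable_rV|exact: weak_grad_measurable ug'|
  exact: weak_grad_measurable ug|].
by apply: filterS (is_weak_grad_unique oO ug' ug) => x h /h ->.
Qed.

Lemma cinfty_sub f phi : cinfty f -> cinfty phi -> cinfty (fun x => f x - phi x).
Proof.
move=> cf cp; apply/cinftyP => n; apply: Ck_D; first exact: cinfty_Ck.
by under eq_fun do rewrite -mulN1r; apply: Ck_Z; exact: cinfty_Ck.
Qed.

Lemma grad_measurable D phi i : cinfty phi -> measurable_fun D (fun x => grad phi x 0 i).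
Proof.
move=> cp; rewrite /grad; under eq_fun do rewrite mxE.
by apply: continuous_measurable_on; apply: cinfty_continuous; exact: cinfty_partial.
Qed.

Lemma is_weak_grad_sub Omega u g phi : open Omega -> is_weak_grad Omega u g ->
  test_fun Omega phi ->
  is_weak_grad Omega (fun x => u x - phi x) (fun x => g x - grad phi x).
Proof.
move=> oO [[mu_ Lu] Lg Ig] tphi; have [cphi _ _] := tphi.
have [[mphi Lphi] Lgphi Iphi] := is_weak_grad_smooth oO cphi.
split.
- split; first exact: measurable_funB.
  move=> K cK KO; have mK := rV_compact_measurable cK.
  by apply: eq_integrable (integrableB mK (Lu K cK KO) (Lphi K cK KO)).
- move=> i; have [m1 i1] := Lg i; have [m2 i2] := Lgphi i.
  have -> : (fun x => (g x - grad phi x) 0 i) = (fun x => g x 0 i - grad phi x 0 i).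
    by apply/funext => x; rewrite !mxE.
  split; first exact: measurable_funB.
  move=> K cK KO; have mK := rV_compact_measurable cK.
  by apply: eq_integrable (integrableB mK (i1 K cK KO) (i2 K cK KO)).
move=> psi i tpsi; have [K [cK KO psiK]] := test_fun_supp tpsi.
have mK := rV_compact_measurable cK.
have [cpsi _ _] := tpsi.
have ip (f h : V -> R) : loc_integrable Omega f -> continuous h ->
    mu.-integrable K (EFin \o (fun x => f x * h x)).
  move=> [mf /(_ K cK KO) if_] ch; have [M M0 hM] := continuous_compact_bounded cK ch.
  apply: (@le_integrable _ _ _ _ _ mK _ (fun x => (M * `|f x|)%:E)).
  - apply/measurable_EFinP; apply: measurable_funM; last exact: continuous_measurable_on.
    by apply: measurable_funS mf => //; exact: open_measurable_rV.
  - move=> x Kx /=; rewrite lee_fin normrM mulrC [X in _ <= X]ger0_norm.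
      by rewrite ler_wpM2r// hM.
    by rewrite mulr_ge0// ltW.
  - exact: eq_integrable (integrableZl mK M (integrable_norm if_)).
have pK x : partial i psi x != 0 -> K x := partial_supp (rV_compact_closed cK) psiK.
have EK (f h : V -> R) : (forall x, h x != 0 -> K x) ->
    \int[mu]_(x in Omega) (f x * h x) = \int[mu]_(x in K) (f x * h x).
  move=> hK; have s x : f x * h x != 0 -> K x.
    by move=> H; apply: hK; apply: contra_neq H => ->; rewrite mulr0.
  rewrite Rintegral_supp; last by move=> x /s /KO.
  by rewrite [RHS]Rintegral_supp.
have cpi := cinfty_continuous (cinfty_partial i cpsi).
have cps := cinfty_continuous cpsi.
have subE (f1 f2 h : V -> R) : loc_integrable Omega f1 -> loc_integrable Omega f2 ->
    continuous h -> (forall x, h x != 0 -> K x) ->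
    \int[mu]_(x in Omega) ((f1 x - f2 x) * h x) =
    \int[mu]_(x in Omega) (f1 x * h x) - \int[mu]_(x in Omega) (f2 x * h x).
  move=> L1 L2 ch hK; rewrite !EK// -RintegralB//; [|exact: ip|exact: ip].
  by apply: eq_Rintegral => x _; rewrite mulrBl.
rewrite subE//.
under [in RHS]eq_Rintegral do rewrite !mxE.
rewrite (subE (fun x => g x 0 i) (fun x => partial i phi x))//; last first.
  by have := Lgphi i; rewrite /grad; under eq_fun do rewrite mxE.
rewrite Ig// Iphi//; under [X in _ - - X]eq_Rintegral do rewrite /grad mxE.
by rewrite opprB addrC opprK.
Qed.

(** Reduces membership in [W10] to a single smooth function close in norm, to which classical
    calculus applies. *)
Lemma W10_approx Omega q u (e : R) : open Omega -> 1 <= q -> W10 q Omega u -> 0 < e ->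
  exists phi, [/\ test_fun Omega phi,
    (normLp Omega q%:E (fun x => (u x - phi x)%R) <= e%:E)%E &
    (normLp Omega q%:E (fun x => enorm (wgrad Omega u x - grad phi x)) <= e%:E)%E].
Proof.
move=> oO q1 [[mu_ [g ug] _ _] [phi [tphi /fine_cvgP[fphi /cvgrPdist_lt cphi]]]] e0.
have {}cphi := cphi e e0.
have q0 : 0 < q by apply: lt_le_trans q1.
(* [fine] sends an infinite norm to 0, so finiteness has to be obtained together with smallness. *)
have [k [fk ck]] : exists k, normW1 Omega q%:E (fun x => u x - phi k x) \is a fin_num /\
    `|0 - (fine \o (fun k => normW1 Omega q%:E (fun x => u x - phi k x))) k| < e.
  by near \oo => k; exists k; split; near: k.
exists (phi k).
have ug' := wgradP ug.
have q0' : (0 < q%:E)%E by rewrite lte_fin.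
have E := normgradE oO q0'
  (is_weak_grad_sub oO ug' (tphi k)).
have le_e : (normW1 Omega q%:E (fun x => (u x - phi k x)%R) <= e%:E)%E.
  move: ck; rewrite sub0r normrN => /(le_lt_trans (ler_norm _)) /ltW.
  by rewrite -lee_fin /= fineK.
split => //; apply: le_trans le_e; rewrite /normW1.
  by rewrite leeDl// normLp_ge0.
by rewrite -E leeDr// normLp_ge0.
Unshelve. all: by end_near. Qed.

End sobolev_norms.

(** * Averages of smooth functions along a translation *)

Section lipschitz.
Context {R : realType} {N : nat}.
Local Notation V := 'rV[R]_N.
Local Notation mu := (lebesgueN R N).
Implicit Types (f phi : V -> R) (D Q : set V) (h x y z : V).

Lemma continuous_grad phi : cinfty phi -> continuous (grad phi).
Proof.
move=> cp x; apply/(@cvgrPdist_le _ _ _ (nbhs x)) => e e0.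
have H : \forall y \near x, forall i, `|partial i phi x - partial i phi y| <= e.
  apply: (@filter_forall V 'I_N
    (fun i y => `|partial i phi x - partial i phi y| <= e) (nbhs x)) => i.
  have c : continuous (partial i phi) := cinfty_continuous (cinfty_partial i cp).
  by have /(@cvgrPdist_le _ _ _ (nbhs x))/(_ _ e0) := c x.
apply: filterS H => y H; apply: norm_le_coord => [|i]; first exact: ltW.
by rewrite !mxE; exact: H.
Qed.

Lemma continuous_enorm_grad phi : cinfty phi -> continuous (fun x => enorm (grad phi x)).
Proof.
move=> cp x; apply: (@continuous_comp _ _ _ (grad phi) (@enorm R N)).
  exact: continuous_grad.
exact: continuous_enorm.
Qed.

Lemma bounded_sub_compact D : bounded_set D -> exists2 K : set V, compact K & D `<=` K.
Proof.
move=> [M [_ HM]]; pose K := closed_ball (0 : V) (`|M| + 1).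
have M1 : 0 < `|M| + 1 by rewrite ltr_wpDl.
exists K.
  apply: bounded_closed_compact; last exact: closed_ball_closed.
  exists (`|M| + 1); split; first exact: num_real.
  move=> r Mr z; rewrite /K closed_ballE// /closed_ball_/= sub0r normrN => h.
  exact: le_trans h (ltW Mr).
move=> z Dz; rewrite /K closed_ballE// /closed_ball_/= sub0r normrN.
by apply: HM Dz; have := ler_norm M; lra.
Qed.

Lemma continuous_bounded_on D f : bounded_set D -> continuous f ->
  exists2 M : R, 0 < M & forall z, D z -> `|f z| <= M.
Proof.
move=> /bounded_sub_compact[K cK DK] cf.
have [M M0 fM] := continuous_compact_bounded cK cf.
by exists M => // z /DK; exact: fM.
Qed.

Lemma continuous_integrable_bounded D f : measurable D -> bounded_set D ->
  continuous f -> mu.-integrable D (EFin \o f).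
Proof.
move=> mD /bounded_sub_compact[K cK DK] cf.
by apply: integrableS (continuous_integrable_compact cK cf) => //;
  exact: rV_compact_measurable.
Qed.

(** The translation is cut into [n] equal steps. The Taylor error of one step is proportional to its
    length, so the total error is at most [e' * enorm h * m], whatever [n] is, and no integration in
    [t] is needed. *)
Lemma path_average_le phi Q h (L : R) : cinfty phi -> measurable Q -> bounded_set Q ->
  (forall t : R, 0 <= t <= 1 ->
     \int[mu]_(y in Q) enorm (grad phi (y + t *: h)) <= L) ->
  `|\int[mu]_(y in Q) phi (y + h) - \int[mu]_(y in Q) phi y| <= enorm h * L.
Proof.
move=> cp mQ bQ HL.
have cphi := cinfty_continuous cp.
have cshift f k : continuous f -> continuous (fun y => f (y + k)).
  move=> cf y; apply: (@continuous_comp _ _ _ (fun v : V => v + k) f).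
    exact: continuous_shift.
  exact: cf.
have ishift f k : continuous f -> mu.-integrable Q (EFin \o (fun y => f (y + k))).
  by move=> cf; apply: continuous_integrable_bounded => //; exact: cshift.
have [M [_ HM]] := bQ.
pose M' := `|M| + 1 + `|h|.
have M'0 : 0 < M' by rewrite /M' ltr_wpDr// ltr_wpDl.
pose K := closed_ball (0 : V) M'.
have KE z : K z <-> `|z| <= M' by rewrite /K closed_ballE// /closed_ball_/= sub0r normrN.
have cK : compact K.
  apply: bounded_closed_compact; last exact: closed_ball_closed.
  exists M'; split; first exact: num_real.
  by move=> r Mr z /KE h'; exact: le_trans h' (ltW Mr).
have Qfin : mu Q \is a fin_num by rewrite ge0_fin_numE// bounded_lebesgueN_lty.
set m := fine (mu Q); have m0 : 0 <= m by rewrite fine_ge0.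
apply/ler_addgt0Pr => e e0.
have e'0 : 0 < e / (enorm h * m + 1).
  by rewrite divr_gt0// ltr_wpDl// mulr_ge0// enorm_ge0.
have [d d0 Hd] := taylor_unif (cinfty_Ck 1 cp) cK e'0.
set e' := e / (enorm h * m + 1) in e'0 Hd.
(* Enough steps for each to be shorter than the radius [d] of validity of the Taylor bound. *)
pose n := (Num.truncn (`|h| / d)).+1.
have n0 : 0 < n%:R :> R by rewrite ltr0n.
have nd : `|n%:R^-1 *: h| < d.
  rewrite normrZ ger0_norm ?invr_ge0 ?ler0n// mulrC ltr_pdivrMr// mulrC -ltr_pdivrMr//.
  exact: truncnS_gt.
pose I j := \int[mu]_(y in Q) phi (y + (j%:R / n%:R) *: h).
have step j : (j < n)%N -> `|I j.+1 - I j| <= enorm h / n%:R * (L + e' * m).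
  move=> jn; have jn01 : 0 <= (j%:R / n%:R : R) <= 1.
    rewrite divr_ge0 ?ler0n//= ler_pdivrMr// mul1r ler_nat; exact: ltnW.
  rewrite /I -RintegralB//; [|exact: ishift|exact: ishift].
  have iD : mu.-integrable Q (EFin \o (fun y =>
      phi (y + (j.+1%:R / n%:R) *: h) - phi (y + (j%:R / n%:R) *: h))).
    by apply: eq_integrable (integrableB mQ (@ishift _ _ cphi) (@ishift _ _ cphi)).
  apply: le_trans (le_normr_Rintegral mQ iD) _.
  have ig : mu.-integrable Q (EFin \o (fun y => enorm (grad phi (y + (j%:R / n%:R) *: h)))).
    exact: (@ishift (fun y => enorm (grad phi y)) _ (continuous_enorm_grad cp)).
  have ie : mu.-integrable Q (EFin \o (fun=> e')).
    by apply: (continuous_integrable_bounded mQ bQ); exact: cst_continuous.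
  have ige : mu.-integrable Q (EFin \o (fun y =>
      enorm (grad phi (y + (j%:R / n%:R) *: h)) + e')).
    by apply: eq_integrable (integrableD mQ ig ie).
  apply: (@le_trans _ _ (\int[mu]_(y in Q) (enorm h / n%:R *
      (enorm (grad phi (y + (j%:R / n%:R) *: h)) + e')))).
    apply: le_Rintegral => //.
    - exact: integrable_norm.
    - by apply: eq_integrable (integrableZl mQ _ ige).
    - move=> y Qy; set z := y + (j%:R / n%:R) *: h.
      have Kz : K z.
        apply/KE; apply: le_trans (ler_normD _ _) _; apply: lerD.
          by apply: HM Qy; have := ler_norm M; lra.
        have /andP[j0 j1] := jn01.
        by rewrite normrZ ger0_norm// ler_piMl.
      have := Hd z (n%:R^-1 *: h) Kz nd.
      have -> : z + n%:R^-1 *: h = y + (j.+1%:R / n%:R) *: h.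
        by rewrite /z -addrA -scalerDl -natr1 mulrDl mul1r.
      have := normr_dot_le (n%:R^-1 *: h) (grad phi z).
      have -> : enorm (n%:R^-1 *: h) = enorm h / n%:R.
        by rewrite enormZ ger0_norm ?invr_ge0// mulrC.
      set a := phi _ - phi z; set b := dot _ _ => hb hab.
      have := ler_normD (a - b) b; rewrite subrK mulrDr (mulrC _ e'); lra.
  rewrite RintegralZl// ler_wpM2l ?divr_ge0 ?enorm_ge0//.
  by rewrite RintegralD// Rintegral_cst// lerD2r HL.
have tele j : (j <= n)%N -> `|I j - I 0%N| <= j%:R * (enorm h / n%:R * (L + e' * m)).
  elim: j => [|j IH] jn; first by rewrite subrr normr0 mul0r.
  rewrite -(subrK (I j) (I j.+1)) -addrA; apply: le_trans (ler_normD _ _) _.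
  rewrite -natr1 mulrDl mul1r [leLHS]addrC; apply: lerD; [exact/IH/ltnW|exact: step].
have := tele n (leqnn n).
rewrite mulrA mulrCA mulfV ?gt_eqF// mulr1.
have -> : I n = \int[mu]_(y in Q) phi (y + h).
  by rewrite /I mulfV ?gt_eqF// scale1r.
have -> : I 0%N = \int[mu]_(y in Q) phi y.
  by rewrite /I mul0r scale0r; apply: eq_Rintegral => y _; rewrite addr0.
move=> /le_trans; apply; rewrite mulrDr lerD2l /e'.
have hm0 : 0 <= enorm h * m by rewrite mulr_ge0// enorm_ge0.
rewrite (_ : _ * _ = enorm h * m / (enorm h * m + 1) * e); last by ring.
by rewrite ler_piMl ?(ltW e0)// ler_pdivrMr ?mul1r ?lerDl// ltr_wpDl.
Qed.

End lipschitz.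

(** * Lipschitz estimates from averages *)

Section powR_facts.
Context {R : realType}.
Implicit Types (a b q t : R).

Lemma convex_combination_powR q t a b : 1 <= q -> 0 <= t <= 1 -> 0 <= a -> 0 <= b ->
  ((1 - t) * a + t * b) `^ q <= (1 - t) * a `^ q + t * b `^ q.
Proof.
move=> q1 /andP[t0 t1] a0 b0.
have := @convex_powR R q q1 (Itv01 t0 t1) b a.
rewrite !inE/= !in_itv/= !andbT => /(_ b0 a0).
rewrite convRE [X in X `^ _ <= _ -> _]convRE/= /unstable.onem => H.
by rewrite [in leLHS](addrC ((1 - t) * a)) [in leRHS](addrC ((1 - t) * _)).
Qed.

(** Plays the role of Hölder's inequality: after integration it bounds an $L^1$ norm by an $L^q$
    energy, with the level [l] still free. *)
Lemma le_add_powR q a (l : R) : 1 <= q -> 0 <= a -> 0 < l -> a <= l + l * (a / l) `^ q.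
Proof.
move=> q1 a0 l0; have [al|la] := leP a l.
  by apply: le_trans al _; rewrite lerDl mulr_ge0 ?powR_ge0// ltW.
have : a / l <= (a / l) `^ q by rewrite le1r_powR// ler_pdivlMr// mul1r ltW.
rewrite -(ler_pM2l l0) mulrCA mulfV ?gt_eqF// mulr1; lra.
Qed.

(** For [a] the gradient norm of an extremal, the two sides compare the energy of an approximation,
    which may exceed that norm by [e], with the least energy of a function whose maximum has dropped
    to [1 - e]. Both follow from continuity of the power at [a]. *)
Lemma powR_perturb q a (d : R) : 1 <= q -> 0 <= a -> 0 < d ->
  exists2 e : R, 0 < e < 1 & (a + e) `^ q <= (a * (1 - e)) `^ q + d.
Proof.
move=> q1 a0 d0; have q0 : 0 < q by apply: lt_le_trans q1.
move: a0; rewrite le_eqVlt => /predU1P[<-|a0].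
  pose e := Num.min d 2^-1.
  have e0 : 0 < e by rewrite lt_min d0 invr_gt0 ltr0n.
  have e1 : e < 1 by rewrite gt_min; apply/orP; right; lra.
  exists e; first by rewrite e0.
  rewrite mul0r add0r powR0 ?gt_eqF// add0r.
  apply: (@le_trans _ _ e); last by rewrite ge_min lexx.
  by rewrite ge1r_powR// e0 ltW.
have ca : {for a, continuous (fun x : R => x `^ q)}.
  apply: differentiable_continuous; apply/derivable1_diffP.
  have H : is_derive a 1 (fun x : R => x `^ q) (q * a `^ (q - 1)).
    exact: is_derive1_powR.
  by case: H.
have d2 : 0 < d / 2 by lra.
have /cvgrPdist_lt/(_ _ d2)/nbhs_ballP[r /= r0 Hr] := ca.
pose e := Num.min (r / (2 * (a + 1))) 2^-1.
have a1 : 0 < 2 * (a + 1) by lra.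
have e0 : 0 < e by rewrite lt_min divr_gt0//= invr_gt0 ltr0n.
have e1 : e < 1 by rewrite gt_min; apply/orP; right; lra.
have er : e * (2 * (a + 1)) <= r by rewrite -ler_pdivlMr// ge_min lexx.
exists e; first by rewrite e0.
have h1 : `|a `^ q - (a + e) `^ q| < d / 2.
  by apply: Hr; rewrite /ball/= ltr_norml; apply/andP; split; nra.
have h2 : `|a `^ q - (a * (1 - e)) `^ q| < d / 2.
  by apply: Hr; rewrite /ball/= ltr_norml; apply/andP; split; nra.
by move: h1 h2; rewrite !ltr_norml => /andP[? ?] /andP[? ?]; lra.
Qed.

End powR_facts.

Section averages.
Context {R : realType} {N : nat}.
Local Notation V := 'rV[R]_N.
Local Notation mu := (lebesgueN R N).
Implicit Types (f u phi : V -> R) (D Q S T Omega : set V) (h x y z : V).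

Lemma shift_set_measurable Q h : measurable Q -> measurable [set y : V | Q (y + h)].
Proof. by move=> mQ; rewrite -[X in measurable X]setTI; exact: measurable_shift. Qed.

Lemma lebesgueN_shift_set Q h : measurable Q -> mu [set y : V | Q (y + h)] = mu Q.
Proof. exact: lebesgueN_pushforward_shift. Qed.

(* Averages over Q pass to the limit in L^1, unlike pointwise values; the average of
   grad phi along the segment from Q to Q + h only involves translates of Q. *)
Lemma average_lipschitz Omega u S Q h (K : R) : open Omega -> bounded_set Omega ->
  measurable_fun Omega u -> measurable Q -> bounded_set Q ->
  Q `<=` Omega -> (forall y, Q y -> Omega (y + h)) ->
  (forall t y, 0 <= t <= 1 -> Q y -> S (y + t *: h)) ->
  (forall d : R, 0 < d -> exists phi, [/\ test_fun Omega phi,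
     (\int[mu]_(x in Omega) `|u x - phi x|%:E <= d%:E)%E &
     forall T, measurable T -> T `<=` S -> mu T = mu Q ->
       (\int[mu]_(x in T) (enorm (grad phi x))%:E <= (K + d)%:E)%E]) ->
  `|\int[mu]_(y in Q) u (y + h) - \int[mu]_(y in Q) u y| <= enorm h * K.
Proof.
move=> oO bO mu_ mQ bQ QO QhO QS H.
have mO := open_measurable_rV oO.
apply/ler_addgt0Pr => e e0.
(* Replacing [u] by [phi] costs [d] at each end of the translation, and the gradient bound costs
   [enorm h * d]. *)
pose d := e / (enorm h + 2).
have h2 : 0 < enorm h + 2 by rewrite ltr_wpDl// enorm_ge0.
have d0 : 0 < d by rewrite divr_gt0.
have [phi [tphi L1 HT]] := H d d0.
have [cphi _ _] := tphi.
have cp := cinfty_continuous cphi.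
have mD : measurable_fun Omega (fun x => u x - phi x).
  by apply: measurable_funB => //; exact: continuous_measurable_on.
have iD : mu.-integrable Omega (EFin \o (fun x => u x - phi x)).
  apply/integrableP; split; first exact/measurable_EFinP.
  by apply: le_lt_trans L1 _; rewrite ltry.
have ip : mu.-integrable Omega (EFin \o phi) by exact: continuous_integrable_bounded.
have bQk k : bounded_set [set y : V | Q (y + k)].
  have [M [_ HM]] := bQ; exists (`|M| + 1 + `|k|); split; first exact: num_real.
  move=> r Mr y /= Qy; have := HM (`|M| + 1) _ _ Qy.
  have -> : (M < `|M| + 1) by have := ler_norm M; lra.
  move=> /(_ isT) /= h'; rewrite -(addrK k y).
  by apply: le_trans (ler_normB _ _) _; lra.
have shiftI (f : V -> R) k : (forall y, Q y -> Omega (y + k)) ->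
    mu.-integrable Omega (EFin \o f) -> mu.-integrable Q (EFin \o (fun y => f (y + k))) /\
    (\int[mu]_(y in Q) `|f (y + k)%R|%:E <= \int[mu]_(y in Omega) `|f y|%:E)%E.
  move=> QkO if_.
  have mQk : measurable [set y : V | Q (y - k)] by exact: shift_set_measurable.
  have QkE : [set y : V | Q (y + k - k)] = Q.
    by apply/seteqP; split => y /=; rewrite addrK.
  have sub : [set y : V | Q (y - k)] `<=` Omega.
    by move=> y /= /QkO; rewrite subrK.
  have mf : measurable_fun Omega f by apply/measurable_EFinP; case/integrableP: if_.
  have E : (\int[mu]_(y in Q) `|f (y + k)%R|%:E = \int[mu]_(y in [set y : V | Q (y - k)%R]) `|f y|%:E)%E.
    rewrite [RHS](@ge0_integral_shift _ _ k)//= ?QkE//.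
    apply/measurable_EFinP; apply: measurableT_comp => //.
    exact: measurable_funS mf.
  have le : (\int[mu]_(y in Q) `|f (y + k)%R|%:E <= \int[mu]_(y in Omega) `|f y|%:E)%E.
    rewrite E; apply: ge0_subset_integral => //.
    by apply/measurable_EFinP; exact: measurableT_comp.
  split => //; apply/integrableP; split.
    apply/measurable_EFinP.
    have -> : (fun y => f (y + k)) = f \o (fun y : V => y + k) by [].
    apply: (@measurable_comp _ _ _ _ _ _ Omega) => //.
      by move=> _ [y Qy <-]; exact: QkO.
    by apply: measurable_funTS; exact: measurable_shift.
  by apply: le_lt_trans le _; case/integrableP: if_.
have Q0O y : Q y -> Omega (y + 0) by rewrite addr0; exact: QO.
have part k : (forall y, Q y -> Omega (y + k)) ->
    `|\int[mu]_(y in Q) u (y + k) - \int[mu]_(y in Q) phi (y + k)| <= d.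
  move=> QkO; have [i1 l1] := @shiftI _ k QkO iD; have [i2 _] := @shiftI _ k QkO ip.
  have i3 : mu.-integrable Q (EFin \o (fun y => u (y + k))).
    apply: eq_integrable (integrableD mQ i1 i2) => // y _ /=.
    by rewrite -EFinD subrK.
  rewrite -RintegralB//; apply: le_trans (le_normr_Rintegral mQ i1) _.
  rewrite -lee_fin; apply: le_trans L1; apply: le_trans l1.
  rewrite /Rintegral fineK//; apply: integrable_fin_num => //.
  exact: integrable_norm.
have main : `|\int[mu]_(y in Q) phi (y + h) - \int[mu]_(y in Q) phi y| <= enorm h * (K + d).
  apply: path_average_le => // t t01.
  rewrite -lee_fin /Rintegral fineK; last first.
    apply: integrable_fin_num => //; apply: continuous_integrable_bounded => //.
    move=> y; apply: (@continuous_comp _ _ _ (fun v : V => v + t *: h)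
      (fun z => enorm (grad phi z))); first exact: continuous_shift.
    exact: continuous_enorm_grad.
  have mQt : measurable [set y : V | Q (y - t *: h)] by exact: shift_set_measurable.
  have := HT _ mQt; rewrite lebesgueN_shift_set// => /(_ _ erefl).
  have sub : [set y : V | Q (y - t *: h)] `<=` S.
    by move=> y /= /(QS t _ t01); rewrite subrK.
  move=> /(_ sub); apply: le_trans.
  rewrite [leRHS](@ge0_integral_shift _ _ (t *: h))//=; last 2 first.
    apply/measurable_EFinP; apply: continuous_measurable_on; exact: continuous_enorm_grad.
    by move=> v _; rewrite lee_fin enorm_ge0.
  by rewrite (_ : [set y : V | Q (y + t *: h - t *: h)] = Q)//;
    apply/seteqP; split => y /=; rewrite addrK.
have p1 := part h QhO; have := part 0 Q0O.
under eq_Rintegral do rewrite addr0; under [X in _ - X]eq_Rintegral do rewrite addr0.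
move=> p2; have -> : enorm h * K + e = enorm h * (K + d) + d + d.
  rewrite /d; field; lra.
set a := \int[mu]_(y in Q) u (y + h) in p1 *; set b := \int[mu]_(y in Q) u y in p2 *.
set a' := \int[mu]_(y in Q) phi (y + h) in p1 main *.
set b' := \int[mu]_(y in Q) phi y in p2 main *.
move: p1 p2 main; rewrite !ler_norml => /andP[? ?] /andP[? ?] /andP[? ?].
by apply/andP; split; lra.
Qed.

End averages.

(** * Energy comparison for extremals *)

Section minimality.
Context {R : realType} {N : nat}.
Local Notation V := 'rV[R]_N.
Local Notation mu := (lebesgueN R N).
Implicit Types (f u v w phi : V -> R) (Omega : set V) (q : R).

Lemma test_fun_measurable Omega D phi : test_fun Omega phi -> measurable_fun D phi.
Proof. by move=> [c _ _]; apply: continuous_measurable_on; exact: cinfty_continuous. Qed.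

Lemma normgrad_test Omega q phi : open Omega -> 0 < q -> test_fun Omega phi ->
  normgrad Omega q%:E phi = normLp Omega q%:E (fun x => enorm (grad phi x)).
Proof.
move=> oO q0 [cphi _ _]; apply: normgradE => //.
exact: is_weak_grad_smooth.
Qed.

Lemma normLp_bounded_lty Omega q f (M : R) : measurable Omega -> (mu Omega < +oo)%E ->
  0 < q -> measurable_fun Omega f -> (forall x, Omega x -> `|f x| <= M) ->
  (normLp Omega q%:E f < +oo)%E.
Proof.
move=> mO Oy q0 mf fM; rewrite (normLp_powV f mO q0); apply: poweR_lty.
apply: (@le_lt_trans _ _ (\int[mu]_(x in Omega) (M `^ q)%:E)%E).
  apply: ge0_le_integral => //.
  - exact: measurable_abs_powR.
  - move=> x Ox; rewrite lee_fin ge0_ler_powR ?nnegrE ?(ltW q0)//; last exact: fM.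
    exact: le_trans (fM x Ox).
by rewrite integral_cst// lte_mul_pinfty// lee_fin powR_ge0.
Qed.

Lemma test_fun_W10 Omega q phi : open Omega -> bounded_set Omega -> 1 <= q ->
  test_fun Omega phi -> W10 q Omega phi.
Proof.
move=> oO bO q1 tphi; have [cphi _ _] := tphi.
have q0 : 0 < q by apply: lt_le_trans q1.
have mO := open_measurable_rV oO.
have Oy := bounded_lebesgueN_lty mO bO.
have wphi := is_weak_grad_smooth oO cphi.
have [M _ HM] := continuous_bounded_on bO (cinfty_continuous cphi).
have [M' _ HM'] := continuous_bounded_on bO (continuous_enorm_grad cphi).
split.
  split.
  - exact: test_fun_measurable tphi.
  - by exists (grad phi).
  - by apply: normLp_bounded_lty HM => //; exact: test_fun_measurable tphi.
  - rewrite normgrad_test//; apply: normLp_bounded_lty HM' => //.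
    exact: weak_grad_measurable wphi.
exists (fun=> phi); split => // .
have -> : (fun x => phi x - phi x) = (fun=> 0 : R).
  by apply/funext => x; rewrite subrr.
have -> : normW1 Omega q%:E (fun=> 0 : R) = 0%E; last exact: cvg_cst.
have z0 : normLp Omega q%:E (fun=> 0 : R) = 0%E.
  rewrite /normLp (_ : EFin \o _ = cst 0%E) ?Lnorm0//; first by rewrite eqe gt_eqF.
  by apply/funext => x; rewrite /= patchE; case: ifP.
rewrite /normW1 z0 add0e normgrad_test//; last exact: test_fun0.
rewrite -[RHS]z0; congr normLp; apply/funext => x.
rewrite (_ : grad _ x = 0) ?enorm0//; apply/rowP => i.
by rewrite !mxE; apply: partialE; exact: is_derive_cst.
Qed.

Lemma normLpooZ Omega (c : R) f : 0 < c ->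
  normLp Omega +oo (fun x => c * f x) = (c%:E * normLp Omega +oo f)%E.
Proof.
move=> c0; rewrite /normLp unlock /Lnorm lebesgueN_setT_gt0 -ess_sup_pZl//.
congr ess_sup; apply/funext => x /=; rewrite !patchE; case: ifP => _.
  by rewrite normrM gtr0_norm// EFinM.
by rewrite normr0 mule0.
Qed.

Lemma gradZ (c : R) f x : cinfty f -> grad (fun y => c * f y) x = c *: grad f x.
Proof.
move=> cf; apply/rowP => i; rewrite !mxE; apply: partialE.
have := is_deriveZ c (cinfty_is_derive i x cf).
exact.
Qed.

(** Minimality in homogeneous form: [Lambda] only sees functions of norm 1, so the competitor is
    divided by [m]. *)
Lemma Lambda_le Omega q w (m : R) : open Omega -> bounded_set Omega -> 1 <= q ->
  test_fun Omega w -> 0 < m -> normLp Omega +oo w = m%:E ->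
  (Lambda q Omega * (m `^ q)%:E <= \int[mu]_(x in Omega) (enorm (grad w x) `^ q)%:E)%E.
Proof.
move=> oO bO q1 tw m0 wm; have q0 : 0 < q by apply: lt_le_trans q1.
have mO := open_measurable_rV oO.
have [cw _ _] := tw.
pose psi x := m^-1 * w x.
have tpsi : test_fun Omega psi.
  have [K [cK KO wK]] := test_fun_supp tw; apply: test_fun_intro cK KO _.
    by apply/cinftyP => n; apply: Ck_Z; exact: cinfty_Ck.
  by move=> x h; apply: wK; apply: contra_neq h; rewrite /psi => ->; rewrite mulr0.
have mi : 0 < m^-1 by rewrite invr_gt0.
have L : (Lambda q Omega <= normgrad Omega q%:E psi `^ q)%E.
  apply: ereal_inf_lbound; exists psi => //; split; first exact: test_fun_W10.
  by rewrite normLpooZ// wm -EFinM mulVf// gt_eqF.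
have mg : measurable_fun Omega (fun x => (enorm (grad w x) `^ q)%:E).
  have := is_weak_grad_smooth oO cw => /weak_grad_measurable /(measurable_abs_powR q).
  by under eq_fun do rewrite ger0_norm ?enorm_ge0//.
have E : (normgrad Omega q%:E psi `^ q =
    (m^-1 `^ q)%:E * \int[mu]_(x in Omega) (enorm (grad w x) `^ q)%:E)%E.
  rewrite normgrad_test// poweR_normLp// -ge0_integralZl//.
  - apply: eq_integral => x _; rewrite gradZ// enormZ ger0_norm ?mulr_ge0 ?enorm_ge0//.
    by rewrite powRM ?enorm_ge0// gtr0_norm.
  - by move=> x _; rewrite lee_fin powR_ge0.
  - by rewrite lee_fin powR_ge0.
move: L; rewrite E => L; rewrite muleC.
apply: le_trans (lee_wpmul2l _ L) _; first by rewrite lee_fin powR_ge0.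
by rewrite muleA -EFinM -powRM ?(ltW m0) ?(ltW mi)// mulfV ?gt_eqF// powR1 mul1e.
Qed.

End minimality.

(** * Smooth truncation and its energy *)

Section energy.
Context {R : realType} {N : nat}.
Local Notation V := 'rV[R]_N.
Local Notation mu := (lebesgueN R N).
Implicit Types (f u v w phi : V -> R) (Omega D T : set V) (q : R).

Lemma chebyshev_powR Omega q f (s e : R) : measurable Omega -> 0 < q -> 0 < s ->
  measurable_fun Omega f ->
  (\int[mu]_(x in Omega) (`|f x| `^ q)%:E <= (e `^ q)%:E)%E ->
  (mu (Omega `&` [set x | s <= `|f x|]%R) <= ((e `^ q) / (s `^ q))%:E)%E.
Proof.
move=> mO q0 s0 mf H; set A := _ `&` _.
have mA : measurable A.
  by apply: measurable_fun_le => //; exact: measurableT_comp.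
have sq0 : 0 < s `^ q by exact: powR_gt0.
rewrite EFinM lee_pdivlMr//; apply: le_trans H.
rewrite muleC -(integral_cst mu mA).
apply: (@le_trans _ _ (\int[mu]_(x in A) (`|f x| `^ q)%:E)%E).
  apply: ge0_le_integral => //.
  - by move=> x _; rewrite lee_fin ltW.
  - by apply: measurable_abs_powR; apply: measurable_funS mf => // x [].
  - by move=> x [Ox /= sx]; rewrite lee_fin ge0_ler_powR ?nnegrE ?(ltW s0) ?(ltW q0)//.
apply: ge0_subset_integral => //; last by move=> x [].
exact: measurable_abs_powR.
Qed.

Lemma grad_expinv_sub phi v x : cinfty phi -> cinfty v ->
  grad (fun y => phi y - expinv 0 (phi y - v y)) x =
  (1 - expinv 2 (phi x - v x)) *: grad phi x + expinv 2 (phi x - v x) *: grad v x.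
Proof.
move=> cphi cv; apply/rowP => i; rewrite !mxE; apply: partialE.
have d1 := cinfty_is_derive i x cphi.
have d2 : is_derive x (delta_mx 0 i : V) (fun y => phi y - v y)
    (partial i phi x - partial i v x).
  exact: is_deriveB d1 (cinfty_is_derive i x cv).
have d3 := is_derive_expinv_comp 0 d2; rewrite mul0r subr0 in d3.
apply: is_derive_eq (is_deriveB d1 d3) _.
by rewrite mulrBr mulrBl mul1r opprB; ring.
Qed.

(* expinv 0 is a smooth nondecreasing function of slope expinv 2 in [0, 1], so that the
   competitor has gradient (1 - t) grad phi + t grad v, and convexity of |.|^q applies.
   The competitor differs from phi only where phi > v. *)
Lemma energy_expinv_sub phi v q x : 1 <= q -> cinfty phi -> cinfty v ->
  enorm (grad (fun y => phi y - expinv 0 (phi y - v y)) x) `^ q +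
    expinv 2 (phi x - v x) * enorm (grad phi x) `^ q <=
  enorm (grad phi x) `^ q + expinv 2 (phi x - v x) * enorm (grad v x) `^ q.
Proof.
move=> q1 cphi cv; rewrite (grad_expinv_sub x cphi cv); set t := expinv 2 _.
have t0 : 0 <= t by exact: expinv_ge0.
have t1 : t <= 1 by exact: expinv2_le1.
have q0 : 0 <= q by apply: le_trans q1.
have h1 : enorm ((1 - t) *: grad phi x + t *: grad v x) `^ q <=
    ((1 - t) * enorm (grad phi x) + t * enorm (grad v x)) `^ q.
  rewrite ge0_ler_powR// ?nnegrE ?enorm_ge0 ?addr_ge0 ?mulr_ge0 ?enorm_ge0 ?subr_ge0//.
  apply: le_trans (enormD _ _) _; rewrite !enormZ !ger0_norm//.
  by rewrite subr_ge0.
rewrite -lerBrDr; apply: le_trans h1 _.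
apply: le_trans (convex_combination_powR q1 _ (enorm_ge0 _) (enorm_ge0 _)) _.
  by rewrite t0 t1.
move: (_ `^ q) (_ `^ q) => a b; lra.
Qed.

Lemma test_fun_expinv_sub Omega phi v : test_fun Omega phi -> cinfty v ->
  (forall y, 0 <= v y) -> test_fun Omega (fun y => phi y - expinv 0 (phi y - v y)).
Proof.
move=> tphi cv v0; have [K [cK KO phiK]] := test_fun_supp tphi; have [cphi _ _] := tphi.
apply: test_fun_intro cK KO _.
  apply: (cinfty_sub cphi); apply/cinftyP => n; apply: Ck_expinv.
  exact: cinfty_Ck (cinfty_sub cphi cv).
move=> x; apply: contra_neqP => Kx.
have -> : phi x = 0 by apply/eqP; apply: contrapT => /negP /phiK.
by rewrite expinv_le0 ?subr0// sub0r oppr_le0.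
Qed.

(** $l\cdot l^{-q}=l^{1-q}$ equals $1/Y$ for $l=Y^{1/(q-1)}$, and $Y=X/d+1$ is large enough. Such a
    high level makes a possibly huge total energy harmless on a small exceptional set. *)
Lemma powR_small q (X d : R) : 1 < q -> 0 <= X -> 0 < d ->
  exists2 l : R, 0 < l & l * l^-1 `^ q * X <= d.
Proof.
move=> q1 X0 d0; pose Y := X / d + 1.
have Y0 : 0 < Y by rewrite ltr_wpDl// divr_ge0// ltW.
pose l := Y `^ (q - 1)^-1.
have l0 : 0 < l by exact: powR_gt0.
have li : 0 < l^-1 by rewrite invr_gt0.
exists l => //.
have -> : l * l^-1 `^ q = Y^-1.
  rewrite -mulr_powRB1 ?(ltW li)//; last by apply: lt_trans q1.
  rewrite mulrA mulfV ?gt_eqF// mul1r /l -powRN.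
  by rewrite -powRrM mulNr mulVf ?gt_eqF ?subr_gt0// powR_inv1// ltW.
rewrite mulrC ler_pdivrMr// /Y mulrDr mulrCA mulfV ?gt_eqF// mulr1 mulr1.
by rewrite lerDl ltW.
Qed.

(** An upper bound on [t] is required because [expinv 2] decays at infinity; this is why the excess
    of an extremal over the barrier is bounded by a constant [M] below. *)
Lemma expinv2_lower (a b : R) : 0 < a ->
  exists2 t0 : R, 0 < t0 & forall t, a <= t <= b -> t0 <= expinv 2 t.
Proof.
move=> a0; have [ab|ba] := leP a b; last first.
  by exists 1 => // t /andP[h1 h2]; lra.
have cE : {within `[a, b], continuous (expinv 2)}.
  by apply: continuous_subspaceT; exact: continuous_expinv.
have [c /[!in_itv]/= /andP[ac cb] Hc] := EVT_min ab cE.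
exists (expinv 2 c); first by apply: expinv_gt0; apply: lt_le_trans ac.
by move=> t tab; apply: Hc; rewrite in_itv.
Qed.

Lemma continuous_within_open D f x : open D -> D x ->
  {within closure D, continuous f} -> {for x, continuous f}.
Proof.
move=> oD Dx cf.
have cD : {within D, continuous f}.
  by apply: continuous_subspaceW cf; exact: subset_closure.
by rewrite continuous_open_subspace// in cD; apply: cD; exact: mem_set.
Qed.

End energy.

Section energy_estimate.
Context {R : realType} {N : nat}.
Local Notation V := 'rV[R]_N.
Local Notation mu := (lebesgueN R N).
Implicit Types (f u v w phi : V -> R) (Omega D T : set V) (q : R).

Lemma scaled_powR q (a l : R) : 1 <= q -> 0 <= a -> 0 < l ->
  a <= l + l * l^-1 `^ q * a `^ q.
Proof.
move=> q1 a0 l0; apply: le_trans (le_add_powR q1 a0 l0) _.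
by rewrite powRM// ?invr_ge0 ?(ltW l0)// (mulrC (a `^ q)) mulrA.
Qed.

Lemma L1_le_Lq Omega q f (e : R) : measurable Omega -> (mu Omega < +oo)%E ->
  1 <= q -> 0 < e -> measurable_fun Omega f ->
  (\int[mu]_(x in Omega) (`|f x| `^ q)%:E <= (e `^ q)%:E)%E ->
  (\int[mu]_(x in Omega) `|f x|%:E <= (e * (fine (mu Omega) + 1))%:E)%E.
Proof.
move=> mO Oy q1 e0 mf H.
have q0 : 0 < q by apply: lt_le_trans q1.
have ei0 : 0 < e^-1 by rewrite invr_gt0.
have k0 : 0 <= e * e^-1 `^ q by rewrite mulr_ge0 ?powR_ge0// ltW.
have mfq := measurable_abs_powR q mf.
apply: (@le_trans _ _ (\int[mu]_(x in Omega) (e%:E + (e * e^-1 `^ q)%:E * (`|f x| `^ q)%:E))%E).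
  apply: ge0_le_integral => //.
  - by apply/measurable_EFinP; exact: measurableT_comp.
  - apply: emeasurable_funD; first exact: measurable_cst.
    by apply: emeasurable_funM => //; exact: measurable_cst.
  - by move=> x _; rewrite -EFinM -EFinD lee_fin; exact: scaled_powR.
rewrite ge0_integralD//; last 3 first.
- by move=> x _; rewrite lee_fin ltW.
- by move=> x _; rewrite -EFinM lee_fin mulr_ge0// powR_ge0.
- by apply: emeasurable_funM => //; exact: measurable_cst.
rewrite (integral_cst mu mO) ge0_integralZl//.
rewrite mulrDr mulr1 EFinD [in leRHS]EFinM fineK ?ge0_fin_numE//.
apply: leeD => //; apply: (le_trans (lee_wpmul2l _ H)); first by rewrite lee_fin.
rewrite -EFinM lee_fin -mulrA -powRM ?(ltW e0) ?(ltW ei0)//.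
by rewrite mulVf ?gt_eqF// powR1 mulr1.
Qed.

Lemma normLp_powR_le Omega q f (e : R) : measurable Omega -> 0 < q -> 0 <= e ->
  (normLp Omega q%:E f <= e%:E)%E ->
  (\int[mu]_(x in Omega) (`|f x| `^ q)%:E <= (e `^ q)%:E)%E.
Proof.
move=> mO q0 e0 H; rewrite -(poweR_normLp f mO q0) -poweR_EFin.
apply: (gt0_ler_poweR (ltW q0)) H.
- by rewrite in_itv /= normLp_ge0 leey.
- by rewrite in_itv /= lee_fin e0 leey.
Qed.

(** Closeness in $L^q$ gives no pointwise control, but the set where [phi] is far from [u] is
    smaller than [W]. On the rest of [W] one has [phi < v], so [w = phi] and [w > 1 - e]. *)
Lemma essup_lower Omega u v phi w W (e s : R) : open W -> W `<=` Omega ->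
  (forall y, W y -> 1 - e / 2 < u y /\ u y + s <= v y) ->
  (forall y, phi y <= v y -> w y = phi y) -> e < 1 -> s <= e / 2 ->
  (mu (Omega `&` [set x | s <= `|u x - phi x|]%R) < mu W)%E ->
  measurable_fun Omega u -> measurable_fun Omega phi -> measurable Omega ->
  ((1 - e)%:E <= normLp Omega +oo w)%E.
Proof.
move=> oW WO HW Hw e1 se mA mu_ mphi mO; rewrite leNgt; apply/negP => lt.
have [X [mX X0 HX]] := le_normLpoo Omega w.
move: mA; rewrite ltNge => /negP; apply.
set A := Omega `&` _.
have mA : measurable A.
  apply: measurable_fun_le => //.
  by apply: measurableT_comp => //; exact: measurable_funB.
apply: (@le_trans _ _ (mu (A `|` X))).
  apply: le_measure; rewrite ?inE//; [exact: open_measurable_rV|exact: measurableU|].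
  move=> y Wy; have Oy := WO y Wy; have [u1 uv] := HW y Wy.
  have [sy|ys] := leP s `|u y - phi y|; [by left|right].
  apply: HX => /(_ Oy) h.
  move: ys; rewrite ltr_norml => /andP[h1 h2].
  have := le_lt_trans h lt; rewrite lte_fin Hw ?ltr_norml; last by lra.
  by case/andP => _; lra.
apply: le_trans (measureU2 _ mA mX) _.
by rewrite [X in (_ + X)%E]X0 adde0.
Qed.

End energy_estimate.

Section energy_bound.
Context {R : realType} {N : nat}.
Local Notation V := 'rV[R]_N.
Local Notation mu := (lebesgueN R N).
Implicit Types (f u v w phi : V -> R) (Omega A T : set V) (q : R).

(* By minimality of Lambda the competitor cannot save energy beyond E1 - L m^q, so
   the gradient of phi is controlled by that of v where phi > v. *)
Lemma theta_energy_bound Omega q phi v A (L m E1 c k : R) : open Omega ->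
  bounded_set Omega -> 1 <= q -> test_fun Omega phi -> cinfty v -> (forall y, 0 <= v y) ->
  Lambda q Omega = L%:E -> 0 < m ->
  (m%:E <= normLp Omega +oo (fun y => phi y - expinv 0 (phi y - v y))%R)%E ->
  (\int[mu]_(x in Omega) (enorm (grad phi x) `^ q)%:E <= E1%:E)%E ->
  measurable A -> 0 <= c -> 0 <= k ->
  (forall x, Omega x -> expinv 2 (phi x - v x) * enorm (grad v x) `^ q <= c + k * \1_A x) ->
  (\int[mu]_(x in Omega) (expinv 2 (phi x - v x) * enorm (grad phi x) `^ q)%:E <=
   (E1 - L * m `^ q)%:E + c%:E * mu Omega + k%:E * mu A)%E.
Proof.
move=> oO bO q1 tphi cv v0 LL m0 mw IE1 mA c0 k0 Hv.
have [cphi _ _] := tphi.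
have q0 : 0 < q by apply: lt_le_trans q1.
have mO := open_measurable_rV oO.
have Oy := bounded_lebesgueN_lty mO bO.
set w := fun y => _ in mw.
have tw : test_fun Omega w := test_fun_expinv_sub tphi cv v0.
have [cw _ _] := tw.
have En x : enorm (grad w x) `^ q + expinv 2 (phi x - v x) * enorm (grad phi x) `^ q <=
    enorm (grad phi x) `^ q + expinv 2 (phi x - v x) * enorm (grad v x) `^ q.
  exact: energy_expinv_sub.
clearbody w.
have [Mw Mw0 HMw] := continuous_bounded_on bO (cinfty_continuous cw).
have wlty : (normLp Omega +oo w < +oo)%E.
  apply: (@le_lt_trans _ _ Mw%:E); last by rewrite ltry.
  by apply: normLpoo_le; [exact: ltW|apply: aeW].
have wfin : normLp Omega +oo w \is a fin_num by rewrite ge0_fin_numE// normLp_ge0.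
set M := fine (normLp Omega +oo w).
have wM : normLp Omega +oo w = M%:E by rewrite fineK.
have mM : m <= M by rewrite -lee_fin -wM.
have M0 : 0 < M by apply: lt_le_trans mM.
have L0 : 0 <= L.
  rewrite -lee_fin -LL; apply: le_ereal_inf_tmp => _ [z _ <-]; exact: poweR_ge0.
have Lw := Lambda_le oO bO q1 tw M0 wM; rewrite LL -EFinM in Lw.
have mpow (f : V -> R) : continuous f -> measurable_fun Omega (fun x => f x `^ q).
  move=> cf; apply: (@measurableT_comp _ _ _ _ _ _ (@powR R ^~ q)) => //.
  exact: continuous_measurable_on.
have ct : continuous (fun x : V => expinv 2 (phi x - v x)).
  by apply: (@Ck_continuous _ _ 0%N); apply: Ck_expinv; exact: cinfty_Ck (cinfty_sub cphi cv).
pose W x := enorm (grad w x) `^ q; pose PA x := enorm (grad phi x) `^ q.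
pose TA x := expinv 2 (phi x - v x) * enorm (grad phi x) `^ q.
pose TB x := expinv 2 (phi x - v x) * enorm (grad v x) `^ q.
have mw_ : measurable_fun Omega W by exact: mpow (continuous_enorm_grad cw).
have ma : measurable_fun Omega PA by exact: mpow (continuous_enorm_grad cphi).
have mb := mpow _ (continuous_enorm_grad cv).
have mt : measurable_fun Omega (fun x : V => expinv 2 (phi x - v x)).
  exact: continuous_measurable_on.
have mta : measurable_fun Omega TA := measurable_funM mt ma.
have mtb : measurable_fun Omega TB := measurable_funM mt mb.
have t0 x : 0 <= expinv 2 (phi x - v x) by exact: expinv_ge0.
have w0 x : 0 <= W x by exact: powR_ge0.
have a0 x : 0 <= PA x by exact: powR_ge0.
have ta0 x : 0 <= TA x by rewrite mulr_ge0 ?powR_ge0.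
have tb0 x : 0 <= TB x by rewrite mulr_ge0 ?powR_ge0.
pose Iw := (\int[mu]_(x in Omega) (W x)%:E)%E.
pose Ia := (\int[mu]_(x in Omega) (PA x)%:E)%E.
pose Ita := (\int[mu]_(x in Omega) (TA x)%:E)%E.
pose Itb := (\int[mu]_(x in Omega) (TB x)%:E)%E.
have addI (f g : V -> R) : measurable_fun Omega f -> measurable_fun Omega g ->
    (forall x, 0 <= f x) -> (forall x, 0 <= g x) ->
    (\int[mu]_(x in Omega) (f x)%:E + \int[mu]_(x in Omega) (g x)%:E =
     \int[mu]_(x in Omega) (f x + g x)%:E)%E.
  move=> mf mg f0 g0; rewrite -(@ge0_integralD _ V R mu Omega mO (EFin \o f) (EFin \o g))//.
  - by move=> x _; rewrite lee_fin.
  - exact/measurable_EFinP.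
  - by move=> x _; rewrite lee_fin.
  - exact/measurable_EFinP.
(* The inequality is kept additive so that no finiteness of these integrals has to be checked. *)
have sum_le : (Iw + Ita <= Ia + Itb)%E.
  have S1 : (Iw + Ita = \int[mu]_(x in Omega) (W x + TA x)%:E)%E by exact: addI.
  have S2 : (Ia + Itb = \int[mu]_(x in Omega) (PA x + TB x)%:E)%E by exact: addI.
  have S12 : (\int[mu]_(x in Omega) (W x + TA x)%:E <=
      \int[mu]_(x in Omega) (PA x + TB x)%:E)%E; last first.
    by move: S1 S2 S12; move: (Iw) (Ita) (Ia) (Itb) => ? ? ? ? -> ->.
  apply: ge0_le_integral; first exact: mO.
  - by move=> x _; rewrite lee_fin; exact: addr_ge0 (w0 x) (ta0 x).
  - by apply/measurable_EFinP; exact: measurable_funD mw_ mta.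
  - by apply/measurable_EFinP; exact: measurable_funD ma mtb.
  - by move=> x _; rewrite lee_fin; exact: En.
have Itb_le : (Itb <= c%:E * mu Omega + k%:E * mu A)%E.
  apply: (@le_trans _ _ (\int[mu]_(x in Omega) (c%:E + k%:E * (\1_A x)%:E))%E).
    apply: ge0_le_integral; first exact: mO.
    - by move=> x _; rewrite lee_fin; exact: tb0.
    - exact/measurable_EFinP.
    - apply: emeasurable_funD; first exact: measurable_cst.
      apply: emeasurable_funM; first exact: measurable_cst.
      by apply/measurable_EFinP; exact: measurable_indic.
    - by move=> x Ox; rewrite -EFinM -EFinD lee_fin; exact: Hv.
  have mi : measurable_fun Omega (fun x => (\1_A x : R)%:E).
    by apply/measurable_EFinP; exact: measurable_indic.
  rewrite ge0_integralD//; [|by move=> x _; rewrite -EFinM lee_fin mulr_ge0|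
    by apply: emeasurable_funM => //; exact: measurable_cst].
  rewrite (integral_cst mu mO) ge0_integralZl//.
  rewrite integral_indic// leeD2lE//; last by rewrite fin_numM// ge0_fin_numE.
  apply: lee_wpmul2l => //; apply: le_measure; rewrite ?inE//.
  exact: measurableI.
have Lm : ((L * m `^ q)%:E <= Iw)%E.
  apply: le_trans Lw; rewrite lee_fin ler_wpM2l// ge0_ler_powR ?(ltW q0)// nnegrE ltW//.
have : ((L * m `^ q)%:E + Ita <= E1%:E + (c%:E * mu Omega + k%:E * mu A))%E.
  apply: (le_trans (leeD Lm (lexx _))); apply: (le_trans sum_le).
  exact: leeD.
rewrite addeC -leeBrDr// => /le_trans; apply.
by rewrite EFinB -!addeA [X in (_ <= _ + X)%E]addeC -!addeA.
Qed.

End energy_bound.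

Section energy_estimate.
Context {R : realType} {N : nat}.
Local Notation V := 'rV[R]_N.
Local Notation mu := (lebesgueN R N).
Implicit Types (f u v w phi : V -> R) (Omega A T B S : set V) (q : R).

(** Off the exceptional set [A] the weight is at least [t0], so the weighted energy controls the
    gradient at level [c]. On [A] only the total energy is available, and it is used at the
    independent level [l]. *)
Lemma theta_gradient_bound Omega T A q phi v (t0 c l : R) : measurable Omega ->
  measurable T -> T `<=` Omega -> measurable A -> 1 <= q -> cinfty phi -> cinfty v ->
  0 < t0 -> 0 < c -> 0 < l ->
  (forall x, T x -> ~ A x -> t0 <= expinv 2 (phi x - v x)) ->
  (\int[mu]_(x in T) (enorm (grad phi x))%:E <=
    c%:E * mu T + (c * c^-1 `^ q / t0)%:E *
      \int[mu]_(x in Omega) (expinv 2 (phi x - v x) * enorm (grad phi x) `^ q)%:E +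
    (l%:E * mu A + (l * l^-1 `^ q)%:E *
      \int[mu]_(x in Omega) (enorm (grad phi x) `^ q)%:E))%E.
Proof.
move=> mO mT TO mA q1 cphi cv t00 c0 l0 Ht.
have q0 : 0 < q by apply: lt_le_trans q1.
set k1 := c * c^-1 `^ q / t0; set k2 := l * l^-1 `^ q.
have k10 : 0 <= k1.
  by rewrite divr_ge0 ?(ltW t00)// mulr_ge0 ?powR_ge0// ltW.
have k20 : 0 <= k2 by rewrite mulr_ge0 ?powR_ge0// ltW.
pose a x := enorm (grad phi x).
pose pa x := a x `^ q.
pose ta x := expinv 2 (phi x - v x) * pa x.
have pa0 x : 0 <= pa x by exact: powR_ge0.
have th0 x : 0 <= expinv 2 (phi x - v x) by exact: expinv_ge0.
have ta0 x : 0 <= ta x by exact: mulr_ge0.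
have ma D : measurable_fun D a.
  by apply: continuous_measurable_on; exact: continuous_enorm_grad.
have mpa D : measurable_fun D pa.
  by apply: (@measurableT_comp _ _ _ _ _ _ (@powR R ^~ q)) => //; exact: ma.
have mta D : measurable_fun D ta.
  apply: measurable_funM; last exact: mpa.
  apply: continuous_measurable_on.
  by apply: (@Ck_continuous _ _ 0%N); apply: Ck_expinv; exact: cinfty_Ck (cinfty_sub cphi cv).
pose g1 x := c + k1 * ta x.
pose g2 x := l * \1_A x + k2 * pa x.
have mi D : measurable_fun D (\1_A : V -> R) by exact: measurable_indic.
have g10 x : 0 <= g1 x by rewrite addr_ge0 ?(ltW c0)// mulr_ge0.
have g20 x : 0 <= g2 x by rewrite addr_ge0// mulr_ge0// ltW.
have mg1 : measurable_fun T g1.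
  by apply: measurable_funD; [exact: measurable_cst|apply: measurable_funM; [exact: measurable_cst|exact: mta]].
have mg2 : measurable_fun T g2.
  by apply: measurable_funD; apply: measurable_funM;
    [exact: measurable_cst|exact: mi|exact: measurable_cst|exact: mpa].
have ag x : T x -> a x <= g1 x + g2 x.
  move=> Tx; have [Ax|Ax] := pselect (A x).
    apply: (@le_trans _ _ (g2 x)); last by rewrite lerDr.
    rewrite /g2 indicE mem_set// mulr1.
    exact: scaled_powR (enorm_ge0 _) l0.
  apply: (@le_trans _ _ (g1 x)); last by rewrite lerDl.
  apply: le_trans (scaled_powR q1 (enorm_ge0 _) c0) _.
  rewrite lerD2l /k1 /ta -[X in _ <= X]mulrA; apply: ler_wpM2l.
    by rewrite mulr_ge0 ?powR_ge0// ltW.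
  rewrite mulrA; apply: ler_peMl; first exact: powR_ge0.
  by rewrite mulrC ler_pdivlMr// mul1r; exact: Ht.
have addI D (f g : V -> R) : measurable D -> measurable_fun D f -> measurable_fun D g ->
    (forall x, 0 <= f x) -> (forall x, 0 <= g x) ->
    (\int[mu]_(x in D) (f x + g x)%:E =
     \int[mu]_(x in D) (f x)%:E + \int[mu]_(x in D) (g x)%:E)%E.
  move=> mD mf mg f0 g0; rewrite -(@ge0_integralD _ V R mu D mD (EFin \o f) (EFin \o g))//.
  - by move=> x _; rewrite lee_fin.
  - exact/measurable_EFinP.
  - by move=> x _; rewrite lee_fin.
  - exact/measurable_EFinP.
have scaleI D (k : R) (f : V -> R) : measurable D -> measurable_fun D f -> 0 <= k ->
    (forall x, 0 <= f x) ->
    (\int[mu]_(x in D) (k * f x)%:E = k%:E * \int[mu]_(x in D) (f x)%:E)%E.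
  move=> mD mf kk f0.
  rewrite -(@ge0_integralZl_EFin _ V R mu D mD (EFin \o f))//.
  - by move=> x _; rewrite lee_fin.
  - exact/measurable_EFinP.
have subI (f : V -> R) : measurable_fun Omega f -> (forall x, 0 <= f x) ->
    (\int[mu]_(x in T) (f x)%:E <= \int[mu]_(x in Omega) (f x)%:E)%E.
  move=> mf f0; apply: ge0_subset_integral => //.
    exact/measurable_EFinP.
  by move=> x _; rewrite lee_fin.
have S0 : (\int[mu]_(x in T) (a x)%:E <= \int[mu]_(x in T) (g1 x + g2 x)%:E)%E.
  apply: ge0_le_integral; first exact: mT.
  - by move=> x _; rewrite lee_fin; exact: enorm_ge0.
  - by apply/measurable_EFinP; exact: ma.
  - by apply/measurable_EFinP; exact: measurable_funD mg1 mg2.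
  - by move=> x Tx; rewrite lee_fin; exact: ag.
have S1 : (\int[mu]_(x in T) (g1 x)%:E <=
    c%:E * mu T + k1%:E * \int[mu]_(x in Omega) (ta x)%:E)%E.
  have -> : (\int[mu]_(x in T) (g1 x)%:E =
      \int[mu]_(x in T) c%:E + \int[mu]_(x in T) (k1 * ta x)%:E)%E.
    apply: (addI T (fun=> c) (fun x => k1 * ta x) mT).
    - exact: measurable_cst.
    - by apply: measurable_funM; [exact: measurable_cst|exact: mta].
    - by move=> _; exact: ltW.
    - by move=> x; rewrite mulr_ge0.
  rewrite (integral_cst mu mT); apply: leeD => //.
  rewrite (scaleI T k1 ta mT (mta T) k10 ta0); apply: lee_wpmul2l; first by rewrite lee_fin.
  exact: subI (mta _) ta0.
have S2 : (\int[mu]_(x in T) (g2 x)%:E <=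
    l%:E * mu A + k2%:E * \int[mu]_(x in Omega) (pa x)%:E)%E.
  have -> : (\int[mu]_(x in T) (g2 x)%:E =
      \int[mu]_(x in T) (l * \1_A x)%:E + \int[mu]_(x in T) (k2 * pa x)%:E)%E.
    apply: (addI T (fun x => l * \1_A x) (fun x => k2 * pa x) mT).
    - by apply: measurable_funM; [exact: measurable_cst|exact: mi].
    - by apply: measurable_funM; [exact: measurable_cst|exact: mpa].
    - by move=> x; rewrite mulr_ge0// ltW.
    - by move=> x; rewrite mulr_ge0.
  apply: leeD.
    rewrite (scaleI T l (\1_A) mT (mi T) (ltW l0))//.
    apply: lee_wpmul2l; first by rewrite lee_fin ltW.
    by rewrite integral_indic//; apply: le_measure; rewrite ?inE//; exact: measurableI.
  rewrite (scaleI T k2 pa mT (mpa T) k20 pa0); apply: lee_wpmul2l; first by rewrite lee_fin.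
  exact: subI (mpa _) pa0.
apply: (le_trans S0); rewrite (addI T g1 g2 mT mg1 mg2 g10 g20).
exact: leeD S1 S2.
Qed.

End energy_estimate.

(** * The gradient of an extremal above a barrier *)

Section extremal.
Context {R : realType} {N : nat}.
Local Notation V := 'rV[R]_N.
Local Notation mu := (lebesgueN R N).
Implicit Types (f u v w phi : V -> R) (Omega A T B S : set V) (q : R).

(** Bounds the essential supremum, which is 1, by the pointwise maximum; hence the extremal is close
    to 1 on an open set around its maximum point. *)
Lemma extremal_max_ge1 Omega q u x : positive_extremal q Omega u -> Omega x ->
  (forall y, Omega y -> u y <= u x) -> 1 <= u x.
Proof.
move=> [_ _ u0 un _] Ox ux; rewrite -lee_fin -un; apply: normLpoo_le.
  exact/ltW/u0.
by apply: aeW => y Oy; rewrite gtr0_norm ?u0// ux.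
Qed.

(** [B] is where the barrier may lie below [u], and its slope there is at most [c]. The maximum
    point lies off [B], so truncation leaves the peak alone; on [S] the excess of [u] over [v] stays
    in a fixed interval, so the weight is bounded below by [t0]. Comparison with [Lambda] then makes
    the weighted energy of order [c ^ q]. *)
Lemma extremal_gradient_bound Omega q u v xq B S (c c' eta M t0 : R) :
  open Omega -> bounded_set Omega -> 1 < q -> positive_extremal q Omega u ->
  Omega xq -> (forall y, Omega y -> u y <= u xq) ->
  cinfty v -> (forall y, 0 <= v y) -> 0 < c -> 0 < c' -> 0 < eta ->
  (forall y, Omega y -> ~ B y -> u y + eta <= v y) ->
  (forall y, Omega y -> B y -> enorm (grad v y) <= c) ->
  (\forall y \near xq, ~ B y) -> S `<=` Omega ->
  (forall y, S y -> v y + eta <= u y <= v y + M) ->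
  0 < t0 -> (forall t, eta / 2 <= t <= M + eta / 2 -> t0 <= expinv 2 t) ->
  forall d : R, 0 < d -> exists phi, [/\ test_fun Omega phi,
     (\int[mu]_(x in Omega) `|u x - phi x|%:E <= d%:E)%E &
     forall T, measurable T -> T `<=` S ->
       (\int[mu]_(x in T) (enorm (grad phi x))%:E <= (c' * fine (mu T) +
          c' * c'^-1 `^ q / t0 * (2 * c `^ q * fine (mu Omega)) + d)%:E)%E].
Proof.
move=> oO bO q1 extu Oxq uxq cv v0 c0 c'0 eta0 HB Hc Hx SO HS t00 Ht d d0.
have [Wu cu u0 _ uL] := extu.
have ux1 := extremal_max_ge1 extu Oxq uxq.
have q1' := ltW q1; have q0 : 0 < q by apply: lt_trans q1.
have mO := open_measurable_rV oO.
have Oy := bounded_lebesgueN_lty mO bO.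
have [[mu_ [g ug] _ Ny] _] := Wu.
have ug' := wgradP ug.
have Nfin : normgrad Omega q%:E u \is a fin_num by rewrite ge0_fin_numE// normLp_ge0.
pose A := fine (normgrad Omega q%:E u).
have NA : normgrad Omega q%:E u = A%:E by rewrite fineK.
have A0 : 0 <= A by rewrite fine_ge0// normLp_ge0.
have LA : Lambda q Omega = (A `^ q)%:E by rewrite -uL NA poweR_EFin.
have mOfin : mu Omega \is a fin_num by rewrite ge0_fin_numE.
pose mO' := fine (mu Omega).
have mOE : mu Omega = mO'%:E by rewrite fineK.
have mO'0 : 0 < mO'.
  rewrite fine_gt0// Oy andbT; apply: lebesgueN_open_gt0 => //; by exists xq.
pose D := c `^ q * mO'.
have D0 : 0 < D by rewrite mulr_gt0// powR_gt0.
have D20 : 0 < D / 2 by rewrite divr_gt0.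
(* [e1] limits both the excess of the gradient norm of [phi] and the loss of height of the
   competitor; together they cost at most [D / 2]. *)
have [e1 /andP[e10 e11] He1] := powR_perturb q1' A0 D20.
have [Cv Cv0 HCv] := continuous_bounded_on bO (continuous_enorm_grad cv).
(* A neighbourhood of the peak off [B]: the barrier lies above [u] on it, so the truncation does not
   act where [phi] is close to [u]. *)
have [W [oW WO HW] W0] : exists2 W : set V, [/\ open W, W `<=` Omega &
    forall y, W y -> 1 - e1 / 2 < u y /\ u y + eta <= v y] & (0 < mu W)%E.
  have cux : {for xq, continuous u} by exact: continuous_within_open cu.
  have H1 : \forall y \near xq, 1 - e1 / 2 < u y.
    by apply: (cvgr_gt (u xq) cux); lra.
  have H2 : \forall y \near xq, Omega y by exact: open_nbhs_nbhs.
  have : nbhs xq [set y | [/\ 1 - e1 / 2 < u y, ~ B y & Omega y]].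
    by apply: filterS (filterI H1 (filterI Hx H2)) => y [? []].
  move=> /nbhs_ballP[r /= r0 Hr]; exists (ball xq r).
    split; first exact: ball_open.
    - by move=> y /Hr[].
    - by move=> y /Hr[h1 h2 h3]; split => //; exact: HB.
  by apply: lebesgueN_open_gt0; [exact: ball_open|exists xq; exact: ballxx].
have [mW mW0 mWle] : exists2 r : R, 0 < r & (r%:E <= mu W)%E.
  have Wy : (mu W < +oo)%E.
    apply: le_lt_trans Oy; apply: le_measure; rewrite ?inE//.
    exact: open_measurable_rV.
  exists (fine (mu W)); first by rewrite fine_gt0// W0.
  by rewrite fineK// ge0_fin_numE.
have X0 : 0 <= (A + 1) `^ q by exact: powR_ge0.
have d20 : 0 < d / 2 by rewrite divr_gt0.
(* [(A + 1) ^ q] bounds the total energy of the [phi] to be chosen, since [e1 < 1]. *)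
have [l l0 Hl] := powR_small q1 X0 d20.
(* Tolerance for the distance from [phi] to [u]: below [eta / 2] it preserves the sign of [u - v],
   and below [e1 / 2] it keeps the peak above [1 - e1]. *)
pose s := Num.min (eta / 2) (e1 / 2).
have s0 : 0 < s by rewrite lt_min !divr_gt0.
have seta : s <= eta / 2 by rewrite ge_min lexx.
have se1 : s <= e1 / 2 by rewrite ge_min lexx orbT.
have CvD : 0 < Cv `^ q + 1 by rewrite ltr_wpDl// powR_ge0.
(* [k] will bound the measure of the exceptional set. Its four conditions control, in order, the
   energy of [v] there, its size compared with [W], the gradient of [phi] there at level [l], and
   the $L^1$ distance from [phi] to [u]. *)
have [k [k0 [k1 [kC kW kl kd]]]] : exists k : R, 0 < k /\ k <= 1 /\
    [/\ Cv `^ q * k <= D / 2, k < mW, l * k <= d / 2 & s * k * (mO' + 1) <= d].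
  pose k := Num.min (Num.min 1 (D / 2 / (Cv `^ q + 1)))
    (Num.min (mW / 2) (Num.min (d / 2 / l) (d / (s * (mO' + 1))))).
  have sm : 0 < s * (mO' + 1) by rewrite mulr_gt0// addr_gt0.
  have k0 : 0 < k.
    by rewrite !lt_min ltr01 !divr_gt0.
  have [h1 h2 h3 h4 h5] : [/\ k <= 1, k <= D / 2 / (Cv `^ q + 1), k <= mW / 2,
      k <= d / 2 / l & k <= d / (s * (mO' + 1))].
    by rewrite /k; split; rewrite !ge_min lexx ?orbT.
  exists k; split => //; split => //; split.
  - move: h2; rewrite ler_pdivlMr// => h2; apply: le_trans h2.
    by rewrite mulrC ler_wpM2l ?(ltW k0)// lerDl.
  - by apply: le_lt_trans h3 _; lra.
  - by move: h4; rewrite ler_pdivlMr// mulrC.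
  - by move: h5; rewrite ler_pdivlMr// mulrA (mulrC k).
(* With this error Chebyshev's inequality bounds the exceptional set by [k ^ q], which is at most
   [k] because [k <= 1]. *)
pose e := s * k.
have e0 : 0 < e by rewrite mulr_gt0.
have ee1 : e <= e1.
  apply: (@le_trans _ _ s); last lra.
  by rewrite /e ler_piMr// ltW.
have [phi [tphi Nphi Gphi]] := W10_approx oO q1' Wu e0.
exists phi; have [cphi _ _] := tphi.
have mphi : measurable_fun Omega phi by exact: test_fun_measurable tphi.
have mD : measurable_fun Omega (fun x => u x - phi x) by exact: measurable_funB.
have Lq := normLp_powR_le mO q0 (ltW e0) Nphi.
pose Z := Omega `&` [set x | s <= `|u x - phi x|].
have mZ : measurable Z.
  by apply: measurable_fun_le => //; apply: measurableT_comp.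
have Zk : (mu Z <= k%:E)%E.
  apply: (le_trans (chebyshev_powR mO q0 s0 mD Lq)); rewrite lee_fin.
  rewrite /e powRM ?(ltW s0) ?(ltW k0)// mulrAC mulfV ?mul1r; last first.
    by rewrite gt_eqF// powR_gt0.
  by rewrite ge1r_powR// k0.
have Ephi : (\int[mu]_(x in Omega) (enorm (grad phi x) `^ q)%:E <= ((A + e1) `^ q)%:E)%E.
  have G1 := weak_grad_measurable ug'.
  have G2 := weak_grad_measurable (is_weak_grad_smooth oO cphi).
  have G3 := weak_grad_measurable (is_weak_grad_sub oO ug' tphi).
  have NG : (normLp Omega q%:E (fun x => enorm (grad phi x)) <= (A + e1)%:E)%E.
    apply: (@le_trans _ _ (normLp Omega q%:E (fun x => (enorm (wgrad Omega u x) +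
        enorm (wgrad Omega u x - grad phi x))%R))).
      apply: le_normLp => //; first exact: measurable_funD.
      apply: aeW => x _; rewrite !ger0_norm ?enorm_ge0 ?addr_ge0 ?enorm_ge0//.
      have := enormD (wgrad Omega u x) (- (wgrad Omega u x - grad phi x)).
      by rewrite enormN opprB addrC subrK.
    apply: (le_trans (normLp_triangle mO q1' G1 G3)).
    rewrite EFinD -NA; apply: leeD => //; apply: (le_trans Gphi).
    by rewrite lee_fin.
  have A10 : 0 <= A + e1 by rewrite addr_ge0// ltW.
  have := normLp_powR_le mO q0 A10 NG.
  by under eq_integral do rewrite ger0_norm ?enorm_ge0//.
pose w y := phi y - expinv 0 (phi y - v y).
have wlow : ((1 - e1)%:E <= normLp Omega +oo w)%E.
  apply: (@essup_lower _ _ Omega u v phi w W e1 s) => //.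
  - by move=> y Wy; have [? ?] := HW y Wy; split => //; lra.
  - by move=> y h; rewrite /w expinv_le0 ?subr0// subr_le0.
  - by apply: (le_lt_trans Zk); apply: lt_le_trans mWle; rewrite lte_fin.
(* On [Z] only the global bound [Cv] is known; on [B] off [Z] the slope is at most [c]; elsewhere
   [phi < v] and the weight vanishes. *)
have Hv x : Omega x ->
    expinv 2 (phi x - v x) * enorm (grad v x) `^ q <= c `^ q + Cv `^ q * \1_Z x.
  move=> Ox; have t01 := expinv_ge0 2 (phi x - v x); have t11 := expinv2_le1 (phi x - v x).
  have [Zx|Zx] := pselect (Z x).
    rewrite indicE mem_set// mulr1; apply: (@le_trans _ _ (Cv `^ q)).
      apply: (@le_trans _ _ (enorm (grad v x) `^ q)); first by rewrite ler_piMl// powR_ge0.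
      rewrite ge0_ler_powR ?(ltW q0)// ?nnegrE ?enorm_ge0 ?(ltW Cv0)//.
      by apply: le_trans (HCv x Ox); exact: ler_norm.
    by rewrite lerDr powR_ge0.
  rewrite indicE memNset// mulr0 addr0.
  have [Bx|Bx] := pselect (B x).
    apply: (@le_trans _ _ (enorm (grad v x) `^ q)); first by rewrite ler_piMl// powR_ge0.
    by rewrite ge0_ler_powR ?(ltW q0)// ?nnegrE ?enorm_ge0 ?(ltW c0)// Hc.
  rewrite expinv_le0 ?mul0r ?powR_ge0//.
  have /negP : ~ (s <= `|u x - phi x|) by move=> h; apply: Zx.
  rewrite -ltNge ltr_norml => /andP[h1 h2]; have := HB x Ox Bx; lra.
have e11' : 0 < 1 - e1 by lra.
have TE := theta_energy_bound oO bO q1' tphi cv v0 LA e11' wlow Ephi mZ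
  (powR_ge0 c q) (powR_ge0 Cv q) Hv.
(* The total [2 * D] consists of [D] from the slope [c], [D / 2] from the perturbed minimality, and
   [D / 2] from [Z]. *)
have TE2 : (\int[mu]_(x in Omega) (expinv 2 (phi x - v x) * enorm (grad phi x) `^ q)%:E <=
    (2 * c `^ q * mO')%:E)%E.
  apply: (le_trans TE).
  have le1 : ((Cv `^ q)%:E * mu Z <= (D / 2)%:E)%E.
    apply: (@le_trans _ _ ((Cv `^ q)%:E * k%:E)%E).
      by apply: lee_wpmul2l => //; rewrite lee_fin powR_ge0.
    by rewrite -EFinM lee_fin.
  apply: (le_trans (leeD (lexx _) le1)).
  rewrite mOE -EFinM -!EFinD lee_fin -powRM ?(ltW e11')//.
  have -> : 2 * c `^ q * mO' = 2 * D by rewrite /D mulrA.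
  rewrite -/D; lra.
split => //.
  apply: (le_trans (L1_le_Lq mO Oy q1' e0 mD Lq)); rewrite lee_fin.
  exact: kd.
move=> T mT TS.
have HtT x : T x -> ~ Z x -> t0 <= expinv 2 (phi x - v x).
  move=> Tx Zx; apply: Ht.
  have /andP[h1 h2] := HS x (TS x Tx).
  have Ox := SO x (TS x Tx).
  have /negP : ~ (s <= `|u x - phi x|) by move=> h; apply: Zx.
  by rewrite -ltNge ltr_norml => /andP[h3 h4]; apply/andP; split; lra.
apply: (le_trans (theta_gradient_bound mO mT (subset_trans TS SO) mZ q1' cphi cv
  t00 c'0 l0 HtT)).
have Tfin : mu T \is a fin_num.
  rewrite ge0_fin_numE//; apply: le_lt_trans Oy; apply: le_measure; rewrite ?inE//.
  exact: subset_trans TS SO.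
rewrite 2!EFinD; apply: leeD.
  apply: leeD; first by rewrite EFinM fineK.
  rewrite [leRHS]EFinM; apply: lee_wpmul2l; last exact: TE2.
  by rewrite lee_fin divr_ge0 ?(ltW t00)// mulr_ge0 ?powR_ge0// ltW.
rewrite [d]splitr EFinD; apply: leeD.
  apply: (@le_trans _ _ (l%:E * k%:E)%E); last by rewrite -EFinM lee_fin.
  by apply: lee_wpmul2l => //; rewrite lee_fin ltW.
apply: (@le_trans _ _ ((l * l^-1 `^ q)%:E * ((A + 1) `^ q)%:E)%E); last first.
  by rewrite -EFinM lee_fin.
apply: lee_wpmul2l; first by rewrite lee_fin mulr_ge0 ?powR_ge0// ltW.
apply: (le_trans Ephi); rewrite lee_fin ge0_ler_powR ?(ltW q0)// ?nnegrE.
- by rewrite addr_ge0// ltW.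
- by rewrite addr_ge0.
- by rewrite lerD2l ltW.
Qed.

End extremal.

(** * The distance to the boundary *)

Lemma enorm_sqrD {R : realType} {N : nat} (a b : 'rV[R]_N) :
  enorm (a + b) ^+ 2 = enorm a ^+ 2 + 2 * dot a b + enorm b ^+ 2.
Proof. by rewrite !enorm_sqr !dotE (dotC b a); ring. Qed.

Section distance.
Context {R : realType} {N : nat}.
Local Notation V := 'rV[R]_N.
Variable Omega : set V.
Hypotheses (oO : open Omega) (bO : bounded_set Omega) (bdry0 : bdry Omega !=set0).
Local Notation rho := (dist_bdry Omega).
Implicit Types (x y z h m : V).

Lemma closure_compact : compact (closure Omega).
Proof.
have [K cK OK] := bounded_sub_compact bO.
apply: (subclosed_compact _ cK); first exact: closed_closure.
rewrite [X in _ `<=` X](closure_id K).1; last exact: rV_compact_closed.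
exact: closure_subset.
Qed.

Lemma bdryE z : bdry Omega z <-> closure Omega z /\ ~ Omega z.
Proof. by rewrite /bdry ((interior_id Omega).1 oO). Qed.

Lemma closure_cases z : closure Omega z -> Omega z \/ bdry Omega z.
Proof.
by move=> cz; have [|nO] := pselect (Omega z); [left|right; apply/bdryE].
Qed.

Lemma bdry_compact : compact (bdry Omega).
Proof.
apply: (subclosed_compact _ closure_compact); last by move=> z [].
rewrite /bdry setDE; apply: closedI; first exact: closed_closure.
by apply: open_closedC; exact: open_interior.
Qed.

Lemma dist_has_inf x : has_inf [set enorm (y - x) | y in bdry Omega].
Proof.
split; first by have [y By] := bdry0; exists (enorm (y - x)), y.
by exists 0 => _ [y _ <-]; exact: enorm_ge0.
Qed.

Lemma dist_le x y : bdry Omega y -> rho x <= enorm (x - y).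
Proof.
by move=> By; apply: (ge_inf (dist_has_inf x).2); exists y => //; rewrite enormB.
Qed.

Lemma continuous_enorm_sub x : continuous (fun y : V => enorm (x - y)).
Proof.
apply: (@enorm_lip_continuous _ _ _ 1) => y z; rewrite mul1r.
apply: le_trans (enorm_lip _ _) _.
by rewrite opprB addrC addrA subrK enormB.
Qed.

Lemma dist_attained x : exists2 y, bdry Omega y & enorm (x - y) = rho x.
Proof.
have [y /[!inE] By Hy] := compact_EVT_min bdry0 bdry_compact
  (continuous_subspaceT (@continuous_enorm_sub x)).
exists y => //; apply/eqP; rewrite eq_le dist_le// andbT.
apply: lb_le_inf; first by exists (enorm (y - x)), y.
by move=> _ [z Bz <-]; rewrite [leRHS]enormB; apply: Hy; rewrite inE.
Qed.

Lemma dist_ge0 x : 0 <= rho x.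
Proof. by have [y _ <-] := dist_attained x; exact: enorm_ge0. Qed.

Lemma dist_lip x z : rho x <= rho z + enorm (x - z).
Proof.
have [y By <-] := dist_attained z; apply: le_trans (dist_le _ By) _.
by rewrite [leRHS]addrC; exact: enormB_le.
Qed.

Lemma continuous_dist : continuous rho.
Proof.
apply: (@enorm_lip_continuous _ _ _ 1) => x z; rewrite mul1r ler_norml.
have := dist_lip x z; have := dist_lip z x; rewrite (enormB z x) => ? ?.
by apply/andP; split; lra.
Qed.

Lemma dist_bdry_eq0 x : bdry Omega x -> rho x = 0.
Proof.
move=> Bx; apply/eqP; rewrite eq_le dist_ge0 andbT.
by apply: le_trans (dist_le _ Bx) _; rewrite subrr enorm0.
Qed.

Lemma dist_gt0 x : Omega x -> 0 < rho x.
Proof.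
move=> Ox; rewrite lt_neqAle dist_ge0 andbT eq_sym; apply/eqP => r0.
have [y /bdryE[_ nOy]] := dist_attained x; rewrite r0 => /enorm_eq0 /eqP.
by rewrite subr_eq0 => /eqP xy; rewrite xy in Ox.
Qed.

(** Boundary points are split by their direction from [x]. Those seen almost in the direction of [y]
    recede at speed at least [c]. The others form a compact set without nearest point, so they are
    farther than [d] by a fixed amount and cannot become nearest during a short motion. *)
Lemma dist_increase x y (c : R) : Omega x -> bdry Omega y -> enorm (x - y) = rho x ->
  (forall z, bdry Omega z -> enorm (x - z) = rho x -> z = y) -> 0 < c < 1 ->
  exists2 tau : R, 0 < tau & forall t : R, 0 < t < tau ->
    rho x + c * t <= rho (x + t *: ((rho x)^-1 *: (x - y))).
Proof.
move=> Ox By dxy uniq /andP[c0 c1].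
have d0 := dist_gt0 Ox; set d := rho x in dxy d0 uniq *.
set nu := d^-1 *: (x - y).
have nu1 : enorm nu = 1 by rewrite /nu -dxy; apply: enorm_scale_unit; rewrite dxy.
have nud : dot nu (x - y) = d.
  by rewrite /nu dotZl -enorm_sqr dxy expr2 mulrA mulVf ?mul1r// gt_eqF.
pose K := bdry Omega `&` [set z | dot nu (x - z) <= c * d].
have far : exists2 tau : R, 0 < tau & forall z, K z -> d + 2 * tau <= enorm (x - z).
  have [K0|K0] := pselect (K !=set0); last first.
    by exists 1 => // z Kz; case: K0; exists z.
  have cdot : continuous (fun z : V => dot nu (x - z)).
    apply: (@enorm_lip_continuous _ _ _ 1) => z1 z2.
    rewrite -dotBr; apply: le_trans (normr_dot_le _ _) _; rewrite nu1.
    by rewrite opprB addrC addrA subrK enormB.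
  have cK : compact K.
    apply: (subclosed_compact _ bdry_compact); last by move=> z [].
    apply: closedI; first exact: rV_compact_closed bdry_compact.
    have -> : [set z | dot nu (x - z) <= c * d] =
        (fun z => dot nu (x - z)) @^-1` [set s | s <= c * d] by [].
    by apply: closed_comp => [z _|]; [exact: cdot|exact: closed_le].
  have [z0 /[!inE] [[Bz0 /= Kz0]] Hz0] := compact_EVT_min K0 cK
    (continuous_subspaceT (@continuous_enorm_sub x)).
  have dz0 : d < enorm (x - z0).
    rewrite lt_neqAle dist_le// andbT; apply/eqP => E.
    have z0y : z0 = y by apply: uniq.
    by move: Kz0; rewrite z0y nud; rewrite -subr_ge0; nra.
  exists ((enorm (x - z0) - d) / 2); first by lra.
  by move=> z Kz; have := Hz0 z; rewrite inE => /(_ Kz); lra.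
have [tau tau0 Htau] := far; exists tau => // t /andP[t0 ttau].
have [z Bz ez] := dist_attained (x + t *: nu); rewrite -ez.
have [Kz|nKz] := pselect (K z).
  have e1 : enorm (x + t *: nu - x) = t.
    by rewrite (addrC x) addrK enormZ nu1 mulr1 gtr0_norm.
  have h1 := Htau z Kz.
  have := dist_lip (x + t *: nu) x; rewrite e1 -ez -/d => h2.
  have := enormB_le x (x + t *: nu) z; rewrite (enormB x (x + t *: nu)) e1 => h3.
  lra.
have hz : c * d < dot nu (x - z).
  by rewrite ltNge; apply/negP => h; apply: nKz.
(* For the receding points, with $\nu$ the direction of motion, $|x+t\nu-z|^2\ge
   d^2+2tcd+t^2\ge(d+ct)^2$. *)
rewrite -(@ler_pXn2r _ 2)// ?nnegrE ?enorm_ge0//; last first.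
  by rewrite addr_ge0 ?mulr_ge0// ltW.
have -> : x + t *: nu - z = (x - z) + t *: nu by rewrite addrAC.
rewrite enorm_sqrD enormZ nu1 dotZr (dotC (x - z)) mulr1 gtr0_norm//.
have h1 := dist_le x Bz; rewrite -/d in h1.
have : d ^+ 2 <= enorm (x - z) ^+ 2.
  by rewrite lerXn2r// nnegrE ?enorm_ge0// ltW.
move: (dot nu (x - z)) (enorm (x - z) ^+ 2) hz => s P hz hP.
have tc : t * (c * d) <= t * s by rewrite ler_pM2l// ltW.
have t2 : (c * t) ^+ 2 <= t ^+ 2.
  rewrite lerXn2r// ?nnegrE ?mulr_ge0 ?(ltW t0) ?(ltW c0)//.
  by rewrite ler_piMl ?(ltW t0)// ltW.
nra.
Qed.

End distance.

(** * Growth of the distance and competing nearest points *)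

Section nearest_points.
Context {R : realType} {N : nat}.
Local Notation V := 'rV[R]_N.
Variable Omega : set V.
Hypotheses (oO : open Omega) (bO : bounded_set Omega) (bdry0 : bdry Omega !=set0).
Local Notation rho := (dist_bdry Omega).
Implicit Types (x y z h m : V).

Definition unique_nearest x :=
  exists! z, bdry Omega z /\ enorm (x - z) = rho x.

Lemma dist_increase_near x (c : R) : Omega x -> unique_nearest x -> 0 < c < 1 ->
  exists2 z, Omega z & [/\ z != x & rho x + c * enorm (z - x) <= rho z].
Proof.
move=> Ox [y [[By dy] uniq]] c01.
have [|tau tau0 Htau] := @dist_increase R N Omega oO bO bdry0 x y c Ox By dy _ c01.
  by move=> z Bz dz; apply/esym/uniq.
set nu := (rho x)^-1 *: (x - y) in Htau.
have nu1 : enorm nu = 1.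
  by rewrite /nu -dy; apply: enorm_scale_unit; rewrite dy; exact: dist_gt0.
have /nbhs_ballP[r /= r0 Hr] : nbhs x Omega by exact: open_nbhs_nbhs.
pose t := Num.min tau r / 2.
have m0 : 0 < Num.min tau r by rewrite lt_min tau0 r0.
have t0 : 0 < t by rewrite divr_gt0.
have tm : t < Num.min tau r by rewrite /t; lra.
have [ttau tr] : t < tau /\ t < r by move: tm; rewrite lt_min => /andP[].
have e1 : enorm (x + t *: nu - x) = t.
  by rewrite (addrC x) addrK enormZ nu1 mulr1 gtr0_norm.
exists (x + t *: nu).
  apply: Hr; rewrite -ball_normE/= -normrN opprB; apply: le_lt_trans tr.
  by rewrite -[leRHS]e1; exact: norm_le_enorm.
split; last by rewrite e1; apply: Htau; rewrite t0.
by apply/eqP => E; move: e1; rewrite E subrr enorm0 => h; rewrite -h ltxx in t0.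
Qed.

(* Ekeland-type argument: a maximum point of [rho w - c |w - y|] can only be the
   exceptional point, because elsewhere rho increases at a speed larger than c. *)
Lemma dist_cone_le x0 : (forall y, Omega y -> y <> x0 -> unique_nearest y) ->
  forall y, Omega y -> rho y + enorm (y - x0) <= rho x0.
Proof.
move=> Huniq y Oy.
have cone (c : R) : 0 < c < 1 -> rho y + c * enorm (y - x0) <= rho x0.
  move=> c01; pose f w := rho w - c * enorm (y - w).
  have cf : continuous f.
    apply: (@enorm_lip_continuous _ _ _ 2) => w1 w2.
    have h1 := dist_lip bO bdry0 w1 w2; have h2 := dist_lip bO bdry0 w2 w1.
    rewrite (enormB w2) in h2.
    have h3 := enormB_le y w1 w2; have h4 := enormB_le y w2 w1.
    rewrite (enormB w2) in h4; case/andP: c01 => c0 c1.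
    have h5 := enorm_ge0 (w1 - w2).
    by rewrite /f ler_norml; apply/andP; split; nra.
  have c0 : closure Omega !=set0 by exists y; exact: subset_closure.
  have [w /[!inE] Cw Hw] := compact_EVT_max c0 (closure_compact bO) (continuous_subspaceT cf).
  have fy : f y = rho y by rewrite /f subrr enorm0 mulr0 subr0.
  have fyw : rho y <= f w by rewrite -fy; apply: Hw; rewrite inE; exact: subset_closure.
  have y0 := dist_gt0 oO bO bdry0 Oy.
  have cge : 0 <= c * enorm (y - w) by rewrite mulr_ge0 ?enorm_ge0//; case/andP: c01 => /ltW.
  (* On the boundary [rho] vanishes, so [f w <= 0 < f y] and [w] would not be a maximum point. *)
  have [Ow|Bw] := closure_cases oO Cw; last first.
    by move: fyw; rewrite /f (dist_bdry_eq0 bO bdry0 Bw); lra.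
  have [wx0|wx0] := eqVneq w x0.
    by rewrite wx0 /f in fyw; lra.
  (* A speed strictly between [c] and 1 gains more than the penalty of slope [c] can cost. *)
  have [|z Oz [zw Hz]] := @dist_increase_near w ((1 + c) / 2) Ow (Huniq w Ow (elimN eqP wx0)).
    by case/andP: c01 => ? ?; apply/andP; split; lra.
  have := Hw z; rewrite !inE => /(_ (subset_closure Oz)); rewrite /f => fz.
  have := enormB_le y w z; rewrite (enormB w z) => h.
  have e0 : 0 < enorm (z - w).
    rewrite lt_neqAle enorm_ge0 andbT eq_sym; apply: contra_neq zw => /enorm_eq0.
    by move=> /eqP; rewrite subr_eq0 => /eqP.
  by case/andP: c01 => ? ?; nra.
apply/ler_addgt0Pr => e e0.
pose D := enorm (y - x0); have D0 : 0 <= D by exact: enorm_ge0.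
(* The slope [1 - r] is admissible and loses at most [r * D <= e] against slope 1. *)
pose r := Num.min 2^-1 (e / (D + 1)).
have D1 : 0 < D + 1 by lra.
have r0 : 0 < r by rewrite lt_min invr_gt0 ltr0n/= divr_gt0.
have r1 : r <= 2^-1 by rewrite ge_min lexx.
have re : r * (D + 1) <= e by rewrite -ler_pdivlMr// ge_min lexx orbT.
have := cone (1 - r); rewrite -/D => /(_ ltac:(apply/andP; split; lra)); nra.
Qed.

(** Each nearest point alone bounds [rho] by a paraboloid whose slope at [x] is a unit vector.
    Averaging the two bounds gives the mean of two distinct unit vectors, which is shorter than
    1. *)
Lemma two_nearest x y1 y2 : Omega x -> bdry Omega y1 -> bdry Omega y2 -> y1 <> y2 ->
  enorm (x - y1) = rho x -> enorm (x - y2) = rho x ->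
  exists2 m, enorm m < 1 & forall z,
    rho z <= rho x + dot m (z - x) + enorm (z - x) ^+ 2 / (2 * rho x).
Proof.
move=> Ox B1 B2 y12 e1 e2; have d0 := dist_gt0 oO bO bdry0 Ox.
set d := rho x in e1 e2 d0 *.
(* AM-GM: 2 d |z - y| <= |z - y|^2 + d^2 *)
have one y z : bdry Omega y -> enorm (x - y) = d ->
    rho z <= d + d^-1 * dot (x - y) (z - x) + enorm (z - x) ^+ 2 / (2 * d).
  move=> By ey; apply: (le_trans (dist_le bdry0 z By)).
  have E : enorm (z - y) ^+ 2 = d ^+ 2 + 2 * dot (x - y) (z - x) + enorm (z - x) ^+ 2.
    by rewrite -ey -enorm_sqrD [X in _ = enorm X ^+ 2]addrC subrKA.
  have -> : d + d^-1 * dot (x - y) (z - x) + enorm (z - x) ^+ 2 / (2 * d) =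
      (enorm (z - y) ^+ 2 + d ^+ 2) / (2 * d).
    by rewrite E; field; rewrite gt_eqF.
  rewrite ler_pdivlMr ?mulr_gt0//; have := sqr_ge0 (enorm (z - y) - d); nra.
have dn : d != 0 by rewrite gt_eqF.
exists ((2 * d)^-1 *: ((x - y1) + (x - y2))); last first.
  move=> z; have h1 := one y1 z B1 e1; have h2 := one y2 z B2 e2.
  rewrite invfM in h1 h2; rewrite dotZl dotDl invfM.
  move: h1 h2; move: d^-1 (dot _ _) (dot _ _) (_ ^+ 2) => i s1 s2 q h1 h2.
  lra.
have d2 : 0 < 2 * d by rewrite mulr_gt0.
rewrite enormZ gtr0_norm ?invr_gt0// mulrC ltr_pdivrMr// mul1r.
rewrite -(@ltr_pXn2r _ 2)// ?nnegrE ?enorm_ge0 ?(ltW d2)//.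
(* Parallelogram identity: $|(x-y_1)+(x-y_2)|^2=4d^2-|y_2-y_1|^2$. *)
have := enorm_sqrD (x - y1) (x - y2); have := enorm_sqrD (x - y1) (- (x - y2)).
rewrite enormN dotNr e1 e2.
have -> : x - y1 - (x - y2) = y2 - y1 by rewrite opprB addrC subrKA.
have : 0 < enorm (y2 - y1) ^+ 2.
  rewrite exprn_even_gt0//=; apply/eqP => /enorm_eq0/eqP; rewrite subr_eq0 => /eqP y21.
  by apply: y12.
move: (enorm _ ^+ 2) (enorm _ ^+ 2) (dot _ _) => A B C; nra.
Qed.

End nearest_points.

(** * Lipschitz bounds for limits *)

Section pointwise.
Context {R : realType} {N : nat}.
Local Notation V := 'rV[R]_N.
Local Notation mu := (lebesgueN R N).
Implicit Types (f u : V -> R) (Omega S T : set V) (x y h : V).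

Lemma average_close f x (e e0 : R) : 0 < e -> 0 < e0 -> {for x, continuous f} ->
  (forall r : R, 0 < r < e0 -> measurable_fun (cube x r) f) ->
  exists2 r0 : R, 0 < r0 & forall r, 0 < r < r0 ->
    `|\int[mu]_(y in cube x r) f y - f x * (2 * r) ^+ N| <= e * (2 * r) ^+ N.
Proof.
move=> e_gt0 e0_gt0 /(@cvgrPdist_le _ _ _ (nbhs x)) /(_ e e_gt0).
move=> /nbhs_ballP[r1 /= r10 Hr1] mf.
exists (Num.min e0 r1) => [|r /andP[r0]]; first by rewrite lt_min e0_gt0.
rewrite lt_min => /andP[re0 rr1].
have mQ := measurable_cube x r.
have muQ := lebesgueN_cube x (ltW r0).
have Qlty : (mu (cube x r) < +oo)%E by rewrite muQ ltry.
have fin : forall y, cube x r y -> `|f x - f y| <= e.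
  move=> y Qy; apply: Hr1; rewrite -ball_normE/= distrC.
  by apply: le_lt_trans rr1; apply: cube_norm (ltW r0) _.
have mfr : measurable_fun (cube x r) f by apply: mf; rewrite r0.
have If : mu.-integrable (cube x r) (EFin \o f).
  apply: (@bounded_integrable R N _ _ (`|f x| + e)) => // y Qy.
  by have := fin y Qy; have := lerB_dist (f y) (f x); rewrite distrC; lra.
have Ic (c : R) : mu.-integrable (cube x r) (EFin \o cst c).
  by apply: (@bounded_integrable R N _ _ `|c|).
have cst_int (c : R) : \int[mu]_(y in cube x r) c = c * (2 * r) ^+ N.
  have muF : fine (mu (cube x r)) = (2 * r) ^+ N by rewrite muQ.
  rewrite -muF; exact: (@Rintegral_cst _ _ _ mu _ mQ c).
rewrite ler_norml lerBlDr lerBrDl -mulNr -!mulrDl -!cst_int.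
have le_int (f1 f2 : V -> R) : mu.-integrable (cube x r) (EFin \o f1) ->
    mu.-integrable (cube x r) (EFin \o f2) -> (forall y, cube x r y -> f1 y <= f2 y) ->
    \int[mu]_(y in cube x r) f1 y <= \int[mu]_(y in cube x r) f2 y.
  by move=> I1 I2 H; apply: le_Rintegral.
by apply/andP; split; apply: le_int; [exact: Ic|exact: If| |exact: If|exact: Ic|] => y /fin;
  rewrite ler_distl => /andP[? ?]; lra.
Qed.

(** [average_lipschitz] on cubes shrinking to [x], divided by their volume, gives the pointwise
    bound by continuity at both ends. The neighbourhood of size [e1] makes [S] contain the whole
    tube swept by the cubes. *)
Lemma lipschitz_of_approx Omega u S x h (L e1 : R) : open Omega -> bounded_set Omega ->
  measurable_fun Omega u -> {for x, continuous u} -> {for x + h, continuous u} ->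
  Omega x -> Omega (x + h) -> 0 < e1 ->
  (forall t y, 0 <= t <= 1 -> `|y - x| < e1 -> S (y + t *: h)) ->
  (forall d : R, 0 < d -> exists phi, [/\ test_fun Omega phi,
     (\int[mu]_(x in Omega) `|u x - phi x|%:E <= d%:E)%E &
     forall T, measurable T -> (mu T < +oo)%E -> T `<=` S ->
       (\int[mu]_(x in T) (enorm (grad phi x))%:E <= (L * fine (mu T) + d)%:E)%E]) ->
  `|u (x + h) - u x| <= enorm h * L.
Proof.
move=> oO bO mu_ cx cxh Ox Oxh e1_gt0 HS H.
have cxh' : {for x, continuous (fun y => u (y + h))}.
  by apply: (@continuous_comp _ _ _ (fun y => y + h) u); [exact: continuous_shift|].
have [e0 e00 [e01 HO]] : exists2 e : R, 0 < e & e <= e1 /\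
    forall y, `|y - x| < e -> Omega y /\ Omega (y + h).
  have : nbhs x [set y | Omega y /\ Omega (y + h)].
    apply: filterI; first exact: open_nbhs_nbhs.
    by apply: (@continuous_shift R N h x); exact: open_nbhs_nbhs.
  move=> /nbhs_ballP[e /= e0' He]; exists (Num.min e1 e); first by rewrite lt_min e1_gt0.
  split; first by rewrite ge_min lexx.
  by move=> y; rewrite lt_min => /andP[_ h1]; apply: He; rewrite -ball_normE/= distrC.
have {}HS t y : 0 <= t <= 1 -> `|y - x| < e0 -> S (y + t *: h).
  by move=> t01 h1; apply: HS t01 _; exact: lt_le_trans e01.
have Qx r y : 0 < r < e0 -> cube x r y -> `|y - x| < e0.
  by move=> /andP[r0 re] /(cube_norm (ltW r0)) h1; apply: le_lt_trans re.
have QO r : 0 < r < e0 -> cube x r `<=` Omega.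
  by move=> r0 y /(Qx r y r0) /HO[].
have QhO r : 0 < r < e0 -> forall y, cube x r y -> Omega (y + h).
  by move=> r0 y /(Qx r y r0) /HO[].
have mO := open_measurable_rV oO.
have m1 r : 0 < r < e0 -> measurable_fun (cube x r) u.
  by move=> r0; apply: measurable_funS mu_ => //; exact: QO.
have m2 r : 0 < r < e0 -> measurable_fun (cube x r) (fun y => u (y + h)).
  move=> r0; apply: (@measurable_comp _ _ _ _ _ _ Omega u _ (fun y => y + h)) => //.
    by move=> _ [y Qy <-]; exact: QhO r0 _ Qy.
  by apply: measurable_funTS; exact: measurable_shift.
apply/ler_addgt0Pr => e e_gt0.
have e2 : 0 < e / 2 by lra.
have [r1 r10 Hr1] := average_close e2 e00 cx m1.
have [r2 r20 Hr2] := average_close e2 e00 cxh' m2.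
pose r := Num.min e0 (Num.min r1 r2) / 2.
have [r0 re0 rr1 rr2] : [/\ 0 < r, r < e0, r < r1 & r < r2].
  have m0 : 0 < Num.min e0 (Num.min r1 r2) by rewrite !lt_min e00 r10.
  have : r < Num.min e0 (Num.min r1 r2) by rewrite /r; lra.
  by rewrite !lt_min => /and3P[? ? ?]; split => //; rewrite divr_gt0.
have h1 := Hr1 r; rewrite r0 rr1 in h1; have {}h1 := h1 isT.
have h2 := Hr2 r; rewrite r0 rr2 in h2; have {}h2 := h2 isT.
have r0e : 0 < r < e0 by rewrite r0.
have mu_Q : fine (mu (cube x r)) = (2 * r) ^+ N by rewrite lebesgueN_cube// ltW.
have m0 : 0 < (2 * r) ^+ N by rewrite exprn_gt0// mulr_gt0.
have h3 : `|\int[mu]_(y in cube x r) u (y + h) - \int[mu]_(y in cube x r) u y| <=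
    enorm h * (L * (2 * r) ^+ N).
  apply: (average_lipschitz (S := S) oO bO mu_ (measurable_cube x r)).
  - have [M [Mr HM]] := bO; exists M; split => // a Ma y Qy.
    by apply: (HM a Ma); exact: QO r0e _ Qy.
  - exact: QO r0e.
  - exact: QhO r0e.
  - by move=> t y t01 /(Qx r y r0e) /(HS t y t01).
  - move=> d d0; have [phi [tp h3 HT]] := H d d0; exists phi; split => // T mT TS muT.
    rewrite -mu_Q -muT; apply: HT => //.
    by rewrite muT lebesgueN_cube ?ltW// ltry.
rewrite -(ler_pM2r m0); move: h1 h2 h3.
move: (\int[mu]_(y in _) _) (\int[mu]_(y in _) _) (_ ^+ N) m0 (u x) (u (x + h)) (enorm h).
move=> I1 I2 m m0 a b n.
have -> : `|b - a| * m = `|(b - a) * m| by rewrite normrM (gtr0_norm m0).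
rewrite !ler_norml => /andP[h11 h12] /andP[h21 h22] /andP[h31 h32].
by apply/andP; split; nra.
Qed.

End pointwise.

(** * A global Lipschitz bound from zero boundary values *)

Section lipschitz.
Context {R : realType} {N : nat}.
Local Notation V := 'rV[R]_N.
Local Notation mu := (lebesgueN R N).
Implicit Types (f u : V -> R) (Omega S T : set V) (x y h : V).

Lemma grad_test0 Omega phi x : test_fun Omega phi -> ~ Omega x -> grad phi x = 0.
Proof.
move=> [_ _ sO] nOx; apply/rowP => i; rewrite !mxE.
apply: contra_notP nOx => /eqP p0; apply: sO.
apply: (@partial_supp R N (closure [set x | phi x != 0]) phi i x _ _ p0).
  exact: closed_closure.
by move=> z h; apply: subset_closure.
Qed.

(** [T] is not confined to [Omega]: outside it the gradient of a test function vanishes, and inside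
    it differs from a gradient bounded by [M] by a small error in $L^1$. *)
Lemma normgradoo_approx Omega u (M d : R) : open Omega -> 0 <= M ->
  W10 1 Omega u -> (normgrad Omega +oo u <= M%:E)%E -> 0 < d ->
  exists phi, [/\ test_fun Omega phi,
     (\int[mu]_(x in Omega) `|u x - phi x|%:E <= d%:E)%E &
     forall T, measurable T -> (mu T < +oo)%E ->
       (\int[mu]_(x in T) (enorm (grad phi x))%:E <= (M * fine (mu T) + d)%:E)%E].
Proof.
move=> oO M0 Wu uM d0; have mO := open_measurable_rV oO.
have [phi [tphi L1 L2]] := W10_approx oO (lexx 1) Wu d0.
have to_int f : (normLp Omega 1%:E f <= d%:E)%E ->
    (\int[mu]_(x in Omega) `|f x|%:E <= d%:E)%E.
  move=> h; have := normLp_powR_le mO (@ltr01 R) (ltW d0) h.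
  have -> : (fun x => (`|f x| `^ 1)%:E) = (fun x => `|f x|%:E).
    by apply/funext => x; rewrite powRr1.
  by rewrite (powRr1 (ltW d0)).
exists phi; split => //; first exact: (to_int _ L1).
move=> T mT Ty.
have [cphi _ _] := tphi; have [[_ [g ug] _ _] _] := Wu; have ug' := wgradP ug.
pose F x := enorm (wgrad Omega u x - grad phi x).
have F0 x : 0 <= F x by exact: enorm_ge0.
have {}L2 : (\int[mu]_(x in Omega) (F x)%:E <= d%:E)%E.
  apply: le_trans (to_int _ L2); rewrite le_eqVlt; apply/orP; left; apply/eqP.
  by apply: eq_integral => x _; rewrite ger0_norm ?enorm_ge0.
have mF : measurable_fun Omega F.
  apply: (@measurable_fun_enorm R N Omega (fun x => wgrad Omega u x - grad phi x)) => i.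
  have -> : (fun x => (wgrad Omega u x - grad phi x) 0 i) =
      (fun x => wgrad Omega u x 0 i - grad phi x 0 i) by apply/funext => x; rewrite !mxE.
  apply: measurable_funB; last exact: grad_measurable.
  by have [_ /(_ i)[]] := ug'.
have mFO : measurable_fun setT (F \_ Omega) by apply/(measurable_restrictT _ mO).
have F0' x : 0 <= (F \_ Omega) x by rewrite patchE; case: ifPn.
apply: (@le_trans _ _ (\int[mu]_(x in T) (M + (F \_ Omega) x)%:E)%E).
  apply: ae_ge0_le_integral => //.
  - by move=> x _; rewrite lee_fin enorm_ge0.
  - apply/measurable_EFinP.
    exact: (@continuous_measurable_on R N T _ (continuous_enorm_grad cphi)).
  - by move=> x _; rewrite lee_fin addr_ge0.
  - apply/measurable_EFinP; apply: measurable_funD => //; exact: measurable_funTS.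
  - apply: filterS (le_normLpoo Omega (fun x => enorm (wgrad Omega u x))) => x Hx _.
    rewrite lee_fin patchE; case: ifPn => [/set_mem Ox|/negP nO].
      have := le_trans (Hx Ox) uM; rewrite lee_fin ger0_norm ?enorm_ge0// => h.
      have := enormD (wgrad Omega u x) (grad phi x - wgrad Omega u x).
      by rewrite addrC subrK enormB -/(F x); lra.
    rewrite (grad_test0 tphi) ?enorm0 ?addr0// => Ox; apply: nO; exact: mem_set.
under eq_integral do rewrite EFinD.
rewrite ge0_integralD//; last 2 first.
- by move=> x _; rewrite lee_fin.
- by apply/measurable_EFinP; exact: measurable_funTS.
rewrite (integral_cst mu mT) EFinD EFinM fineK ?ge0_fin_numE//.
apply: leeD => //; apply: le_trans L2.
apply: (@le_trans _ _ (\int[mu]_x ((F \_ Omega) x)%:E)%E).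
  apply: ge0_subset_integral => //; last by move=> x _; rewrite lee_fin.
  exact/measurable_EFinP.
by rewrite [leRHS]integral_mkcond restrict_EFin.
Qed.

(** The segment from [x] to [y] may leave [Omega], since the approximations are controlled on the
    whole space; hence [S] is [setT] and the bound involves the Euclidean distance. *)
Lemma lipschitz_normgradoo Omega u (M : R) : open Omega -> bounded_set Omega -> 0 <= M ->
  W10 1 Omega u -> (forall x, Omega x -> {for x, continuous u}) ->
  (normgrad Omega +oo u <= M%:E)%E ->
  forall x y, Omega x -> Omega y -> `|u y - u x| <= enorm (y - x) * M.
Proof.
move=> oO bO M0 Wu cu uM x y Ox Oy.
have [[mu_ _ _ _] _] := Wu.
have yE : x + (y - x) = y by rewrite addrC subrK.
rewrite -[y in u y]yE; apply: (lipschitz_of_approx (Omega := Omega) (S := setT) (e1 := 1)) => //.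
- exact: (cu x Ox).
- by rewrite yE; exact: (cu y Oy).
- by rewrite yE.
- move=> d d0; have [phi [tphi h1 h2]] := normgradoo_approx oO M0 Wu uM d0.
  by exists phi; split => // T mT Ty _; exact: h2.
Qed.


End lipschitz.

(** * The normalised distance and sufficiency of unique nearest points *)

Section sup_distance.
Context {R : realType} {N : nat}.
Local Notation V := 'rV[R]_N.
Local Notation mu := (lebesgueN R N).
Implicit Types (f g u : V -> R) (Omega S T : set V) (x y h : V).

Lemma continuous_closure_eq Omega f g : {within closure Omega, continuous f} ->
  continuous g -> (forall y, Omega y -> f y = g y) ->
  forall y, closure Omega y -> f y = g y.
Proof.
move=> /subspace_continuousP cf cg fg y Cy; apply/eqP; rewrite -subr_eq0 -normr_le0.
apply/ler_addgt0Pr => e e0; rewrite add0r.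
have e2 : 0 < e / 2 by lra.
have : nbhs y [set z | (closure Omega z -> `|f y - f z| < e / 2) /\ `|g y - g z| < e / 2].
  apply: filterI.
    by have /(@cvgrPdist_lt _ _ _ (within (closure Omega) (nbhs y))) /(_ _ e2) := cf y Cy.
  by have /(@cvgrPdist_lt _ _ _ (nbhs y)) /(_ _ e2) := cg y.
move=> /Cy[z [Oz [/(_ (subset_closure Oz))]]].
rewrite (fg z Oz) => /ltW h1 /ltW h2; apply: le_trans (ler_distD (g z) _ _) _.
by rewrite (distrC (g z)); lra.
Qed.

(** The infimum of the empty set is 0 by convention. *)
Lemma dist_bdry_empty Omega x : ~ (bdry Omega !=set0) -> dist_bdry Omega x = 0.
Proof.
move=> B0; rewrite /dist_bdry (_ : [set _ | _ in _] = set0) ?inf0//.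
by apply/seteqP; split => // z [y By _]; apply: B0; exists y.
Qed.

(** An empty boundary or a zero [sup_dist] would make the quotient bounding [u] vanish, against
    [u x = 1]; continuity turns the almost everywhere bounds into pointwise ones. *)
Lemma sup_dist_facts Omega u x : open Omega -> bounded_set Omega -> Omega x ->
  (forall y, Omega y -> {for y, continuous u}) -> u x = 1 ->
  (\forall y \ae mu, Omega y -> 0 <= u y /\ u y <= dist_bdry Omega y / sup_dist Omega) ->
  [/\ bdry Omega !=set0, 0 < sup_dist Omega,
    forall y, Omega y -> u y <= dist_bdry Omega y / sup_dist Omega &
    forall y, closure Omega y -> dist_bdry Omega y <= sup_dist Omega].
Proof.
move=> oO bO Ox cu ux Hu.
have crho : continuous (dist_bdry Omega).
  have [B0|B0] := pselect (bdry Omega !=set0); first exact: continuous_dist.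
  by rewrite (_ : dist_bdry Omega = cst 0); [exact: cst_continuous|apply/funext => y; exact: dist_bdry_empty].
have ule y : Omega y -> u y <= dist_bdry Omega y / sup_dist Omega.
  move=> Oy; rewrite -subr_ge0; move: y Oy; apply: (continuous_ae_ge0 oO).
    move=> y Oy; apply: continuousB; last exact: cu.
    by apply: continuousM; [exact: crho|exact: cst_continuous].
  by apply: filterS Hu => y h /h[_]; rewrite subr_ge0.
have S0 : 0 < sup_dist Omega.
  rewrite lt_neqAle fine_ge0 ?normLp_ge0// andbT eq_sym; apply/eqP => S0.
  by have := ule x Ox; rewrite ux S0 invr0 mulr0; lra.
have B0 : bdry Omega !=set0.
  by apply: contrapT => B0; have := ule x Ox; rewrite ux dist_bdry_empty// mul0r; lra.
split => // y Cy; have [Oy|By] := closure_cases oO Cy; last first.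
  by rewrite (dist_bdry_eq0 bO B0 By) ltW.
rewrite -subr_ge0; move: y Oy {Cy}.
apply: (continuous_ae_ge0 oO).
  by move=> y Oy; apply: continuousB; [exact: cst_continuous|exact: crho].
apply: filterS (le_normLpoo Omega (dist_bdry Omega)) => y Hy Oy.
(* [fine] gives 0 at infinite values, so positivity of [sup_dist] makes the essential supremum
   finite. *)
have := Hy Oy; rewrite /sup_dist in S0 *; case: (normLp _ _ _) S0 => [s| |]/= s0.
- by rewrite lee_fin => h; rewrite subr_ge0; apply: le_trans h; exact: ler_norm.
- by rewrite ltxx in s0.
- by [].
Qed.

Lemma eq_dist_of_unique_nearest Omega u xs :
  open Omega -> bounded_set Omega -> Omega xs ->
  {within closure Omega, continuous u} -> u xs = 1 ->
  W10 1 Omega u -> normgrad Omega +oo%E u = ((sup_dist Omega)^-1)%:E ->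
  (\forall y \ae mu, Omega y -> 0 <= u y /\ u y <= dist_bdry Omega y / sup_dist Omega) ->
  dist_bdry Omega xs = sup_dist Omega ->
  (exists x0 : V, unique (is_max_point (closure Omega) (dist_bdry Omega)) x0 /\
     forall y, Omega y -> y <> x0 -> unique_nearest Omega y) ->
  forall y, closure Omega y -> u y = dist_bdry Omega y / sup_dist Omega.
Proof.
move=> oO bO Oxs cu uxs Wu nu Hu dxs [x0 [[_ x0u] nearest]].
have cu' y : Omega y -> {for y, continuous u}.
  by move=> Oy; exact: continuous_within_open cu.
have [B0 S0 ule rS] := sup_dist_facts oO bO Oxs cu' uxs Hu.
have x0E : x0 = xs.
  apply: x0u; split; first exact: subset_closure.
  by move=> y /rS; rewrite dxs.
rewrite x0E in nearest.
apply: (continuous_closure_eq cu).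
  move=> y; apply: continuousM; last exact: cst_continuous.
  exact: continuous_dist.
move=> y Oy; apply/eqP; rewrite eq_le ule//=.
have cone := dist_cone_le oO bO B0 nearest Oy.
have Si0 : 0 <= (sup_dist Omega)^-1 by rewrite invr_ge0 ltW.
have := lipschitz_normgradoo oO bO Si0 Wu cu' _ Oxs Oy.
rewrite nu lexx => /(_ isT); rewrite uxs ler_norml => /andP[h _].
rewrite ler_pdivrMr//; have := ler_pM2r S0; move=> E; move: h; rewrite -E.
rewrite mulrBl mulNr mul1r -mulrA mulVf ?gt_eqF// mulr1.
by move: cone; rewrite dxs; lra.
Qed.

End sup_distance.

(** * Barriers and the limit of extremals *)

Section barrier.
Context {R : realType} {N : nat}.
Local Notation V := 'rV[R]_N.
Local Notation mu := (lebesgueN R N).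
Implicit Types (f g u v : V -> R) (Omega S T B : set V) (x y h m : V).

Definition paraboloid (a b : R) m x : V -> R :=
  fun z => a + dot m (z - x) + b * enorm (z - x) ^+ 2.

Lemma cinfty_paraboloid a b m x : cinfty (paraboloid a b m x).
Proof.
apply/cinftyP => n.
have -> : paraboloid a b m x = fun z => a +
    \sum_(i <- index_enum 'I_N) (m 0 i * (z 0 i + - x 0 i) +
      b * ((z 0 i + - x 0 i) * (z 0 i + - x 0 i))).
  apply/funext => z; rewrite /paraboloid enorm_sqr /dot big_split/= -mulr_sumr addrA.
  by congr (_ + _ + b * _); apply: eq_bigr => i _; rewrite !mxE.
have C i : Ck n (fun z : V => z 0 i + - x 0 i).
  by apply: Ck_D; [exact: Ck_coord|exact: Ck_cst].
apply: Ck_D; first exact: Ck_cst.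
apply: Ck_sum => i; apply: Ck_D; apply: Ck_Z; first exact: C.
by apply: Ck_M; exact: C.
Qed.

Lemma grad_paraboloid a b m x z :
  grad (paraboloid a b m x) z = m + (2 * b) *: (z - x).
Proof.
apply/rowP => i; rewrite !mxE; apply: partialE.
rewrite -[z in is_derive z]add0r -(scale0r (delta_mx 0 i)); apply/is_derive_line.
rewrite (_ : (fun _ => _) = (fun t : R => paraboloid a b m x z +
    (m 0 i + 2 * b * (z 0 i - x 0 i)) * t + b * t ^+ 2)); last first.
  apply/funext => t; rewrite /paraboloid.
  have -> : t *: delta_mx 0 i + z - x = (z - x) + t *: delta_mx 0 i by rewrite -addrA addrC.
  rewrite enorm_sqrD.
  rewrite dotDr !dotZr (dotC m (delta_mx 0 i)) (dotC (z - x) (delta_mx 0 i)) !dot_delta !mxE enormZ enorm_delta mulr1.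
  by rewrite real_normK ?num_real//; ring.
apply: is_derive_eq.
by rewrite /GRing.scale/=; ring.
Qed.

Lemma powR_lt_eps (r e : R) : 0 < r < 1 -> 0 < e ->
  exists q0 : R, forall q, q0 <= q -> r `^ q <= e.
Proof.
move=> /andP[r0 r1] e0; have lr : ln r < 0 by rewrite ln_lt0// r0.
exists (ln e / ln r) => q; rewrite ler_ndivrMr// => h.
by rewrite -[leRHS]lnK ?posrE// /powR gt_eqF// ler_expR.
Qed.

(** The margins are [2 * eta] so that replacing [u] by an extremal within [eta] of it still leaves
    the margin [eta]. The remaining error is a constant times $(c/c')^q$, which tends to 0 because
    $c<c'$. *)
Lemma limit_gradient_bound Omega u v (xs : V) B S (c c' eta M : R) :
  open Omega -> bounded_set Omega -> measurable_fun Omega u ->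
  (forall (q0 e : R) (W : set V), 0 < e -> nbhs xs W -> exists q w xq,
     [/\ q0 <= q, positive_extremal q Omega w, Omega xq /\ W xq,
       forall y, Omega y -> w y <= w xq & forall y, Omega y -> `|w y - u y| <= e]) ->
  cinfty v -> (forall y, 0 <= v y) -> 0 < c -> c < c' -> 0 < eta ->
  (forall y, Omega y -> ~ B y -> u y + 2 * eta <= v y) ->
  (forall y, Omega y -> B y -> enorm (grad v y) <= c) ->
  (\forall y \near xs, ~ B y) -> S `<=` Omega ->
  (forall y, S y -> v y + 2 * eta <= u y <= v y + M) ->
  forall d : R, 0 < d -> exists phi, [/\ test_fun Omega phi,
     (\int[mu]_(x in Omega) `|u x - phi x|%:E <= d%:E)%E &
     forall T, measurable T -> (mu T < +oo)%E -> T `<=` S ->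
       (\int[mu]_(x in T) (enorm (grad phi x))%:E <= (c' * fine (mu T) + d)%:E)%E].
Proof.
move=> oO bO mu_ Hseq cv v0 c0 cc' eta0 HB Hc Hx SO HS d d0.
have mO := open_measurable_rV oO.
have Oy := bounded_lebesgueN_lty mO bO.
have c'0 : 0 < c' by apply: lt_trans cc'.
have eta2 : 0 < eta / 2 by rewrite divr_gt0.
(* The lower bound of the weight depends only on [eta] and [M], so it can be fixed before the
   exponent; the constant [C] below is then independent of [q]. *)
have [t0 t00 Ht0] := expinv2_lower (M + eta + eta / 2) eta2.
set mO' := fine (mu Omega).
have mO'0 : 0 <= mO' by exact: fine_ge0.
have m1 : 0 < mO' + 1 by lra.
pose C := c' / t0 * (2 * mO').
have C0 : 0 <= C by rewrite mulr_ge0//; [apply: divr_ge0; apply: ltW|apply: mulr_ge0].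
have eC : 0 < d / (2 * (C + 1)) by rewrite divr_gt0 ?mulr_gt0//; lra.
have r01 : 0 < c / c' < 1 by rewrite divr_gt0//= ltr_pdivrMr// mul1r.
have [q0 Hq0] := powR_lt_eps r01 eC.
pose e := Num.min eta (d / (2 * (mO' + 1))).
have e0 : 0 < e by rewrite lt_min eta0 divr_gt0// mulr_gt0.
have ee : e <= eta by rewrite ge_min lexx.
have ed : e * mO' <= d / 2.
  apply: (@le_trans _ _ (e * (mO' + 1))); first by rewrite ler_pM2l//; lra.
  rewrite -ler_pdivlMr// -mulrA -invfM ge_min; apply/orP; right.
  by rewrite lexx.
(* The bound 2 ensures [q > 1]; the interior is taken because a whole neighbourhood of the maximum
   point has to avoid [B]. *)
have [q [w [xq [qq0 ext [Oxq Bxq] wmax wu]]]] := Hseq (Num.max q0 2) e _ e0 (nbhs_interior Hx).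
have [q0q q2] : q0 <= q /\ 2 <= q by move: qq0; rewrite ge_max => /andP[].
have q1 : 1 < q by lra.
have d2 : 0 < d / 2 by rewrite divr_gt0.
have HB' y : Omega y -> ~ B y -> w y + eta <= v y.
  by move=> Oy' nB; have := HB y Oy' nB; have := wu y Oy'; rewrite ler_distl => /andP[? ?]; lra.
have HS' y : S y -> v y + eta <= w y <= v y + (M + eta).
  move=> Sy; have := HS y Sy; have := wu y (SO y Sy).
  by rewrite ler_distl => /andP[? ?] /andP[? ?]; apply/andP; split; lra.
have [phi [tphi L1 HT]] := extremal_gradient_bound oO bO q1 ext Oxq wmax cv v0 c0 c'0 eta0
  HB' Hc Bxq SO HS' t00 Ht0 d2.
have [cphi _ _] := tphi.
have mphi : measurable_fun Omega phi by exact: test_fun_measurable tphi.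
have [[[mw _ _ _] _] _ _ _ _] := ext.
have mabs f1 f2 : measurable_fun Omega f1 -> measurable_fun Omega f2 ->
    measurable_fun Omega (fun x => (`|f1 x - f2 x|)%:E).
  move=> h1 h2; apply/measurable_EFinP; apply: measurableT_comp => //.
  exact: measurable_funB.
exists phi; split => //.
  have -> : d = d / 2 + d / 2 by lra.
  rewrite EFinD.
  apply: (@le_trans _ _ (\int[mu]_(x in Omega) (`|u x - w x|%:E + `|w x - phi x|%:E))%E).
    apply: ge0_le_integral => //; last 1 first.
    - by move=> x _; rewrite -EFinD lee_fin; exact: ler_distD.
    - exact: mabs.
    - by apply: emeasurable_funD; exact: mabs.
  rewrite ge0_integralD//; [|exact: mabs|exact: mabs].
  apply: leeD => //.
  apply: (@le_trans _ _ (\int[mu]_(x in Omega) (cst e%:E x))%E).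
    apply: ge0_le_integral => //; first exact: mabs.
    by move=> x Ox; rewrite lee_fin distrC; exact: wu.
  apply: (@le_trans _ _ (e * mO')%:E); last by rewrite lee_fin.
  by rewrite (integral_cst mu mO) EFinM fineK ?ge0_fin_numE.
move=> T mT Ty TS; apply: le_trans (HT T mT TS) _; rewrite lee_fin.
have -> : c' * c'^-1 `^ q / t0 * (2 * c `^ q * mO') = C * (c / c') `^ q.
  rewrite powRM ?invr_ge0 ?(ltW c0) ?(ltW c'0)// /C.
  by move: (c'^-1 `^ q) (c `^ q) (t0^-1) => *; ring.
have : C * (c / c') `^ q <= d / 2.
  apply: (@le_trans _ _ (C * (d / (2 * (C + 1))))); first by rewrite ler_wpM2l// Hq0.
  rewrite mulrA ler_pdivrMr ?mulr_gt0//; last by lra.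
  by have := mulr_ge0 C0 (ltW d0); nra.
by move: (C * _) (c' * _) => ? ?; lra.
Qed.

End barrier.

(** * Necessity of unique nearest points *)

Section forward.
Context {R : realType} {N : nat}.
Local Notation V := 'rV[R]_N.
Implicit Types (f g u v : V -> R) (Omega T B : set V) (x y h m : V).

(* Where two nearest points compete the bound of two_nearest has slope |m| < 1; lowering
   that paraboloid at its vertex and steepening it gives a barrier crossing the distance
   only near x, with a gradient still below 1 there. *)
Lemma paraboloid_barrier Omega x m (d : R) (xs : V) : open Omega -> Omega x -> x != xs ->
  0 < d -> enorm m < 1 ->
  (forall z, dist_bdry Omega z <= d + dot m (z - x) + enorm (z - x) ^+ 2 / (2 * d)) ->
  (forall z, d - enorm (z - x) <= dist_bdry Omega z) ->
  (forall z, 0 <= dist_bdry Omega z) ->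
  exists a b r s c eta : R, let v := paraboloid a b m x in
    [/\ [/\ 0 < s, 0 < eta, 0 < c & c < 1], forall z, 0 <= v z,
     forall z, 2 * r < enorm (z - x) -> dist_bdry Omega z + 2 * eta <= v z,
     forall z, enorm (z - x) <= 2 * r -> enorm (grad v z) <= c &
     2 * r < enorm (xs - x) /\
     forall z, enorm (z - x) <= s -> v z + 2 * eta <= dist_bdry Omega z /\ Omega z].
Proof.
move=> oO Ox xxs d0 m1 rle rge rho0.
set m1' := enorm m in m1.
have m0 : 0 <= m1' by exact: enorm_ge0.
(* On the ball of radius [2 * r] the slope of the barrier is at most [m1' + 2 * b * (2 * r)], that
   is [m1' + 4 * k = 1 - 12 * k]. *)
pose k := (1 - m1') / 16.
have k0 : 0 < k by rewrite /k; lra.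
have k16 : 16 * k = 1 - m1' by rewrite /k; field.
have k1 : k <= 16^-1 by lra.
have xs0 : 0 < enorm (xs - x).
  rewrite lt_neqAle enorm_ge0 andbT eq_sym; apply: contra_neq xxs => /enorm_eq0.
  by move=> /eqP; rewrite subr_eq0 => /eqP.
(* [r <= k * d] gives [b >= 1 / d], so that half of [b] already dominates the coefficient
   [1 / (2 * d)]; the other bound keeps [xs] outside the ball of radius [2 * r]. *)
pose r := Num.min (k * d) (enorm (xs - x) / 3).
have r0 : 0 < r by rewrite lt_min mulr_gt0//= divr_gt0.
have rk : r <= k * d by rewrite ge_min lexx.
have rxs : r <= enorm (xs - x) / 3 by rewrite ge_min lexx orbT.
have /nbhs_ballP[e /= e0 He] : nbhs x Omega by exact: open_nbhs_nbhs.
(* Within distance [s] of [x] the variations of the barrier and of the distance do not use up the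
   drop [k * r / 2] at [x]; [e / 2] keeps this ball inside [Omega]. *)
pose s := Num.min (k * r / 12) (e / 2).
have s0 : 0 < s by rewrite lt_min !divr_gt0// mulr_gt0.
have sk : s <= k * r / 12 by rewrite ge_min lexx.
have se : s < e by have : s <= e / 2 by [rewrite ge_min lexx orbT]; lra.
pose b := k / r; have b0 : 0 < b by rewrite divr_gt0.
have br : b * r = k by rewrite /b divfK// gt_eqF.
(* Beyond distance [2 * r] the spare half of [b] gains at least [2 * k * r], more than the drop
   [k * r / 2] and the margin [2 * eta = k * r / 4] together. *)
exists (d - k * r / 2), b, r, s, (m1' + 4 * k), (k * r / 8).
pose v := paraboloid (d - k * r / 2) b m x; rewrite /= -/v.
have far z : 2 * r < enorm (z - x) -> dist_bdry Omega z + 2 * (k * r / 8) <= v z.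
  move=> hz; have := rle z; rewrite /v /paraboloid.
  have : enorm (z - x) ^+ 2 / (2 * d) <= b / 2 * enorm (z - x) ^+ 2.
    rewrite mulrC ler_wpM2r ?sqr_ge0// invfM mulrC ler_pM2r// -[leLHS]mul1r.
    by rewrite /b ler_pdivrMr// mulrAC ler_pdivlMr// mul1r.
  have : b * (4 * r ^+ 2) <= b * enorm (z - x) ^+ 2 by rewrite ler_pM2l//; nra.
  have -> : b * (4 * r ^+ 2) = 4 * (k * r) by rewrite -br; ring.
  have kr : 0 < k * r by rewrite mulr_gt0.
  have h0 : 0 <= b * enorm (z - x) ^+ 2 by rewrite mulr_ge0 ?sqr_ge0// ltW.
  move: (_ ^+ 2) h0 => q h0.
  by move: (k * r) kr (_ / (2 * d)) (dot m _) (dist_bdry Omega z) => kr *; lra.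
have bnd z : `|dot m (z - x)| <= enorm (z - x).
  apply: le_trans (normr_dot_le _ _) _; rewrite ler_piMl ?enorm_ge0//; exact: ltW m1.
split => //.
- by split => //; [rewrite divr_gt0// mulr_gt0|lra|lra].
- move=> z; have [hz|hz] := ltP (2 * r) (enorm (z - x)).
    by have := far z hz; have := rho0 z; have : 0 < k * r by [rewrite mulr_gt0]; lra.
  rewrite /v /paraboloid.
  have : 0 <= b * enorm (z - x) ^+ 2 by rewrite mulr_ge0 ?sqr_ge0// ltW.
  have := bnd z; rewrite ler_norml => /andP[h1 _].
  have : k * d <= 16^-1 * d by rewrite ler_pM2r.
  have : k * r <= 16^-1 * r by rewrite ler_pM2r.
  lra.
- move=> z hz; rewrite /v grad_paraboloid; apply: le_trans (enormD _ _) _.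
  have b2 : 0 < 2 * b by lra.
  have : b * enorm (z - x) <= b * (2 * r) by rewrite ler_pM2l.
  by rewrite lerD2l enormZ (gtr0_norm b2) -br; lra.
split; first by lra.
move=> z hz; split.
  have := rge z; rewrite /v /paraboloid.
  have := bnd z; rewrite ler_norml => /andP[_ h1].
  have h2 : enorm (z - x) <= k * r / 12 by apply: le_trans sk.
  have h3 : b * enorm (z - x) ^+ 2 <= b * (k * r / 12) ^+ 2.
    by rewrite ler_pM2l// lerXn2r// nnegrE ?enorm_ge0//; lra.
  have h4 : b * (k * r / 12) ^+ 2 = k * k * (k * r) / 144.
    have -> : b * (k * r / 12) ^+ 2 = b * r * k * (k * r) / 144 by field.
    by rewrite br.
  have kr : 0 < k * r by rewrite mulr_gt0.
  have h5 : k * k * (k * r) <= 1 * (k * r) by rewrite ler_pM2r//; nra.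
  by move: (k * r) kr h2 h3 h4 h5 => kr *; lra.
apply: He; rewrite -ball_normE/= -normrN opprB; apply: le_lt_trans (norm_le_enorm _) _.
exact: le_lt_trans se.
Qed.

Lemma unique_nearest_of_limit Omega u (xs : V) :
  open Omega -> bounded_set Omega -> bdry Omega !=set0 -> measurable_fun Omega u ->
  (forall (q0 e : R) (W : set V), 0 < e -> nbhs xs W -> exists q w xq,
     [/\ q0 <= q, positive_extremal q Omega w, Omega xq /\ W xq,
       forall y, Omega y -> w y <= w xq & forall y, Omega y -> `|w y - u y| <= e]) ->
  0 < sup_dist Omega ->
  (forall y, closure Omega y -> dist_bdry Omega y <= sup_dist Omega) ->
  (forall y, Omega y -> u y = dist_bdry Omega y / sup_dist Omega) ->
  forall x, Omega x -> x <> xs -> unique_nearest Omega x.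
Proof.
move=> oO bO B0 mu_ Hseq S0 rS uE x Ox /eqP xxs; apply: contrapT => nuniq.
set S := sup_dist Omega in S0 rS uE.
have Si0 : 0 < S^-1 by rewrite invr_gt0.
have d0 := dist_gt0 oO bO B0 Ox; set d := dist_bdry Omega x in d0.
have [y1 By1 e1] := dist_attained bO B0 x.
have [y2 [By2 e2 y12]] : exists y2, [/\ bdry Omega y2, enorm (x - y2) = d & y1 <> y2].
  apply: contrapT => h; apply: nuniq; exists y1; split => // z [Bz ez].
  by apply: contrapT => y1z; apply: h; exists z.
have [m m1 rle] := two_nearest oO bO B0 Ox By1 By2 y12 e1 e2.
have rge z : d - enorm (z - x) <= dist_bdry Omega z.
  by have := dist_lip bO B0 x z; rewrite (enormB x) -/d; lra.
have [a [b [r [s [c [eta]]]]]] := paraboloid_barrier oO Ox xxs d0 m1 rle rge (dist_ge0 bO B0).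
set V0 := paraboloid a b m x => -[[s0 eta0 c0 c1] V0ge far near [xsr Hs]].
pose v := paraboloid (S^-1 * a) (S^-1 * b) (S^-1 *: m) x.
have vE z : v z = S^-1 * V0 z by rewrite /v /V0 /paraboloid dotZl; ring.
have gv z : grad v z = S^-1 *: grad V0 z.
  rewrite /v /V0 !grad_paraboloid [RHS]scalerDr [in RHS]scalerA; congr (_ + _ *: _); ring.
have cont y : Omega y -> {for y, continuous u}.
  move=> Oy; have h : {for y, continuous (fun z => dist_bdry Omega z / S)}.
    by apply: continuousM; [exact: continuous_dist|exact: cst_continuous].
  suff : \forall z \near y, dist_bdry Omega z / S = u z.
    move=> /near_eq_cvg E; have := cvg_trans E h.
    by rewrite /prop_for /continuous_at -(uE y Oy).
  by apply: filterS (open_nbhs_nbhs (conj oO Oy)) => z Oz; rewrite uE.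
pose B := [set z | enorm (z - x) <= 2 * r].
pose Q := [set z : V | enorm (z - x) <= s].
pose c' := (1 + c) / 2.
have cc' : c / S < c' / S by rewrite ltr_pM2r// /c'; lra.
have HB y : Omega y -> ~ B y -> u y + 2 * (eta / S) <= v y.
  move=> Oy /negP; rewrite -ltNge => /far h; rewrite uE// vE mulrA -mulrDl mulrC.
  by rewrite ler_pM2l.
have Hc y : Omega y -> B y -> enorm (grad v y) <= c / S.
  by move=> _ /near h; rewrite gv enormZ gtr0_norm// mulrC ler_pM2r.
have Hx : \forall y \near xs, ~ B y.
  have ce : {for xs, continuous (fun z : V => enorm (x - z))} by exact: continuous_enorm_sub.
  have : \forall z \near xs, 2 * r < enorm (x - z).
    by apply: (cvgr_gt (enorm (x - xs)) ce); rewrite enormB.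
  by apply: filterS => z h; apply/negP; rewrite -ltNge enormB.
have QO : Q `<=` Omega by move=> z /Hs[].
have v0 z : 0 <= v z by rewrite vE mulr_ge0// ltW.
(* The upper constant 1 is enough, since [v] is nonnegative and [rho] is at most its maximum [S]. *)
have HQ y : Q y -> v y + 2 * (eta / S) <= u y <= v y + 1.
  move=> Qy; have [h Oy] := Hs y Qy; rewrite uE//; apply/andP; split.
    by rewrite vE [S^-1 * _]mulrC mulrA -mulrDl ler_pM2r.
  have : dist_bdry Omega y / S <= 1 by rewrite ler_pdivrMr// mul1r rS//; exact: subset_closure.
  by have := v0 y; lra.
have H := limit_gradient_bound oO bO mu_ Hseq (cinfty_paraboloid _ _ _ _) v0
  (divr_gt0 c0 S0) cc' (divr_gt0 eta0 S0) HB Hc Hx QO HQ.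
pose t := Num.min (s / 2) d.
have t0 : 0 < t by rewrite lt_min d0 divr_gt0.
have ts : t <= s / 2 by rewrite ge_min lexx.
have td : t <= d by rewrite ge_min lexx orbT.
pose nu := d^-1 *: (x - y1).
have nu1 : enorm nu = 1 by rewrite /nu /d -e1 enorm_scale_unit// e1.
pose h := - (t *: nu).
have eh : enorm h = t by rewrite enormN enormZ nu1 mulr1 gtr0_norm.
have N1 : 0 < N%:R + 1 :> R by rewrite ltr_wpDl.
(* The Euclidean norm is at most [N] times the sup norm: an offset below [e3] uses at most half of
   the radius [s], and the displacement [t <= s / 2] the other half. *)
pose e3 := s / 2 / (N%:R + 1).
have e30 : 0 < e3 by rewrite !divr_gt0.
have seg (tau : R) y : 0 <= tau <= 1 -> `|y - x| < e3 -> Q (y + tau *: h).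
  move=> /andP[t1 t2] yx; rewrite /Q/=.
  have -> : y + tau *: h - x = (y - x) + tau *: h by rewrite addrAC.
  apply: le_trans (enormD _ _) _; rewrite enormZ eh ger0_norm//.
  have : tau * t <= t by rewrite ler_piMl// ltW.
  have := enorm_le_norm (y - x).
  have : N%:R * `|y - x| <= N%:R * e3 by rewrite ler_wpM2l// ltW.
  have : (N%:R + 1) * e3 = s / 2 by rewrite /e3 mulrC divfK// gt_eqF.
  by rewrite mulrDl mul1r; lra.
have Qxh : Q (x + h).
  by have := seg 1 x; rewrite scale1r subrr normr0 lexx ler01; apply.
have Oxh := QO _ Qxh.
have := lipschitz_of_approx oO bO mu_ (cont x Ox) (cont _ Oxh) Ox Oxh e30 seg H.
rewrite eh !uE// -/d.
(* Moving by [t] straight towards [y1] lowers the distance by at least [t], whereas the Lipschitz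
   bound allows only [t * c'] with [c' < 1]. *)
have le1 : dist_bdry Omega (x + h) <= d - t.
  apply: le_trans (dist_le B0 (x + h) By1) _.
  have -> : x + h - y1 = (1 - t / d) *: (x - y1).
    by rewrite scalerBl scale1r /h /nu scalerA addrAC.
  rewrite enormZ e1 -/d ger0_norm; last by rewrite subr_ge0 ler_pdivrMr// mul1r.
  by rewrite mulrBl mul1r divfK// gt_eqF.
rewrite -mulrBl mulrA normrM (gtr0_norm Si0) ler_pM2r// ler_norml => /andP[h1 _].
have : t * c' < t * 1 by rewrite ltr_pM2l// /c'; lra.
lra.
Qed.

End forward.

Lemma uniform_closure_dist {R : realType} {N : nat} (A : set 'rV[R]_N)
    (w : ('rV[R]_N -> R)^nat) (u : 'rV[R]_N -> R) (e : R) : 0 < e ->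
  {uniform A, w @ \oo --> u} -> \forall n \near \oo, forall y, A y -> `|w n y - u y| <= e.
Proof.
move=> e0 wu; have := wu [set g | forall y, A y -> `|g y - u y| <= e]; apply.
apply/uniform_nbhs; exists [set xy : R * R | ball xy.1 e xy.2].
split; first exact: (entourage_ball R (PosNum e0)).
by move=> g H y Ay; have := H y Ay; rewrite -ball_normE/= distrC => /ltW.
Qed.

Theorem theorem3p14 (R : realType) (N : nat) (Omega : set 'rV[R]_N)
  (u : R -> 'rV[R]_N -> R) (x : R -> 'rV[R]_N)
  (p : R^nat) (xstar : 'rV[R]_N) (uoo : 'rV[R]_N -> R)
  (hN : (2 <= N)%N)
  (hO : smooth_domain Omega) (hOb : bounded_set Omega)
  (hu : forall q : R, N%:R < q -> positive_extremal q Omega (u q))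
  (hx : forall q : R, N%:R < q ->
     Omega (x q) /\ unique (is_max_point (closure Omega) (u q)) (x q))
  (hpN : forall n, N%:R < p n)
  (hp : p n @[n --> \oo] --> +oo)
  (hxstar : Omega xstar)
  (huoo : W10oo Omega uoo)
  (ha_weak : forall r : R, N%:R < r -> weak_cvg_W10 r Omega (fun n => u (p n)) uoo)
  (ha_unif : {uniform closure Omega, (fun n => u (p n)) @ \oo --> uoo})
  (hb : normgrad Omega +oo%E uoo = ((sup_dist Omega)^-1)%:E)
  (hc : \forall y \ae lebesgueN R N,
     Omega y -> 0 <= uoo y /\ uoo y <= dist_bdry Omega y / sup_dist Omega)
  (hd : x (p n) @[n --> \oo] --> xstar)
  (he_u : uoo xstar = 1) (he_norm : normLp Omega +oo%E uoo = 1%E)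
  (he_rho : dist_bdry Omega xstar = sup_dist Omega) :
  (forall y, closure Omega y -> uoo y = dist_bdry Omega y / sup_dist Omega) <->
  (exists x0 : 'rV[R]_N,
     unique (is_max_point (closure Omega) (dist_bdry Omega)) x0 /\
     forall y, Omega y -> y <> x0 ->
       exists! z, bdry Omega z /\ enorm (y - z) = dist_bdry Omega y).
Proof.
have [_ oO _ _] := hO.
have cu : {within closure Omega, continuous uoo}.
  apply: (@uniform_limit_continuous_subspace _ _ _ ((fun n => u (p n)) @ \oo)) ha_unif.
  by near_simpl; apply: nearW => n; have [] := hu (p n) (hpN n).
have [[muoo _ _ _] Wu1] := huoo.
have cu' y : Omega y -> {for y, continuous uoo}.
  by move=> Oy; exact: continuous_within_open cu.
have [B0 S0 _ rS] := sup_dist_facts oO hOb hxstar cu' he_u hc.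
split; last first.
  exact: (eq_dist_of_unique_nearest oO hOb hxstar cu he_u Wu1 hb hc he_rho).
move=> uE.
have nearest : forall y, Omega y -> y <> xstar -> unique_nearest Omega y.
  apply: (unique_nearest_of_limit oO hOb B0 muoo _ S0 rS) => [q0 e W e0 nW|y Oy]; last first.
    by apply: uE; exact: subset_closure.
  have [n [pq Wx unif]] : exists n, [/\ q0 <= p n, W (x (p n)) &
      forall y, closure Omega y -> `|u (p n) y - uoo y| <= e].
    have H1 : \forall n \near \oo, q0 <= p n by move/cvgryPge : hp; apply.
    have H2 : \forall n \near \oo, W (x (p n)) by exact: hd nW.
    have H3 := uniform_closure_dist e0 ha_unif.
    by near \oo => n; exists n; split; near: n.
  have [Oxq [[_ xqmax] _]] := hx (p n) (hpN n).
  exists (p n), (u (p n)), (x (p n)); split.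
  - exact: pq.
  - exact: hu (hpN n).
  - by split.
  - by move=> y /subset_closure; exact: xqmax.
  - by move=> y /subset_closure; exact: unif.
exists xstar; split => //; split.
  by split; [exact: subset_closure|move=> y /rS; rewrite he_rho].
(* A second maximum point would have a unique nearest boundary point by [nearest], and [rho] would
   then still increase close to it; any speed in the open unit interval serves, here one half. *)
move=> x1 [Cx1 x1max]; apply: contrapT => /nesym x1s.
have Sx1 : sup_dist Omega <= dist_bdry Omega x1.
  by rewrite -he_rho; apply: x1max; exact: subset_closure.
have [Ox1|Bx1] := closure_cases oO Cx1; last first.
  by move: Sx1; rewrite (dist_bdry_eq0 hOb B0 Bx1) leNgt S0.
have h01 : 0 < (2^-1 : R) < 1 by rewrite invr_gt0 invf_lt1 ?ltr0n ?ltr1n.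
have [z Oz [zx hz]] := dist_increase_near oO hOb B0 Ox1 (nearest x1 Ox1 x1s) h01.
have := x1max z (subset_closure Oz).
have : 0 < enorm (z - x1).
  rewrite lt_neqAle enorm_ge0 andbT eq_sym; apply: contra_neq zx => /enorm_eq0/eqP.
  by rewrite subr_eq0 => /eqP.
by lra.
Unshelve. all: by end_near.
Qed.
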